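(* Let $f$ be a non-constant entire function of finite order. Let $\alpha(r)$ be an arbitrary function such that $\alpha(r)\to0$ as $r\to\infty$, and let $\eta=\eta(r)\in\mathbb{C}$ satisfy $0<|\eta|<\alpha(r)$, with $f$ not $\eta$-periodic. Then $$\sum_{a\in\mathbb{C}}\pi_\eta(a,f)\leq1-\delta(0,f').$$
   Context: $m,N,T$ are the standard Nevanlinna functions; finite order means $\limsup_{r\to\infty}\frac{\log^+T(r,f)}{\log r}<\infty$. For $c\in\mathbb{C}\setminus\{0\}$ such that $f$ is not $c$-periodic and $a\in\mathbb{C}$, let $n_c(r,a,f)$ count the points $z_0$ with $|z_0|\le r$ and $f(z_0)=a=f(z_0+c)$ (called $c$-separated $a$-pairs), each according to the number of equal terms at the beginning of the Taylor expansions of $f$ at $z_0$ and at $z_0+c$, and let $$N_c(r,a,f)=\int_0^r\frac{n_c(t,a,f)-n_c(0,a,f)}{t}\,dt+n_c(0,a,f)\log r .$$ The $\eta$-separated pair index of $a$ is obtained by substituting $c=\eta$, with $\eta=\eta(r)$ at radius $r$: $$\pi_\eta(a,f)=\liminf_{r\to\infty}\frac{N_{\eta}(r,a,f)}{T(r,f)} .$$ The deficiency is $\delta(0,f')=\liminf_{r\to\infty}\frac{m(r,1/f')}{T(r,f')}$. The sum over $a\in\mathbb{C}$ of non-negative terms is the supremum of its finite partial sums. *)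

(* Defs.v *)
From HB Require Import structures.
From mathcomp Require Import all_boot all_order all_algebra.
From mathcomp Require Import all_classical all_reals all_analysis.
From mathcomp Require Import complex.

Set Implicit Arguments.
Unset Strict Implicit.
Unset Printing Implicit Defensive.

Import Order.TTheory GRing.Theory Num.Theory.
Import numFieldNormedType.Exports.
Import Normc.

Local Open Scope classical_set_scope.
Local Open Scope ring_scope.

(* The library equips every numFieldType with its own topology, but not yet the
   concrete type R[i]; this makes R[i] a normed module over itself, with the
   topology of the modulus. *)
#[warnings="-redundant-canonical-projection"]
HB.instance Definition _ (R : realType) :=
  NormedModule.copy R[i] ((R[i] : numFieldType)^o).

Section Nevanlinna.
Variable R : realType.
Local Notation C := R[i].
Implicit Types (f : C -> C) (a c z : C) (r t : R).

(* Complex differentiability: [derivable] is taken over the field C itself. *)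
Definition entire f := forall z, derivable f z 1.

(* [ln 0 = 0] in the library, so [logp 0 = 0] as usual. *)
Definition logp (x : R) : R := Num.max 0 (ln x).

Definition circle_point r (theta : R) : C :=
  ((r * cos theta) +i* (r * sin theta))%C.

(* The modulus is [normc : C -> R]; the library's [`|z|] lives in C. *)
Definition m_proximity f r : R :=
  (2 * pi)^-1 *
  \int[lebesgue_measure]_(theta in `[0, 2 * pi])
    logp (normc (f (circle_point r theta))).

(* Points of the closed disc, each counted [mult z] times. The sum is over the
   points with [mult z != 0] and is 0 by convention if there are infinitely
   many of them. *)
Definition counting (mult : C -> nat) r : R :=
  \sum_(z \in [set z | normc z <= r]) ((mult z)%:R : R).

Definition integrated_counting (mult : C -> nat) r : R :=
  \int[lebesgue_measure]_(t in `[0, r])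
     ((counting mult t - counting mult 0) / t)
  + counting mult 0 * ln r.

(* Meromorphic functions are total maps with arbitrary values at the poles; the
   order of a pole is the k > 0 for which (w - z)^k f(w) has a finite nonzero
   limit at z. It is 0 when there is no such k. *)
Definition pole_order f z : nat :=
  xget 0%N [set k | (0 < k)%N /\
    exists2 l : C, l != 0 & (w - z) ^+ k * f w @[w --> z^'] --> l].

Definition N_poles f r : R := integrated_counting (pole_order f) r.

Definition T_char f r : R := m_proximity f r + N_poles f r.

Definition finite_order f : Prop :=
  (limf_esup (fun r => (logp (T_char f r) / ln r)%:E) (pinfty_nbhs R) < +oo)%E.

Definition taylor_coef f z (j : nat) : C := (f^`(j))%classic z / j`!%:R.

(* The index of the first pair of distinct coefficients, i.e. the number of
   equal terms before it. It exists at every point when f is entire and not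
   c-periodic. *)
Definition equal_initial_terms f c z : nat :=
  xget 0%N [set k |
    (forall j, (j < k)%N -> taylor_coef f z j = taylor_coef f (z + c) j) /\
    taylor_coef f z k != taylor_coef f (z + c) k].

Definition pair_mult f c a z : nat :=
  if (f z == a) && (f (z + c) == a) then equal_initial_terms f c z else 0%N.

Definition N_pairs f c a r : R := integrated_counting (pair_mult f c a) r.

Definition pair_index f (eta : R -> C) a : \bar R :=
  limf_einf (fun r => (N_pairs f (eta r) a r / T_char f r)%:E) (pinfty_nbhs R).

(* delta(0, g). Real division by 0 yields 0, which matters only when
   T(r, g) = 0: for g constant of modulus at most 1 the deficiency is 0. *)
Definition deficiency0 (g : C -> C) : \bar R :=
  limf_einf (fun r => (m_proximity (fun z => (g z)^-1) r / T_char g r)%:E)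
            (pinfty_nbhs R).

End Nevanlinna.

(* Main.v *)
(* Put g = (f(z + eta) - f(z)) / eta. The number of equal initial Taylor terms at a
   separated pair is the order of the zero of g there, so for distinct a_1, .., a_q the
   sum of the N_eta(r, a_j) is at most the Jensen sum of g over rho < |z| <= r, that is
   the increase of the circle mean of log|g| from rho to r; for fixed a_j there are no
   pairs in a small disc |z| <= rho once eta is small, and on |z| = rho log|g| is bounded
   below because g tends to f'. As |g(z)| is at most max |f'(z + s)| over |s| <= |eta|,
   and unit shifts change log|f'| on |z| = r by an amount whose mean is o(T(r, f)) along
   a sequence of radii (zeros are factored out and the zero-free part is controlled by
   Harnack's inequality), the mean of log|g| is at most m(r, f') - m(r, 1/f') + o(T(r, f)).
   The same shift estimate for f, with Cauchy's bound for f', gives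
   m(r, f') <= T(r, f) + o(T(r, f)). Finite order provides radii with
   T(16 r, f) <= K T(r, f), and one sequence of radii suffices for lower limits. *)
Require Import Defs.
From mathcomp Require Import all_boot all_order all_algebra.
From mathcomp Require Import all_classical all_reals all_analysis.
From mathcomp Require Import complex.
From mathcomp Require Import ring lra.
Import Order.TTheory GRing.Theory Num.Theory.
Import numFieldNormedType.Exports.
Import Normc.
Local Open Scope classical_set_scope.
Local Open Scope ring_scope.
Local Notation Re := complex.Re.
Local Notation Im := complex.Im.

(** * Complex differentiability *)

(** The shift [eta r] changes with the radius, so every bound must be uniform in it. This is why the
    Jensen sum is anchored at a fixed circle |z| = rho and not at 0, where [g] may vanish or be
    tiny, and why one majorant [L z] serves all shifts |w| <= 1 at once. Means of ln|h| are
    evaluated on circles free of zeros of [h], where the integrand is continuous. Hence the radius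
    [r] is moved to a generic [s > r], so close that m(s, f) exceeds m(r, f) by little, while the
    pairs are still counted up to [r]. A small parameter [tau] governs the shift estimate: each of
    the O(T) zeros costs O(tau) in the mean, once the radius is large in terms of [tau]. No branch
    of the complex logarithm is chosen: Poisson's formula is proved for ln|u| directly. The factor 1
    - delta multiplies an upper bound for m(r, f'), so delta <= 1 has to be known beforehand.
    Complex integrals are estimated through real and imaginary parts, whence spare factors 2 in the
    constants. *)

Lemma normc_ge0 {R : realType} (z : R[i]) : 0 <= normc z.
Proof. by case: z => x y /=; exact: sqrtr_ge0. Qed.
#[local] Hint Extern 0 (is_true (@Order.le _ _ _ (normc _))) => exact: normc_ge0 : core.

Section ComplexDerivative.
Set Implicit Arguments.
Unset Strict Implicit.
Variable R : realType.
Local Notation C := R[i].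
Implicit Types (f g : C -> C) (z w s l : C).

Lemma normc_eq0 z : (normc z == 0) = (z == 0).
Proof. by apply/eqP/eqP => [/eq0_normc|->] //; rewrite normc0. Qed.

Lemma normc_gt0 z : (0 < normc z) = (z != 0).
Proof. by rewrite lt0r normc_ge0 andbT normc_eq0. Qed.

Lemma ler_normcB z w : normc (z - w) <= normc z + normc w.
Proof. by rewrite (le_trans (le_normcD _ _))// normcN. Qed.

Lemma ler_dist_normc z w : normc z - normc w <= normc (z - w).
Proof. by rewrite lerBlDr -{1}(subrK w z) le_normcD. Qed.

Lemma normc_distC z w : normc (z - w) = normc (w - z).
Proof. by rewrite -normcN opprB. Qed.

Lemma ler_dist_dist_normc z w : `|normc z - normc w| <= normc (z - w).
Proof.
by rewrite ler_norml ler_dist_normc andbT lerNl opprB normc_distC ler_dist_normc.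
Qed.

Lemma normcR (x : R) : normc x%:C%C = `|x|.
Proof. by rewrite /= expr0n addr0 sqrtr_sqr. Qed.

Lemma normc_i : normc ('i%C : C) = 1.
Proof. by rewrite /= expr0n add0r expr1n sqrtr1. Qed.

Lemma normcX z n : normc (z ^+ n) = normc z ^+ n.
Proof.
by elim: n => [|n IH]; rewrite ?expr0 ?normc1// !exprS normcM IH.
Qed.

Lemma normc_sqr z : normc z ^+ 2 = Re z ^+ 2 + Im z ^+ 2.
Proof. by case: z => x y /=; rewrite sqr_sqrtr // addr_ge0 // sqr_ge0. Qed.

Lemma Re_le_normc z : `|Re z| <= normc z.
Proof.
rewrite -ler_sqr ?nnegrE// normc_sqr real_normK ?num_real//.
by rewrite lerDl sqr_ge0.
Qed.

Lemma Im_le_normc z : `|Im z| <= normc z.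
Proof.
rewrite -ler_sqr ?nnegrE// normc_sqr real_normK ?num_real//.
by rewrite lerDr sqr_ge0.
Qed.

Lemma normc_le_ReIm z : normc z <= `|Re z| + `|Im z|.
Proof.
rewrite -ler_sqr ?nnegrE ?addr_ge0// normc_sqr sqrrD !real_normK ?num_real//.
by rewrite -addrA lerD2l lerDr mulrn_wge0 // mulr_ge0.
Qed.

(** Epsilon and delta are real and distances go through [normc], whereas the norm of [C] takes
    values in [C]. The bridges between [cderiv] and the derivative of the statement are
    [derivable_cderiv] and [cderiv_derive1]. *)
Definition ccont f z := forall e : R, 0 < e ->
  exists2 d : R, 0 < d & forall w, normc (w - z) < d -> normc (f w - f z) < e.

Definition cderiv f z l := forall e : R, 0 < e ->
  exists2 d : R, 0 < d & forall s, normc s < d ->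
    normc (f (z + s) - f z - l * s) <= e * normc s.

(** [P] only selects points: the derivative at each of them involves a full neighbourhood in the
    plane, also at boundary points of a closed disc. *)
Definition holo (P : C -> Prop) f := forall z, P z -> exists l, cderiv f z l.

Lemma derivable_cderiv f z : derivable f z 1 -> cderiv f z ((f^`())%classic z).
Proof.
rewrite /derivable derive1E /derive.
move=> /cvg_ex[l hl].
rewrite (cvg_lim _ hl)// => e e0.
move/cvgrPdist_le: hl => /(_ e%:C%C).
rewrite ltcR => /(_ e0).
rewrite near_withinE.
case=> -[d1 d2] /=.
rewrite ltcE /= => /andP[/eqP -> d0] hd.
exists d1 => // s sd.
have [->|s0] := eqVneq s 0; first by rewrite addr0 subrr mulr0 subrr normc0 mulr0.
have := hd s.
rewrite /ball /= sub0r normrN => /(_ _ s0).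
rewrite ltcR => /(_ sd).
rewrite /shift /= /GRing.scale /=.
rewrite mulr1 (addrC s).
rewrite lecR => h.
have -> : f (z + s) - f z - l * s = - (l - s^-1 * (f (z + s) - f z)) * s by field.
by rewrite normcM normcN ler_wpM2r.
Qed.

Lemma cderiv_derive1 f z l : cderiv f z l ->
  derivable f z 1 /\ (f^`())%classic z = l.
Proof.
move=> h.
have H : h^-1 *: ((f \o shift z) (h *: 1) - f z) @[h --> 0^'] --> (l : C).
  apply/cvgrPdist_le => -[e1 e2]; rewrite ltcE /= => /andP[/eqP -> e0].
  have [d d0 hd] := h _ e0.
  rewrite near_withinE.
  exists d%:C%C => /=; first by rewrite ltcR.
  move=> s; rewrite /ball /= sub0r normrN ltcR => sd s0.
  rewrite /shift /= /GRing.scale /= mulr1 (addrC s) lecR.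
  have := hd _ sd.
  have -> : f (z + s) - f z - l * s = - (l - s^-1 * (f (z + s) - f z)) * s by field.
  by rewrite normcM normcN ler_pM2r // normc_gt0.
split; first by apply/cvg_ex; exists l.
by rewrite derive1E /derive; exact: cvg_lim H.
Qed.

Lemma cderiv_uniq f z l l' : cderiv f z l -> cderiv f z l' -> l = l'.
Proof. by move=> /cderiv_derive1[_ <-] /cderiv_derive1[_ <-]. Qed.

Lemma ccontP f z : (forall e : R, 0 < e -> exists2 d : R, 0 < d &
   forall w, normc (w - z) < d -> normc (f w - f z) <= e) -> ccont f z.
Proof.
move=> h e e0; have [|d d0 hd] := h (e / 2); first by rewrite divr_gt0.
exists d => // w /hd /le_lt_trans; apply.
by rewrite ltr_pdivrMr // ltr_pMr// ltr1n.
Qed.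

Lemma ccont_near f g z (d : R) : 0 < d ->
  (forall w, normc (w - z) < d -> f w = g w) -> ccont f z -> ccont g z.
Proof.
move=> d0 fg h e e0; have [d1 d10 h1] := h e e0.
exists (Num.min d d1); first by rewrite lt_min d0.
move=> w; rewrite lt_min => /andP[wd wd1].
rewrite -fg// -fg ?h1//; by rewrite subrr normc0.
Qed.

Lemma ccont_eq f g z : f =1 g -> ccont f z -> ccont g z.
Proof. by move=> fg; apply: (@ccont_near _ _ _ 1) => // w _. Qed.

Lemma ccont_cst a z : ccont (fun=> a) z.
Proof. by move=> e e0; exists 1 => // w _; rewrite subrr normc0. Qed.

Lemma ccont_id z : ccont (fun w => w) z.
Proof. by move=> e e0; exists e. Qed.

Lemma ccontD f g z : ccont f z -> ccont g z -> ccont (fun w => f w + g w) z.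
Proof.
move=> hf hg e e0.
have [|d1 d10 h1] := hf (e / 2); first by rewrite divr_gt0.
have [|d2 d20 h2] := hg (e / 2); first by rewrite divr_gt0.
exists (Num.min d1 d2); first by rewrite lt_min d10.
move=> w; rewrite lt_min => /andP[/h1 H1 /h2 H2].
rewrite opprD addrACA (le_lt_trans (le_normcD _ _))//.
by rewrite (splitr e) ltrD.
Qed.

Lemma ccont_bounded f z : ccont f z -> exists2 d : R, 0 < d &
  forall w, normc (w - z) < d -> normc (f w) < normc (f z) + 1.
Proof.
move=> /(_ 1 ltr01)[d d0 hd]; exists d => // w /hd h.
by rewrite addrC -ltrBlDr (le_lt_trans (ler_dist_normc _ _)).
Qed.

Lemma ccontM f g z : ccont f z -> ccont g z -> ccont (fun w => f w * g w) z.
Proof.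
move=> hf hg; apply: ccontP => e e0.
have [d0 d00 h0] := ccont_bounded hf.
pose A := normc (f z) + 1; pose B := normc (g z) + 1.
have A0 : 0 < A by rewrite ltr_wpDl.
have B0 : 0 < B by rewrite ltr_wpDl.
have [|d1 d10 h1] := hf (e / (2 * B)); first by rewrite divr_gt0// mulr_gt0.
have [|d2 d20 h2] := hg (e / (2 * A)); first by rewrite divr_gt0// mulr_gt0.
exists (Num.min d0 (Num.min d1 d2)); first by rewrite !lt_min d00 d10.
move=> w; rewrite !lt_min => /and3P[/h0 H0 /h1 H1 /h2 H2].
have -> : f w * g w - f z * g z = f w * (g w - g z) + (f w - f z) * g z by ring.
rewrite (le_trans (le_normcD _ _))// !normcM (splitr e) lerD//.
  rewrite (le_trans (ler_pM _ _ (ltW H0) (ltW H2)))// -/A.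
  suff -> : A * (e / (2 * A)) = e / 2 by [].
  by field; rewrite gt_eqF.
have gB : normc (g z) <= B by rewrite lerDl.
rewrite (le_trans (ler_pM _ _ (ltW H1) gB))//.
suff -> : e / (2 * B) * B = e / 2 by [].
by field; rewrite gt_eqF.
Qed.

Lemma ccontN f z : ccont f z -> ccont (fun w => - f w) z.
Proof.
move=> h; apply: (@ccont_eq (fun w => (-1) * f w)) => [w|].
  by rewrite mulN1r.
by apply: ccontM => //; exact: ccont_cst.
Qed.

Lemma ccontB f g z : ccont f z -> ccont g z -> ccont (fun w => f w - g w) z.
Proof. by move=> hf hg; apply: ccontD => //; exact: ccontN. Qed.

Lemma ccontX f z n : ccont f z -> ccont (fun w => f w ^+ n) z.
Proof.
move=> hf; elim: n => [|n IH].
  by apply: (ccont_eq _ (ccont_cst 1 z)) => w; rewrite expr0.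
by apply: (ccont_eq _ (ccontM hf IH)) => w; rewrite exprS.
Qed.

Lemma ccont_comp f g z : ccont g z -> ccont f (g z) -> ccont (fun w => f (g w)) z.
Proof.
move=> hg hf e e0; have [d d0 hd] := hf e e0.
by have [d' d'0 hd'] := hg d d0; exists d' => // w /hd' /hd.
Qed.

Lemma ccont_inv z : z != 0 -> ccont (fun w => w^-1) z.
Proof.
move=> z0; apply: ccontP => e e0.
pose r := normc z; have r0 : 0 < r by rewrite normc_gt0.
exists (Num.min (r / 2) (e * r ^+ 2 / 2)).
  by rewrite lt_min !divr_gt0 // mulr_gt0// exprn_gt0.
move=> w; rewrite lt_min => /andP[w1 w2].
have rw : r / 2 <= normc w.
  rewrite normc_distC in w1.
  have := le_lt_trans (ler_dist_normc z w) w1; rewrite -/r => h; lra.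
have w0 : w != 0 by rewrite -normc_gt0 (lt_le_trans _ rw)// divr_gt0.
have -> : w^-1 - z^-1 = - (w - z) / (z * w) by field; rewrite ?z0 ?w0.
rewrite normcM normcN normcV normcM -/r ler_pdivrMr ?mulr_gt0 ?normc_gt0//.
rewrite (le_trans (ltW w2))//.
have -> : e * r ^+ 2 / 2 = e * (r * (r / 2)) by field.
by rewrite !ler_pM2l.
Qed.

Lemma ccontV f z : f z != 0 -> ccont f z -> ccont (fun w => (f w)^-1) z.
Proof. by move=> fz hf; apply: (ccont_comp hf); exact: ccont_inv. Qed.

(** Caratheodory's form of differentiability: the difference quotient extends continuously by the
    value [l]. It turns the product and chain rules into algebra with continuous factors. *)
Lemma cderivP f z l : cderiv f z l <->
  exists phi, [/\ phi z = l, ccont phi z & forall w, f w = f z + (w - z) * phi w].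
Proof.
split=> [h|[phi [phil cphi fE]] e e0].
- exists (fun w => if w == z then l else (f w - f z) / (w - z)); split.
  + by rewrite eqxx.
  + apply: ccontP => e e0; have [d d0 hd] := h e e0.
    exists d => // w wd; rewrite eqxx.
    case: eqVneq => [_|wz]; first by rewrite subrr normc0 ltW.
    have wz0 : w - z != 0 by rewrite subr_eq0.
    have := hd _ wd; rewrite subrKC => hw.
    rewrite -(ler_pM2r (_ : 0 < normc (w - z))) ?normc_gt0// -normcM.
    suff -> : ((f w - f z) / (w - z) - l) * (w - z) = f w - f z - l * (w - z) by [].
    by field.
  + move=> w; case: eqVneq => [->|wz]; first by rewrite subrr mul0r addr0.
    have wz0 : w - z != 0 by rewrite subr_eq0.
    by field.
- have [d d0 hd] := cphi e e0; exists d => // s sd.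
  rewrite fE -phil.
  have -> : f z + (z + s - z) * phi (z + s) - f z - phi z * s =
    (phi (z + s) - phi z) * s by ring.
  by rewrite normcM ler_wpM2r// ltW// hd// addrC addKr.
Qed.

Lemma cderiv_cont f z l : cderiv f z l -> ccont f z.
Proof.
move=> /cderivP[phi [_ cphi fE]].
apply: (@ccont_eq (fun w => f z + (w - z) * phi w)) => [w|]; first by rewrite -fE.
apply: ccontD; first exact: ccont_cst.
by apply: ccontM => //; apply: ccontB; [exact: ccont_id|exact: ccont_cst].
Qed.

Lemma cderiv_near f g z l (d : R) : 0 < d ->
  (forall w, normc (w - z) < d -> f w = g w) -> cderiv f z l -> cderiv g z l.
Proof.
move=> d0 fg h e e0; have [d1 d10 h1] := h e e0.
exists (Num.min d d1); first by rewrite lt_min d0.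
move=> s; rewrite lt_min => /andP[sd sd1].
rewrite -!fg ?h1//; first by rewrite subrr normc0.
by rewrite addrC addKr.
Qed.

Lemma cderiv_eq f g z l : f =1 g -> cderiv f z l -> cderiv g z l.
Proof. by move=> fg; apply: (@cderiv_near _ _ _ _ 1) => // w _. Qed.

Lemma cderiv_eql f z l l' : l = l' -> cderiv f z l -> cderiv f z l'.
Proof. by move=> ->. Qed.

Lemma cderiv_cst a z : cderiv (fun=> a) z 0.
Proof.
apply/cderivP; exists (fun=> 0); split=> // [|w]; first exact: ccont_cst.
by rewrite mulr0 addr0.
Qed.

Lemma cderiv_id z : cderiv (fun w => w) z 1.
Proof.
apply/cderivP; exists (fun=> 1); split=> // [|w]; first exact: ccont_cst.
by rewrite mulr1 addrC subrK.
Qed.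

Lemma cderivD f g z l k : cderiv f z l -> cderiv g z k ->
  cderiv (fun w => f w + g w) z (l + k).
Proof.
move=> /cderivP[p [<- cp fE]] /cderivP[q [<- cq gE]].
apply/cderivP; exists (fun w => p w + q w); split=> //; first exact: ccontD.
by move=> w; rewrite fE gE; ring.
Qed.

Lemma cderivM f g z l k : cderiv f z l -> cderiv g z k ->
  cderiv (fun w => f w * g w) z (l * g z + f z * k).
Proof.
move=> hf /cderivP[q [<- cq gE]].
have cf := cderiv_cont hf; move/cderivP: hf => [p [<- cp fE]].
apply/cderivP; exists (fun w => p w * g z + f w * q w); split=> //.
- apply: ccontD; apply: ccontM => //; exact: ccont_cst.
- by move=> w; rewrite (gE w) mulrDr {1}(fE w); ring.
Qed.

Lemma cderivN f z l : cderiv f z l -> cderiv (fun w => - f w) z (- l).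
Proof.
move=> h; apply: cderiv_eql (cderiv_eq _ (cderivM (cderiv_cst (-1) z) h)).
  by rewrite mul0r add0r mulN1r.
by move=> w; rewrite mulN1r.
Qed.

Lemma cderivB f g z l k : cderiv f z l -> cderiv g z k ->
  cderiv (fun w => f w - g w) z (l - k).
Proof. by move=> hf hg; apply: cderivD => //; exact: cderivN. Qed.

Lemma cderiv_comp f g z l k : cderiv g z l -> cderiv f (g z) k ->
  cderiv (fun w => f (g w)) z (k * l).
Proof.
move=> hg /cderivP[p [<- cp fE]].
have cg := cderiv_cont hg; move/cderivP: hg => [q [<- cq gE]].
apply/cderivP; exists (fun w => p (g w) * q w); split=> //.
- by apply: ccontM => //; exact: ccont_comp.
- by move=> w; rewrite fE {1}(gE w); ring.
Qed.

Lemma cderiv_inv z : z != 0 -> cderiv (fun w => w^-1) z (- (z^-1 ^+ 2)).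
Proof.
move=> z0; have r0 : 0 < normc z by rewrite normc_gt0.
apply: (@cderiv_near (fun w => z^-1 + (w - z) * (- (z^-1 * w^-1))) _ _ _ (normc z)) => //.
  move=> w; rewrite normc_distC => h.
  have w0 : w != 0 by apply: contraTneq h => ->; rewrite subr0 ltxx.
  by field; rewrite ?z0 ?w0.
apply/cderivP; exists (fun w => - (z^-1 * w^-1)); split=> // [|w].
  apply: ccontN; apply: ccontM; [exact: ccont_cst|exact: ccont_inv].
by rewrite subrr mul0r addr0.
Qed.

Lemma cderivV f z l : f z != 0 -> cderiv f z l ->
  cderiv (fun w => (f w)^-1) z (- ((f z)^-1 ^+ 2) * l).
Proof.
by move=> fz hf; apply: (cderiv_comp hf); exact: cderiv_inv.
Qed.

Lemma cderivX f z l n : cderiv f z l ->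
  cderiv (fun w => f w ^+ n) z (n%:R * f z ^+ n.-1 * l).
Proof.
move=> hf; elim: n => [|n IH].
  by apply: cderiv_eql (cderiv_eq _ (cderiv_cst 1 z)) => //; rewrite !mul0r.
apply: cderiv_eql (cderiv_eq _ (cderivM hf IH)) => [|w]; last by rewrite exprS.
case: n {IH} => [|n] /=; first by rewrite expr0; ring.
by rewrite -[in RHS](addn1 n.+1) natrD !exprS; ring.
Qed.

Lemma holo_cont P f z : holo P f -> P z -> ccont f z.
Proof. by move=> h /h[l]; exact: cderiv_cont. Qed.

Lemma holo_cst P a : holo P (fun=> a).
Proof. by move=> z _; exists 0; exact: cderiv_cst. Qed.

Lemma holo_id P : holo P (fun w => w).
Proof. by move=> z _; exists 1; exact: cderiv_id. Qed.

Lemma holoD P f g : holo P f -> holo P g -> holo P (fun w => f w + g w).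
Proof.
by move=> hf hg z Pz; have [l ?] := hf z Pz; have [k ?] := hg z Pz;
  exists (l + k); exact: cderivD.
Qed.

Lemma holoB P f g : holo P f -> holo P g -> holo P (fun w => f w - g w).
Proof.
by move=> hf hg z Pz; have [l ?] := hf z Pz; have [k ?] := hg z Pz;
  exists (l - k); exact: cderivB.
Qed.

Lemma holoM P f g : holo P f -> holo P g -> holo P (fun w => f w * g w).
Proof.
move=> hf hg z Pz; have [l h1] := hf z Pz; have [k h2] := hg z Pz.
by exists (l * g z + f z * k); exact: cderivM.
Qed.

Lemma holoV P f : holo P f -> (forall z, P z -> f z != 0) ->
  holo P (fun w => (f w)^-1).
Proof.
move=> hf h0 z Pz; have [l h] := hf z Pz.
by exists (- ((f z)^-1 ^+ 2) * l); apply: cderivV h; exact: h0.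
Qed.

Lemma holo_comp P Q f g : holo P g -> (forall z, P z -> Q (g z)) -> holo Q f ->
  holo P (fun w => f (g w)).
Proof.
move=> hg PQ hf z Pz; have [l ?] := hg z Pz; have [k ?] := hf _ (PQ z Pz).
by exists (k * l); exact: cderiv_comp.
Qed.

Lemma holo_sub P Q f : (forall z, P z -> Q z) -> holo Q f -> holo P f.
Proof. by move=> PQ hf z /PQ /hf. Qed.

Lemma holo_eq P f g : f =1 g -> holo P f -> holo P g.
Proof. by move=> fg hf z /hf[l h]; exists l; exact: cderiv_eq h. Qed.

Lemma entire_holo f : entire f -> holo (fun=> True) f.
Proof. by move=> h z _; exists ((f^`())%classic z); exact: derivable_cderiv. Qed.

Lemma holo_entire f : holo (fun=> True) f -> entire f.
Proof. by move=> h z; have [l /cderiv_derive1[]] := h z I. Qed.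

End ComplexDerivative.

(** * Integrals along real segments *)

Section ComplexIntegral.
Set Implicit Arguments.
Unset Strict Implicit.
Variable R : realType.
Local Notation C := R[i].
Implicit Types (f g : C -> C) (z w s l : C) (phi psi : R -> C) (u v : R -> R).

Definition rint (a b : R) u : R := \int[lebesgue_measure]_(t in `[a, b]) u t.

Definition rcts (a b : R) u := forall t, a <= t <= b -> {for t, continuous u}.

Lemma rcts_integrable a b u : rcts a b u ->
  lebesgue_measure.-integrable `[a, b] (EFin \o u).
Proof.
move=> h; apply: continuous_compact_integrable; first exact: segment_compact.
apply: continuous_in_subspaceT => t /set_mem /=; rewrite in_itv /=; exact: h.
Qed.

Lemma eq_rint a b u v : (forall t, a <= t <= b -> u t = v t) ->
  rint a b u = rint a b v.
Proof.
move=> h; apply: eq_Rintegral => t /set_mem /=; rewrite in_itv /=; exact: h.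
Qed.

Lemma rintD a b u v : rcts a b u -> rcts a b v ->
  rint a b (fun t => u t + v t) = rint a b u + rint a b v.
Proof. by move=> hu hv; apply: RintegralD => //; exact: rcts_integrable. Qed.

Lemma rintB a b u v : rcts a b u -> rcts a b v ->
  rint a b (fun t => u t - v t) = rint a b u - rint a b v.
Proof. by move=> hu hv; apply: RintegralB => //; exact: rcts_integrable. Qed.

Lemma rintZ a b u k : rcts a b u -> rint a b (fun t => k * u t) = k * rint a b u.
Proof. by move=> hu; apply: RintegralZl => //; exact: rcts_integrable. Qed.

Lemma rint_cst a b k : a <= b -> rint a b (fun=> k) = k * (b - a).
Proof.
move=> ab; rewrite /rint Rintegral_cst//= lebesgue_measure_itv /= lte_fin.
by case: ltgtP ab => // -> _; rewrite subrr.
Qed.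

Lemma le_rint a b u v : rcts a b u -> rcts a b v ->
  (forall t, a <= t <= b -> u t <= v t) -> rint a b u <= rint a b v.
Proof.
by move=> hu hv h; apply: le_Rintegral => //; exact: rcts_integrable.
Qed.

Lemma rint_split a m b u : a <= m -> m <= b -> rcts a b u ->
  rint a b u = rint a m u + rint m b u.
Proof.
move=> am mb hu; apply/eqP; rewrite addrC -subr_eq; apply/eqP.
have iu := rcts_integrable hu.
rewrite /rint Rintegral_itvB ?bnd_simp//.
by apply: Rintegral_itv_obnd_cbnd; apply: integrableS iu => //;
  exact/subset_itvr.
Qed.

Lemma continuous_cst_real (k : R) t : {for t, continuous (fun _ : R => k)}.
Proof. exact: cvg_cst. Qed.

Lemma rcts_cst a b (k : R) : rcts a b (fun=> k).
Proof. by move=> t _; exact: continuous_cst_real. Qed.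

Lemma rctsD a b u v : rcts a b u -> rcts a b v -> rcts a b (fun t => u t + v t).
Proof. by move=> hu hv t h; apply: continuousD; [exact: hu|exact: hv]. Qed.

Lemma rctsN a b u : rcts a b u -> rcts a b (fun t => - u t).
Proof. by move=> hu t h; apply: continuousN; exact: hu. Qed.

Lemma rctsB a b u v : rcts a b u -> rcts a b v -> rcts a b (fun t => u t - v t).
Proof. by move=> hu hv; apply: rctsD => //; exact: rctsN. Qed.

Lemma rctsM a b u v : rcts a b u -> rcts a b v -> rcts a b (fun t => u t * v t).
Proof. by move=> hu hv t h; apply: continuousM; [exact: hu|exact: hv]. Qed.

Lemma rint_dist_cst a b u k e : a <= b -> rcts a b u ->
  (forall t, a <= t <= b -> `|u t - k| <= e) -> `|rint a b u - k * (b - a)| <= e * (b - a).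
Proof.
move=> ab hu h; rewrite ler_distl -mulrBl -mulrDl -!rint_cst//.
apply/andP; split; apply: le_rint => //; try exact: rcts_cst;
  by move=> t /h; rewrite ler_distl => /andP[].
Qed.

(* A path is read as the function [w |-> phi (Re w)] of a complex variable, so
   that the rules for [ccont] apply to it. *)
Definition pcont phi (t : R) := ccont (fun w => phi (Re w)) t%:C%C.

Definition pcts (a b : R) phi := forall t, a <= t <= b -> pcont phi t.

Lemma pcontP phi t : pcont phi t <-> forall e : R, 0 < e ->
  exists2 d : R, 0 < d & forall t', `|t' - t| < d -> normc (phi t' - phi t) < e.
Proof.
split=> h e e0; have [d d0 hd] := h e e0; exists d => //.
  move=> t' t'd; apply: (hd t'%:C%C).
  by rewrite -rmorphB normcR.
move=> w wd; apply: hd; apply: le_lt_trans wd.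
by apply: le_trans (Re_le_normc _); case: (w).
Qed.

Lemma continuousP u t : {for t, continuous u} <-> forall e : R, 0 < e ->
  exists2 d : R, 0 < d & forall t', `|t' - t| < d -> `|u t' - u t| < e.
Proof.
split=> [/cvgrPdist_lt h e /h|h].
  by case=> d d0 hd; exists d => // t'; rewrite distrC => /hd; rewrite distrC.
apply/cvgrPdist_lt => e /h[d d0 hd]; exists d => // t' /=.
by rewrite distrC => /hd; rewrite distrC.
Qed.

Lemma pcont_Re phi t : pcont phi t -> {for t, continuous (fun x => Re (phi x))}.
Proof.
move=> /pcontP h; apply/continuousP => e e0; have [d d0 hd] := h e e0.
exists d => // t' /hd; apply: le_lt_trans; apply: le_trans (Re_le_normc _).
by case: (phi t) (phi t') => [? ?] [].
Qed.

Lemma pcont_Im phi t : pcont phi t -> {for t, continuous (fun x => Im (phi x))}.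
Proof.
move=> /pcontP h; apply/continuousP => e e0; have [d d0 hd] := h e e0.
exists d => // t' /hd; apply: le_lt_trans; apply: le_trans (Im_le_normc _).
by case: (phi t) (phi t') => [? ?] [].
Qed.

Lemma pcont_normc phi t : pcont phi t -> {for t, continuous (fun x => normc (phi x))}.
Proof.
move=> /pcontP h; apply/continuousP => e e0; have [d d0 hd] := h e e0.
by exists d => // t' /hd; apply: le_lt_trans; exact: ler_dist_dist_normc.
Qed.

Lemma pcont_real u t : {for t, continuous u} -> pcont (fun x => (u x)%:C%C) t.
Proof.
move=> /continuousP h; apply/pcontP => e e0; have [d d0 hd] := h e e0.
by exists d => // t' /hd; rewrite -rmorphB normcR.
Qed.

Lemma pcont_comp f phi t : pcont phi t -> ccont f (phi t) -> pcont (fun x => f (phi x)) t.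
Proof. by move=> hp hf; apply: (ccont_comp hp). Qed.

Lemma pctsB a b phi psi : pcts a b phi -> pcts a b psi ->
  pcts a b (fun t => phi t - psi t).
Proof. by move=> h1 h2 t h; apply: ccontB; [exact: h1|exact: h2]. Qed.

Lemma pctsM a b phi psi : pcts a b phi -> pcts a b psi ->
  pcts a b (fun t => phi t * psi t).
Proof. by move=> h1 h2 t h; apply: ccontM; [exact: h1|exact: h2]. Qed.

Lemma pcts_cst a b k : pcts a b (fun=> k).
Proof. by move=> t h; exact: ccont_cst. Qed.

Lemma pcts_sub a b a' b' phi : a <= a' -> b' <= b -> pcts a b phi -> pcts a' b' phi.
Proof.
move=> aa bb h t /andP[t1 t2]; apply: h.
by rewrite (le_trans aa t1) (le_trans t2 bb).
Qed.

Lemma pcts_Re a b phi : pcts a b phi -> rcts a b (fun x => Re (phi x)).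
Proof. by move=> h t /h /pcont_Re. Qed.

Lemma pcts_Im a b phi : pcts a b phi -> rcts a b (fun x => Im (phi x)).
Proof. by move=> h t /h /pcont_Im. Qed.

Definition cint (a b : R) phi : C :=
  (rint a b (fun t => Re (phi t)) +i* rint a b (fun t => Im (phi t)))%C.

Lemma eq_cint a b phi psi : (forall t, a <= t <= b -> phi t = psi t) ->
  cint a b phi = cint a b psi.
Proof.
by move=> h; congr (_ +i* _)%C; apply: eq_rint => t /h ->.
Qed.

Lemma ReD z w : Re (z + w) = Re z + Re w. Proof. by case: z w => [? ?] []. Qed.
Lemma ImD z w : Im (z + w) = Im z + Im w. Proof. by case: z w => [? ?] []. Qed.
Lemma ReB z w : Re (z - w) = Re z - Re w. Proof. by case: z w => [? ?] []. Qed.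
Lemma ImB z w : Im (z - w) = Im z - Im w. Proof. by case: z w => [? ?] []. Qed.
Lemma ReM z w : Re (z * w) = Re z * Re w - Im z * Im w.
Proof. by case: z w => [? ?] []. Qed.
Lemma ImM z w : Im (z * w) = Re z * Im w + Im z * Re w.
Proof. by case: z w => [? ?] []. Qed.

Lemma cintD a b phi psi : pcts a b phi -> pcts a b psi ->
  cint a b (fun t => phi t + psi t) = cint a b phi + cint a b psi.
Proof.
move=> h1 h2; rewrite {1}/cint.
rewrite (eq_rint (u := fun t => Re (phi t + psi t))
  (v := fun t => Re (phi t) + Re (psi t))) => [|t _]; last exact: ReD.
rewrite rintD; [|exact: pcts_Re|exact: pcts_Re].
rewrite (eq_rint (u := fun t => Im (phi t + psi t))
  (v := fun t => Im (phi t) + Im (psi t))) => [|t _]; last exact: ImD.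
by rewrite rintD; [|exact: pcts_Im|exact: pcts_Im].
Qed.

Lemma cintZ a b k phi : pcts a b phi ->
  cint a b (fun t => k * phi t) = k * cint a b phi.
Proof.
move=> h; rewrite {1}/cint.
have hr := pcts_Re h; have hi := pcts_Im h.
have hZ (c : R) u : rcts a b u -> rcts a b (fun t => c * u t).
  by move=> hu; apply: rctsM => //; exact: rcts_cst.
rewrite (eq_rint (u := fun t => Re (k * phi t))
  (v := fun t => Re k * Re (phi t) - Im k * Im (phi t))) => [|t _]; last exact: ReM.
rewrite rintB; [|exact: hZ|exact: hZ].
rewrite (eq_rint (u := fun t => Im (k * phi t))
  (v := fun t => Re k * Im (phi t) + Im k * Re (phi t))) => [|t _]; last exact: ImM.
rewrite rintD; [|exact: hZ|exact: hZ].
by rewrite !rintZ// /cint; case: k.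
Qed.

Lemma cintB a b phi psi : pcts a b phi -> pcts a b psi ->
  cint a b (fun t => phi t - psi t) = cint a b phi - cint a b psi.
Proof.
move=> h1 h2; rewrite -[- cint _ _ _]mulN1r -cintZ// -cintD//.
  by apply: eq_cint => t _; rewrite mulN1r.
by apply: pctsM => //; exact: pcts_cst.
Qed.

Lemma cint_cst a b k : a <= b -> cint a b (fun=> k) = k * (b - a)%:C%C.
Proof.
move=> ab; rewrite /cint !rint_cst//; case: k => x y /=.
by rewrite /GRing.mul /= !mulr0 subr0 add0r.
Qed.

Lemma cint_split a m b phi : a <= m -> m <= b -> pcts a b phi ->
  cint a b phi = cint a m phi + cint m b phi.
Proof.
move=> am mb h; rewrite /cint (rint_split am mb (pcts_Re h)).
by rewrite (rint_split am mb (pcts_Im h)).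
Qed.

(* The factor 2 comes from estimating the real and imaginary parts separately. *)
Lemma cint_dist_cst a b phi k e : a <= b -> pcts a b phi ->
  (forall t, a <= t <= b -> normc (phi t - k) <= e) ->
  normc (cint a b phi - k * (b - a)%:C%C) <= 2 * e * (b - a).
Proof.
move=> ab hp h; apply: le_trans (normc_le_ReIm _) _.
rewrite -mulrA mulr_natl mulr2n; apply: lerD.
- rewrite ReB ReM /= mulr0 subr0; apply: rint_dist_cst => //; first exact: pcts_Re.
  by move=> t /h; rewrite -ReB; apply: le_trans; exact: Re_le_normc.
- rewrite ImB ImM /= mulr0 add0r; apply: rint_dist_cst => //; first exact: pcts_Im.
  by move=> t /h; rewrite -ImB; apply: le_trans; exact: Im_le_normc.
Qed.

Lemma cint_bound a b phi e : a <= b -> pcts a b phi ->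
  (forall t, a <= t <= b -> normc (phi t) <= e) ->
  normc (cint a b phi) <= 2 * e * (b - a).
Proof.
move=> ab hp h; rewrite -[cint _ _ _]subr0 -(mul0r (b - a)%:C%C).
by apply: cint_dist_cst => // t /h; rewrite subr0.
Qed.

End ComplexIntegral.

(** * Goursat's theorem *)

Section Goursat.
Set Implicit Arguments.
Unset Strict Implicit.
Variable R : realType.
Local Notation C := R[i].
Implicit Types (f g : C -> C) (z w s l : C) (phi psi : R -> C) (u v : R -> R).

Lemma nested_intervals (u v : nat -> R) :
  (forall n, u n <= u n.+1) -> (forall n, v n.+1 <= v n) -> (forall n, u n <= v n) ->
  exists x, forall n, u n <= x <= v n.
Proof.
move=> uS vS uv.
have um n k : u n <= u (n + k)%N.
  by elim: k => [|k IH]; rewrite ?addn0// addnS (le_trans IH).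
have vm n k : v (n + k)%N <= v n.
  by elim: k => [|k IH]; rewrite ?addn0// addnS (le_trans _ IH).
have ub n : ubound (range u) (v n).
  move=> _ [k _ <-]; rewrite (le_trans (um k n))// addnC.
  by rewrite (le_trans (uv _)) // vm.
exists (sup (range u)) => n; apply/andP; split.
  by apply: ub_le_sup; [exists (v 0%N); exact: ub|exists n].
by apply: ge_sup; [exists (u 0%N); exists 0%N|exact: ub].
Qed.

Lemma half_pow_small (x e : R) : 0 < e -> exists n, x / 2 ^+ n < e.
Proof.
move=> e0; have [x0|x0] := leP x 0.
  by exists 0%N; rewrite expr0 divr1 (le_lt_trans x0).
exists (Num.bound (x / e)); rewrite ltr_pdivrMr ?exprn_gt0// mulrC -ltr_pdivrMr//.
have := archi_boundP (ltW (divr_gt0 x0 e0)); move=> /lt_le_trans; apply.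
by rewrite -natrX ler_nat ltnW// ltn_expl.
Qed.

(** Bisection as an induction principle: a rectangle where [Pr] fails has a quarter where it fails,
    and the nested failing quarters shrink to a point at which the local hypothesis is violated. It
    serves both Goursat's theorem and the compactness of the disc. *)
Lemma rect_ind (A B c0 D : R) (Pr : R -> R -> R -> R -> Prop) :
  A <= B -> c0 <= D ->
  (forall a b c d, A <= a -> a <= b -> b <= B -> c0 <= c -> c <= d -> d <= D ->
    Pr a ((a + b) / 2) c ((c + d) / 2) -> Pr ((a + b) / 2) b c ((c + d) / 2) ->
    Pr a ((a + b) / 2) ((c + d) / 2) d -> Pr ((a + b) / 2) b ((c + d) / 2) d ->
    Pr a b c d) ->
  (forall x y, A <= x -> x <= B -> c0 <= y -> y <= D ->
    exists2 e, 0 < e & forall a b c d, A <= a -> a <= x -> x <= b -> b <= B ->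
      c0 <= c -> c <= y -> y <= d -> d <= D -> b - a < e -> d - c < e -> Pr a b c d) ->
  Pr A B c0 D.
Proof.
move=> AB CD split_ loc; apply: contrapT => nP.
pose T := (R * R * (R * R))%type.
pose bad (q : T) := [/\ A <= q.1.1 /\ q.1.1 <= q.1.2, q.1.2 <= B, c0 <= q.2.1 /\ q.2.1 <= q.2.2,
  q.2.2 <= D & ~ Pr q.1.1 q.1.2 q.2.1 q.2.2].
pose sub (q q' : T) := [/\ q.1.1 <= q'.1.1 /\ q'.1.2 <= q.1.2,
  q.2.1 <= q'.2.1 /\ q'.2.2 <= q.2.2, q'.1.2 - q'.1.1 = (q.1.2 - q.1.1) / 2 &
  q'.2.2 - q'.2.1 = (q.2.2 - q.2.1) / 2].
have nxt q : bad q -> exists q', bad q' /\ sub q q'.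
  case: q => [[a b] [c d]]; rewrite /bad /sub /= => -[[h1 h2] h3 [h4 h5] h6 nPr].
  apply: contrapT => /forallNP H; apply: nPr; apply: split_ => //.
  - apply: contrapT => nPr; apply: (H ((a, (a + b) / 2), (c, (c + d) / 2))) => /=.
    by split; split=> //; try split; lra.
  - apply: contrapT => nPr; apply: (H (((a + b) / 2, b), (c, (c + d) / 2))) => /=.
    by split; split=> //; try split; lra.
  - apply: contrapT => nPr; apply: (H ((a, (a + b) / 2), ((c + d) / 2, d))) => /=.
    by split; split=> //; try split; lra.
  - apply: contrapT => nPr; apply: (H (((a + b) / 2, b), ((c + d) / 2, d))) => /=.
    by split; split=> //; try split; lra.
have /choice[F hF] : forall q, exists q', bad q -> bad q' /\ sub q q'.
  move=> q; have [/nxt[q' h]|nb] := pselect (bad q); first by exists q'.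
  by exists q.
pose s n := iter n F ((A, B), (c0, D)).
have sb n : bad (s n).
  by elim: n => [|n IH]; [split|case: (hF _ IH)].
have ss n : sub (s n) (s n.+1) by case: (hF _ (sb n)).
have [x hx] := @nested_intervals (fun n => (s n).1.1) (fun n => (s n).1.2)
  (fun n => let: And4 (conj h _) _ _ _ := ss n in h)
  (fun n => let: And4 (conj _ h) _ _ _ := ss n in h)
  (fun n => let: And5 (conj _ h) _ _ _ _ := sb n in h).
have [y hy] := @nested_intervals (fun n => (s n).2.1) (fun n => (s n).2.2)
  (fun n => let: And4 _ (conj h _) _ _ := ss n in h)
  (fun n => let: And4 _ (conj _ h) _ _ := ss n in h)
  (fun n => let: And5 _ _ (conj _ h) _ _ := sb n in h).
have w1 n : (s n).1.2 - (s n).1.1 = (B - A) / 2 ^+ n.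
  elim: n => [|n IH]; first by rewrite expr0 divr1.
  by have [_ _ -> _] := ss n; rewrite IH exprSr invfM mulrA.
have w2 n : (s n).2.2 - (s n).2.1 = (D - c0) / 2 ^+ n.
  elim: n => [|n IH]; first by rewrite expr0 divr1.
  by have [_ _ _ ->] := ss n; rewrite IH exprSr invfM mulrA.
have /andP[x1 x2] := hx 0%N; have /andP[y1 y2] := hy 0%N.
have [e e0 he] := loc x y x1 x2 y1 y2.
have [n hn] := half_pow_small (Num.max (B - A) (D - c0)) e0.
have [[b1 _] b2 [b3 _] b4] := sb n; apply.
have /andP[? ?] := hx n; have /andP[? ?] := hy n.
apply: he => //; rewrite ?w1 ?w2; apply: le_lt_trans hn; apply: ler_wpM2r;
  by rewrite ?invr_ge0 ?exprn_ge0// le_max lexx ?orbT.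
Qed.

(* Contour integral of [f] over the counterclockwise boundary of [a, b] x [c, d]. *)
Definition bdry f (a b c d : R) : C :=
  cint a b (fun x => f (x +i* c)%C - f (x +i* d)%C) +
  'i%C * cint c d (fun y => f (b +i* y)%C - f (a +i* y)%C).

Lemma pcont_horizontal (c t : R) : pcont (fun x => (x +i* c)%C) t.
Proof.
apply/pcontP => e e0; exists e => // t'.
suff -> : ((t' +i* c) - (t +i* c))%C = (t' - t)%:C%C by rewrite normcR.
by apply/eqP; rewrite eq_complex /=; apply/andP; split; apply/eqP; ring.
Qed.

Lemma pcont_vertical (c t : R) : pcont (fun y => (c +i* y)%C) t.
Proof.
apply/pcontP => e e0; exists e => // t'.
suff -> : ((c +i* t') - (c +i* t))%C = 'i%C * (t' - t)%:C%C.
  by rewrite normcM normcR normc_i mul1r.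
by apply/eqP; rewrite eq_complex /=; apply/andP; split; apply/eqP; ring.
Qed.

Definition in_rect (A B c0 D : R) z := (A <= Re z <= B) && (c0 <= Im z <= D).

Lemma bdry_quarters f A B c0 D a b c d : holo (in_rect A B c0 D) f ->
  A <= a -> a <= b -> b <= B -> c0 <= c -> c <= d -> d <= D ->
  bdry f a b c d =
    bdry f a ((a + b) / 2) c ((c + d) / 2) + bdry f ((a + b) / 2) b c ((c + d) / 2) +
    bdry f a ((a + b) / 2) ((c + d) / 2) d + bdry f ((a + b) / 2) b ((c + d) / 2) d.
Proof.
move=> hf Aa ab bB Cc cd dD; set m := (a + b) / 2; set k := (c + d) / 2.
have am : a <= m by rewrite /m; lra.
have mb : m <= b by rewrite /m; lra.
have ck : c <= k by rewrite /k; lra.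
have kd : k <= d by rewrite /k; lra.
have H y : c0 <= y <= D -> pcts a b (fun x => f (x +i* y)%C).
  move=> /andP[y1 y2] t /andP[t1 t2]; apply: pcont_comp; first exact: pcont_horizontal.
  by apply: (holo_cont hf); rewrite /in_rect /=; apply/andP; split; apply/andP; split; lra.
have V x : A <= x <= B -> pcts c d (fun y => f (x +i* y)%C).
  move=> /andP[x1 x2] t /andP[t1 t2]; apply: pcont_comp; first exact: pcont_vertical.
  by apply: (holo_cont hf); rewrite /in_rect /=; apply/andP; split; apply/andP; split; lra.
have Hc : pcts a b (fun x => f (x +i* c)%C) by apply: H; lra.
have Hk : pcts a b (fun x => f (x +i* k)%C) by apply: H; lra.
have Hd : pcts a b (fun x => f (x +i* d)%C) by apply: H; lra.
have Va : pcts c d (fun y => f (a +i* y)%C) by apply: V; lra.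
have Vm : pcts c d (fun y => f (m +i* y)%C) by apply: V; lra.
have Vb : pcts c d (fun y => f (b +i* y)%C) by apply: V; lra.
rewrite /bdry.
have L1 phi : pcts a b phi -> pcts a m phi by apply: pcts_sub.
have L2 phi : pcts a b phi -> pcts m b phi by apply: pcts_sub.
have L3 phi : pcts c d phi -> pcts c k phi by apply: pcts_sub.
have L4 phi : pcts c d phi -> pcts k d phi by apply: pcts_sub.
rewrite !cintB; do ?[by []|exact: L1|exact: L2|exact: L3|exact: L4].
rewrite !(cint_split am mb)// !(cint_split ck kd)//.
by ring.
Qed.

(** The boundary integral of an affine function is 0, so only the first-order remainder at [z]
    survives. Its bound [e / 16 * h] doubles in a difference of two values and again in
    [cint_dist_cst], which leaves [e * h^2 / 4] in total. *)
Lemma bdry_small f z l (e : R) : cderiv f z l -> 0 < e ->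
  exists2 r : R, 0 < r & forall a b c d, a <= Re z -> Re z <= b -> c <= Im z -> Im z <= d ->
    b - a < r -> d - c < r -> holo (in_rect a b c d) f ->
    normc (bdry f a b c d) <= e * ((b - a) ^+ 2 + (d - c) ^+ 2).
Proof.
move=> hf e0; have [|r r0 hr] := hf (e / 16); first by rewrite divr_gt0.
exists (r / 2); first by rewrite divr_gt0.
move=> a b c d ax xb cy yd bar dcr ho.
have ab : a <= b := le_trans ax xb; have cd : c <= d := le_trans cy yd.
pose h := (b - a) + (d - c).
have h0 : 0 <= h by rewrite /h; lra.
have near x y : a <= x -> x <= b -> c <= y -> y <= d ->
    normc (f (x +i* y)%C - f z - l * ((x +i* y)%C - z)) <= e / 16 * h.
  move=> ax' xb' cy' yd'.
  have hn : normc ((x +i* y)%C - z) <= h.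
    apply: le_trans (normc_le_ReIm _) _; rewrite ReB ImB /=; apply: lerD.
      by rewrite ler_norml; apply/andP; split; lra.
    by rewrite ler_norml; apply/andP; split; lra.
  have := hr ((x +i* y)%C - z); rewrite subrKC => /(_ _)/le_trans; apply.
    by apply: le_lt_trans hn _; rewrite /h; lra.
  by rewrite ler_wpM2l// divr_ge0// ltW.
have diff x y x' y' k : a <= x -> x <= b -> c <= y -> y <= d ->
   a <= x' -> x' <= b -> c <= y' -> y' <= d -> k = l * ((x +i* y)%C - (x' +i* y')%C) ->
   normc (f (x +i* y)%C - f (x' +i* y')%C - k) <= e / 8 * h.
  move=> h1 h2 h3 h4 h5 h6 h7 h8 ->.
  have -> : f (x +i* y)%C - f (x' +i* y')%C - l * ((x +i* y)%C - (x' +i* y')%C) =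
    (f (x +i* y)%C - f z - l * ((x +i* y)%C - z)) -
    (f (x' +i* y')%C - f z - l * ((x' +i* y')%C - z)) by ring.
  apply: le_trans (ler_normcB _ _) _.
  by apply: le_trans (lerD (near _ _ _ _ _ _) (near _ _ _ _ _ _)) _ => //; lra.
have H y : c <= y <= d -> pcts a b (fun x => f (x +i* y)%C).
  move=> /andP[y1 y2] t /andP[t1 t2]; apply: pcont_comp; first exact: pcont_horizontal.
  by apply: (holo_cont ho); rewrite /in_rect /=; apply/andP; split; apply/andP; split; lra.
have V x : a <= x <= b -> pcts c d (fun y => f (x +i* y)%C).
  move=> /andP[x1 x2] t /andP[t1 t2]; apply: pcont_comp; first exact: pcont_vertical.
  by apply: (holo_cont ho); rewrite /in_rect /=; apply/andP; split; apply/andP; split; lra.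
have B1 : normc (cint a b (fun x => f (x +i* c)%C - f (x +i* d)%C) -
    (l * ('i%C * (c - d)%:C%C)) * (b - a)%:C%C) <= 2 * (e / 8 * h) * (b - a).
  apply: cint_dist_cst => //.
    by apply: pctsB; apply: H; rewrite ?lexx ?cd.
  move=> t /andP[t1 t2]; apply: diff => //; congr (_ * _).
  by apply/eqP; rewrite eq_complex /=; apply/andP; split; apply/eqP; ring.
have B2 : normc (cint c d (fun y => f (b +i* y)%C - f (a +i* y)%C) -
    (l * (b - a)%:C%C) * (d - c)%:C%C) <= 2 * (e / 8 * h) * (d - c).
  apply: cint_dist_cst => //.
    by apply: pctsB; apply: V; rewrite ?lexx ?ab.
  move=> t /andP[t1 t2]; apply: diff => //; congr (_ * _).
  by apply/eqP; rewrite eq_complex /=; apply/andP; split; apply/eqP; ring.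
(* The two subtracted constants are increments of [w |-> l * w] across the rectangle; multiplied by
   the side lengths they cancel, one carrying [c - d] and the other [d - c]. *)
have -> : bdry f a b c d = (cint a b (fun x => f (x +i* c)%C - f (x +i* d)%C) -
    (l * ('i%C * (c - d)%:C%C)) * (b - a)%:C%C) +
   'i%C * (cint c d (fun y => f (b +i* y)%C - f (a +i* y)%C) -
    (l * (b - a)%:C%C) * (d - c)%:C%C).
  by rewrite /bdry !rmorphB /=; ring.
apply: le_trans (le_normcD _ _) _; rewrite normcM normc_i mul1r.
apply: le_trans (lerD B1 B2) _.
suff : h * h <= 4 * ((b - a) ^+ 2 + (d - c) ^+ 2).
  have -> : 2 * (e / 8 * h) * (b - a) + 2 * (e / 8 * h) * (d - c) = e * (h * h / 4).
    by rewrite /h; field.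
  by move=> hh; rewrite ler_pM2l//; lra.
rewrite /h; move: (b - a) (d - c) => p q.
have := sqr_ge0 (p - q); have := sqr_ge0 p; have := sqr_ge0 q.
by rewrite !expr2; lra.
Qed.

(** The bound [e] times the sum of the squared side lengths is additive under quartering, since each
    quarter carries a fourth of it. So the local estimate of [bdry_small] passes to the whole
    rectangle with the same [e]. *)
Theorem goursat f A B c0 D : A <= B -> c0 <= D ->
  holo (in_rect A B c0 D) f -> bdry f A B c0 D = 0.
Proof.
move=> AB CD hf.
have sub a b c d : A <= a -> b <= B -> c0 <= c -> d <= D -> holo (in_rect a b c d) f.
  move=> Aa bB Cc dD; apply: holo_sub hf => z /andP[/andP[? ?] /andP[? ?]].
  by rewrite /in_rect; apply/andP; split; apply/andP; split; lra.
pose K := (B - A) ^+ 2 + (D - c0) ^+ 2.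
have K0 : 0 <= K by rewrite addr_ge0 ?sqr_ge0.
have tri4 (z1 z2 z3 z4 : C) :
    normc (z1 + z2 + z3 + z4) <= normc z1 + normc z2 + normc z3 + normc z4.
  by do 3 (apply: le_trans (le_normcD _ _) _; rewrite lerD2r).
have main e : 0 < e -> normc (bdry f A B c0 D) <= e * K.
  move=> e0; pose Pr a b c d := normc (bdry f a b c d) <= e * ((b - a) ^+ 2 + (d - c) ^+ 2).
  apply: (@rect_ind _ _ _ _ Pr) => //.
  - move=> a b c d Aa ab bB Cc cd dD; rewrite /Pr => h1 h2 h3 h4.
    rewrite (bdry_quarters hf)//.
    apply: le_trans (tri4 _ _ _ _) _.
    apply: le_trans (lerD (lerD (lerD h1 h2) h3) h4) _.
    by rewrite le_eqVlt; apply/orP; left; apply/eqP; field.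
  - move=> x y Ax xB Cy yD; have [|l hl] := hf (x +i* y)%C.
      by rewrite /in_rect /= Ax xB Cy yD.
    have [r r0 hr] := bdry_small hl e0.
    by exists r => // a b c d *; apply: hr => //; exact: sub.
apply/eqP; rewrite -normc_eq0 eq_le normc_ge0 andbT.
rewrite leNgt; apply/negP => h.
have := main (normc (bdry f A B c0 D) / (K + 1) / 2).
rewrite !divr_gt0 ?ltr_wpDl// => /(_ isT).
rewrite -[X in X <= _ -> _](@mulfVK _ (K + 1)) ?gt_eqF ?ltr_wpDl//.
rewrite -[X in _ <= X -> _]mulrA ler_pM2l ?divr_gt0 ?ltr_wpDl//; lra.
Qed.

End Goursat.

(** * Circle means and Cauchy's formula *)

Section CauchyFormula.
Set Implicit Arguments.
Unset Strict Implicit.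
Variable R : realType.
Local Notation C := R[i].
Implicit Types (f g : C -> C) (z w s l p : C) (phi psi : R -> C) (u v : R -> R).

Lemma complex_ext z w : Re z = Re w -> Im z = Im w -> z = w.
Proof. by case: z w => [x y] [x' y'] /= -> ->. Qed.

Definition cexp z : C := (expR (Re z) * cos (Im z) +i* (expR (Re z) * sin (Im z)))%C.

Lemma cexpD z w : cexp (z + w) = cexp z * cexp w.
Proof.
apply: complex_ext; rewrite ?ReM ?ImM /= ReD ImD expRD ?cosD ?sinD; ring.
Qed.

Lemma cexp0 : cexp 0 = 1.
Proof. by rewrite /cexp /= expR0 cos0 sin0 mulr1 mulr0. Qed.

Lemma normc_cexp z : normc (cexp z) = expR (Re z).
Proof.
apply/eqP; rewrite -(eqrXn2 (n := 2))// ?expR_ge0// normc_sqr /=.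
by rewrite !exprMn -mulrDr cos2Dsin2 mulr1.
Qed.

Lemma is_derive_small u (l : R) : is_derive 0 (1 : R) u l -> forall e : R, 0 < e ->
  exists2 d, 0 < d & forall h, `|h| < d -> `|u h - u 0 - l * h| <= e * `|h|.
Proof.
move=> [du <-] e e0; move: du; rewrite /derivable /derive => /cvg_ex[k hk].
rewrite (cvg_lim _ hk)//.
move/cvgrPdist_le : hk => /(_ _ e0); rewrite near_withinE => -[d d0 hd].
exists d => // h hd'; have [->|h0] := eqVneq h 0.
  by rewrite subrr mulr0 subrr normr0 mulr0.
have := hd h; rewrite /ball /= sub0r normrN => /(_ hd' h0).
rewrite /shift /= /GRing.scale /= mulr1 addr0 => hh.
have -> : u h - u 0 - k * h = - (k - h^-1 * (u h - u 0)) * h by field.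
by rewrite normrM normrN ler_wpM2r.
Qed.

Lemma cderiv_cexp0 : cderiv cexp 0 1.
Proof.
(* The real part will contribute [3 * (k * n)] and the imaginary part [4 * (k * n)], with [n] the
   modulus of the increment. *)
move=> e e0; have [k [k0 k1 ke]] : exists k : R, [/\ 0 < k, k <= 1 & 8 * k <= e].
  exists (Num.min 1 (e / 8)); split; first by rewrite lt_min ltr01 divr_gt0.
    by rewrite ge_min lexx.
  by rewrite -ler_pdivlMl// mulrC ge_min lexx orbT.
have [d1 d10 h1] := is_derive_small (is_derive_expR 0) k0.
have [d2 d20 h2] := is_derive_small (is_derive_sin 0) k0.
have [d3 d30 h3] := is_derive_small (is_derive_cos 0) k0.
pose d := Num.min k (Num.min d1 (Num.min d2 d3)).
exists d; first by rewrite !lt_min k0 d10 d20.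
case=> x y; rewrite add0r cexp0 mul1r !lt_min => /and4P[sk sd1 sd2 sd3].
have xs := Re_le_normc (x +i* y)%C; have ys := Im_le_normc (x +i* y)%C.
apply: le_trans (normc_le_ReIm _) _; rewrite !ReB !ImB.
move: (normc (x +i* y)%C) xs ys sk sd1 sd2 sd3 => n /= xs ys sk sd1 sd2 sd3.
have {}h1 := h1 x (le_lt_trans xs sd1); rewrite expR0 mul1r in h1.
have {}h2 := h2 y (le_lt_trans ys sd2); rewrite sin0 subr0 cos0 mul1r in h2.
have {}h3 := h3 y (le_lt_trans ys sd3).
rewrite sin0 oppr0 mul0r subr0 cos0 in h3.
have c1 : `|cos y| <= 1 by rewrite ler_norml cos_geN1 cos_le1.
have s1 : `|sin y| <= 1 by rewrite ler_norml sin_geN1 sin_le1.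
have n0 : 0 <= n := le_trans (normr_ge0 _) xs.
have kn : k * `|x| <= k * n by rewrite ler_pM2l.
have km : k * `|y| <= k * n by rewrite ler_pM2l.
have x1 : `|1 + x| <= 2.
  by apply: le_trans (ler_normD _ _) _; rewrite normr1; lra.
have A1 : `|expR x * cos y - 1 - x| <= 3 * (k * n).
  have -> : expR x * cos y - 1 - x = (expR x - 1 - x) * cos y + (1 + x) * (cos y - 1) by ring.
  apply: le_trans (ler_normD _ _) _; rewrite !normrM.
  have := ler_pM (normr_ge0 _) (normr_ge0 _) h1 c1.
  have := ler_pM (normr_ge0 _) (normr_ge0 _) x1 h3.
  lra.
have A2 : `|expR x * sin y - 0 - y| <= 4 * (k * n).
  have -> : expR x * sin y - 0 - y = (expR x - 1 - x) * sin y + (1 + x) * (sin y - y) + x * y by ring.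
  apply: le_trans (ler_normD _ _) _; apply: le_trans (lerD (ler_normD _ _) (lexx _)) _.
  rewrite !normrM.
  have := ler_pM (normr_ge0 _) (normr_ge0 _) h1 s1.
  have := ler_pM (normr_ge0 _) (normr_ge0 _) x1 h2.
  have := ler_pM (normr_ge0 _) (normr_ge0 _) (le_trans xs (ltW sk)) ys.
  lra.
have := ler_wpM2r n0 ke; have := mulr_ge0 (ltW k0) n0; lra.
Qed.

Lemma cderiv_cexp z : cderiv cexp z (cexp z).
Proof.
have h : cderiv (fun w => w - z) z 1.
  by apply: cderiv_eql (cderivB (cderiv_id z) (cderiv_cst z z)); rewrite subr0.
have h0 : cderiv cexp (z - z) 1 by rewrite subrr; exact: cderiv_cexp0.
apply: cderiv_eql (cderiv_eq _ (cderivM (cderiv_cst (cexp z) z) (cderiv_comp h h0))).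
  by rewrite mul0r add0r !mulr1.
by move=> w; rewrite -cexpD subrKC.
Qed.

Notation E := (@circle_point R).

Lemma circle_pointE r (t : R) : E r t = r%:C%C * E 1 t.
Proof. by apply: complex_ext; rewrite ?ReM ?ImM /=; ring. Qed.

Lemma normc_circle r (t : R) : 0 <= r -> normc (E r t) = r.
Proof.
move=> r0; apply/eqP; rewrite -(eqrXn2 (n := 2))// normc_sqr /=.
by rewrite !exprMn -mulrDr cos2Dsin2 mulr1.
Qed.

Lemma pcont_circle r (t : R) : pcont (E r) t.
Proof.
apply: (@ccont_eq _ (fun w => r%:C%C * cexp ('i%C * (Re w)%:C%C))) => [w|].
  have -> : 'i%C * (Re w)%:C%C = (0 +i* Re w)%C by apply: complex_ext => /=; ring.
  by rewrite /cexp /= expR0; apply: complex_ext; rewrite ?ReM ?ImM /=; ring.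
apply: ccontM; first exact: ccont_cst.
apply: (@pcont_comp _ cexp (fun t => 'i%C * t%:C%C) t); last first.
  exact: cderiv_cont (cderiv_cexp _).
apply: ccontM; first exact: ccont_cst.
by apply: (@pcont_real _ (fun t => t)); exact: cvg_id.
Qed.

(** The integral is in the angle: since dz = i z dt on the circle, a contour integral of [F z] dz
    becomes, up to the factor i, [circ_int] of [z * F z]. This is why Cauchy's kernel appears below
    as [z / (z - p)]. *)
Definition circ_int f (r : R) : C := cint 0 (2 * pi) (fun t => f (E r t)).

Lemma twopi_ge0 : 0 <= 2 * pi :> R.
Proof. by rewrite mulr_ge0// pi_ge0. Qed.

Lemma pcts_circle f (r : R) : 0 <= r -> (forall z, normc z = r -> ccont f z) ->
  pcts 0 (2 * pi) (fun t => f (E r t)).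
Proof.
move=> r0 h t _; apply: pcont_comp; first exact: pcont_circle.
by apply: h; rewrite normc_circle.
Qed.

Lemma eq_circ_int f g (r : R) : 0 <= r -> (forall z, normc z = r -> f z = g z) ->
  circ_int f r = circ_int g r.
Proof. by move=> r0 h; apply: eq_cint => t _; rewrite h// normc_circle. Qed.

Lemma circ_int_bound f (r e : R) : 0 <= r -> (forall z, normc z = r -> ccont f z) ->
  (forall z, normc z = r -> normc (f z) <= e) ->
  normc (circ_int f r) <= 2 * e * (2 * pi).
Proof.
move=> r0 hc h; rewrite -[2 * pi in leRHS]subr0.
apply: cint_bound; [exact: twopi_ge0|exact: pcts_circle|].
by move=> t _; rewrite h// normc_circle.
Qed.

Lemma circ_intB f g (r : R) : 0 <= r -> (forall z, normc z = r -> ccont f z) ->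
  (forall z, normc z = r -> ccont g z) ->
  circ_int (fun z => f z - g z) r = circ_int f r - circ_int g r.
Proof. by move=> r0 hf hg; apply: cintB; exact: pcts_circle. Qed.

Lemma circ_intD f g (r : R) : 0 <= r -> (forall z, normc z = r -> ccont f z) ->
  (forall z, normc z = r -> ccont g z) ->
  circ_int (fun z => f z + g z) r = circ_int f r + circ_int g r.
Proof. by move=> r0 hf hg; apply: cintD; exact: pcts_circle. Qed.

Lemma circ_intZ k f (r : R) : 0 <= r -> (forall z, normc z = r -> ccont f z) ->
  circ_int (fun z => k * f z) r = k * circ_int f r.
Proof. by move=> r0 hf; apply: cintZ; exact: pcts_circle. Qed.

Lemma circ_int_cst k (r : R) : circ_int (fun=> k) r = k * (2 * pi)%:C%C.
Proof. by rewrite /circ_int cint_cst ?subr0//; exact: twopi_ge0. Qed.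

(* Goursat for [f \o exp] on a rectangle of height [2 * pi]: the horizontal sides
   cancel by periodicity. *)
Lemma circ_int_annulus f (r1 r2 : R) : 0 < r1 -> r1 <= r2 ->
  holo (fun z => r1 <= normc z <= r2) f -> circ_int f r1 = circ_int f r2.
Proof.
move=> r10 r12 hf; have r20 : 0 < r2 := lt_le_trans r10 r12.
have L : ln r1 <= ln r2 by rewrite ler_ln.
have hg : holo (in_rect (ln r1) (ln r2) 0 (2 * pi)) (fun w => f (cexp w)).
  apply: (holo_comp _ _ hf) => z; first by exists (cexp z); exact: cderiv_cexp.
  by rewrite /in_rect normc_cexp => /andP[/andP[h1 h2] _];
    rewrite -[r1]lnK ?posrE// -[r2]lnK ?posrE// !ler_expR h1 h2.
have := goursat L twopi_ge0 hg; rewrite /bdry.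
rewrite (eq_cint (psi := fun=> 0)) => [|t _]; last first.
  suff -> : cexp (t +i* (2 * pi))%C = cexp (t +i* 0)%C by rewrite subrr.
  by apply: complex_ext; rewrite /= mulr_natl ?cos2pi ?sin2pi ?cos0 ?sin0.
rewrite cint_cst// mul0r add0r => /eqP; rewrite mulf_eq0.
rewrite -[X in X || _]normc_eq0 normc_i oner_eq0 /= => /eqP.
have cexpE (r y : R) : 0 < r -> cexp (ln r +i* y)%C = E r y.
  by move=> r0; apply: complex_ext; rewrite /= lnK.
rewrite (eq_cint (psi := fun t => f (E r2 t) - f (E r1 t))) => [|t _]; last by rewrite !cexpE.
rewrite cintB => [/eqP|t _|t _]; first by rewrite subr_eq0 => /eqP.
- apply: pcont_comp; first exact: pcont_circle.
  by apply: (holo_cont hf); rewrite normc_circle ?r12 ?lexx// ltW.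
- apply: pcont_comp; first exact: pcont_circle.
  by apply: (holo_cont hf); rewrite normc_circle ?r12 ?lexx// ltW.
Qed.

End CauchyFormula.

(** * Compactness of closed discs and Cauchy's formula *)

Section CauchyDisc.
Set Implicit Arguments.
Unset Strict Implicit.
Variable R : realType.
Local Notation C := R[i].
Local Notation E := (@circle_point R).
Implicit Types (f g : C -> C) (z w s l p : C) (B r e : R).

(* Compactness of the closed disc, as an induction principle on sets of points. *)
Lemma disc_ind B (Pr : (C -> Prop) -> Prop) :
  (forall S S' : C -> Prop, (forall z, S z -> S' z) -> Pr S' -> Pr S) ->
  (forall S S' : C -> Prop, Pr S -> Pr S' -> Pr (fun z => S z \/ S' z)) ->
  Pr (fun=> False) ->
  (forall z, normc z <= B -> exists2 d : R, 0 < d & Pr (fun w => normc (w - z) < d)) ->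
  Pr (fun z => normc z <= B).
Proof.
move=> mono union0 empty loc.
have [B0|B0] := ltP B 0.
  by apply: mono empty => z h; have := le_lt_trans h B0; rewrite ltNge normc_ge0.
pose T a b c d := Pr (fun z => normc z <= B /\ in_rect a b c d z).
suff : T (- B) B (- B) B.
  apply: mono => z h; split=> //; rewrite /in_rect -!ler_norml.
  by rewrite (le_trans (Re_le_normc z) h) (le_trans (Im_le_normc z) h).
apply: rect_ind; try lra.
- move=> a b c d _ _ _ _ _ _ h1 h2 h3 h4.
  apply: mono (union0 _ _ (union0 _ _ h1 h2) (union0 _ _ h3 h4)) => z [zB].
  rewrite /in_rect => /andP[/andP[z1 z2] /andP[z3 z4]].
  by have [?|?] := leP (Re z) ((a + b) / 2); have [?|?] := leP (Im z) ((c + d) / 2);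
    [left; left|right; left|left; right|right; right]; split=> //;
    apply/andP; split; apply/andP; split => //; exact: ltW.
- move=> x y _ _ _ _; pose p := (x +i* y)%C.
  have near a b c d e z : a <= x -> x <= b -> c <= y -> y <= d -> b - a < e -> d - c < e ->
      in_rect a b c d z -> normc (z - p) < 2 * e.
    move=> h1 h2 h3 h4 h5 h6 /andP[/andP[h7 h8] /andP[h9 h10]].
    apply: le_lt_trans (normc_le_ReIm _) _; rewrite ReB ImB /= mulr_natl mulr2n.
    by apply: ltrD; rewrite ltr_norml; apply/andP; split; lra.
  have [pB|pB] := leP (normc p) B.
    have [d d0 hd] := loc p pB; exists (d / 2); first by rewrite divr_gt0.
    move=> a b c d' _ ? ? _ _ ? ? _ ? ?; apply: mono hd => z [_ zr].
    rewrite -[d in _ < d](@mulfVK _ 2) ?pnatr_eq0// [_ * 2]mulrC.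
    exact: (near a b c d').
  exists ((normc p - B) / 2); first by rewrite divr_gt0// subr_gt0.
  move=> a b c d' _ ? ? _ _ ? ? _ ? ?; apply: mono empty => z [zB zr].
  have := near a b c d' _ z; move=> /(_ ((normc p - B) / 2)) h.
  have : normc (z - p) < 2 * ((normc p - B) / 2) by exact: h.
  rewrite mulrC mulfVK ?pnatr_eq0// normc_distC => h'.
  by have := le_lt_trans (ler_dist_normc _ _) h'; lra.
Qed.

Lemma unif_cont f B : (forall z, normc z <= B -> ccont f z) ->
  forall e, 0 < e -> exists2 d : R, 0 < d & forall z w, normc z <= B -> normc w <= B ->
    normc (w - z) < d -> normc (f w - f z) < e.
Proof.
move=> hf e e0.
pose Pr (S : C -> Prop) := exists2 d : R, 0 < d & forall z w, S z -> normc w <= B ->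
    normc (w - z) < d -> normc (f w - f z) < e.
apply: (@disc_ind B Pr).
- by move=> S S' sub [d d0 hd]; exists d => // z w /sub; exact: hd.
- move=> S S' [d d0 hd] [d' d'0 hd']; exists (Num.min d d'); first by rewrite lt_min d0.
  by move=> z w [Sz|Sz] wB; rewrite lt_min => /andP[? ?]; [exact: hd|exact: hd'].
- by exists 1.
- move=> z zB; have [|d d0 hd] := hf z zB (e / 2); first by rewrite divr_gt0.
  exists (d / 2); first by rewrite divr_gt0.
  exists (d / 2); first by rewrite divr_gt0.
  move=> z' w z'z wB wz'.
  have wz : normc (w - z) < d.
    have -> : w - z = (w - z') + (z' - z) by ring.
    by apply: le_lt_trans (le_normcD _ _) _; rewrite (splitr d) ltrD.
  have z'd : normc (z' - z) < d by lra.
  have -> : f w - f z' = (f w - f z) - (f z' - f z) by ring.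
  apply: le_lt_trans (ler_normcB _ _) _; rewrite (splitr e) ltrD//; exact: hd.
Qed.

Lemma bounded_disc f B : (forall z, normc z <= B -> ccont f z) ->
  exists2 M, 0 < M & forall z, normc z <= B -> normc (f z) <= M.
Proof.
move=> hf; pose Pr (S : C -> Prop) := exists2 M, 0 < M & forall z, S z -> normc (f z) <= M.
apply: (@disc_ind B Pr).
- by move=> S S' sub [M M0 hM]; exists M => // z /sub /hM.
- move=> S S' [M M0 hM] [M' M'0 hM']; exists (Num.max M M'); first by rewrite lt_max M0.
  by move=> z [/hM|/hM'] h; rewrite le_max h ?orbT.
- by exists 1.
- move=> z /hf /ccont_bounded[d d0 hd]; exists d => //.
  by exists (normc (f z) + 1) => [|w /hd /ltW//]; rewrite ltr_wpDl.
Qed.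

Lemma bounded_away_disc f B : (forall z, normc z <= B -> ccont f z) ->
  (forall z, normc z <= B -> f z != 0) ->
  exists2 c : R, 0 < c & forall z, normc z <= B -> c <= normc (f z).
Proof.
move=> hf f0; have [|M M0 hM] := @bounded_disc (fun z => (f z)^-1) B.
  by move=> z zB; apply: ccontV; [exact: f0|exact: hf].
exists M^-1; first by rewrite invr_gt0.
move=> z zB; have := hM z zB; rewrite normcV => h.
by rewrite -[normc _]invrK lef_pV2 // posrE invr_gt0 normc_gt0 f0.
Qed.

Lemma circ_int_unif f B e : (forall z, normc z <= B -> ccont f z) -> 0 < e ->
  exists2 d : R, 0 < d & forall r r', 0 <= r <= B -> 0 <= r' <= B -> `|r' - r| < d ->
    normc (circ_int f r' - circ_int f r) <= e.
Proof.
move=> hf e0; pose k := e / (2 * (2 * pi)).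
have k0 : 0 < k by rewrite divr_gt0// !mulr_gt0// ?pi_gt0.
have [d d0 hd] := unif_cont hf k0.
exists d => // r r' /andP[r0 rB] /andP[r'0 r'B] rr'.
have c1 : pcts 0 (2 * pi) (fun t => f (E r t)).
  by apply: pcts_circle => // z zr; apply: hf; rewrite zr.
have c2 : pcts 0 (2 * pi) (fun t => f (E r' t)).
  by apply: pcts_circle => // z zr; apply: hf; rewrite zr.
rewrite /circ_int -cintB//.
have -> : e = 2 * k * (2 * pi - 0).
  have pi0 : pi != 0 :> R by rewrite gt_eqF// pi_gt0.
  by rewrite subr0 /k; move: (@pi R) pi0 => q q0; field.
apply: cint_bound; [exact: twopi_ge0|exact: pctsB|].
move=> t _; apply: ltW; apply: hd; rewrite ?normc_circle//.
rewrite circle_pointE [X in _ - X]circle_pointE -mulrBl normcM.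
by rewrite normc_circle// mulr1 -rmorphB normcR.
Qed.

Lemma small_norm_eq0 z (K : R) : (forall e, 0 < e -> normc z <= e * K) -> z = 0.
Proof.
move=> h; apply/eqP; rewrite -normc_eq0 eq_le normc_ge0 andbT leNgt; apply/negP => z0.
have [K0|K0] := leP K 0.
  have := h 1 ltr01; rewrite mul1r => /le_trans /(_ K0).
  by rewrite leNgt z0.
have := h (normc z / (2 * K)); rewrite divr_gt0 ?mulr_gt0// => /(_ isT).
have -> : normc z / (2 * K) * K = normc z / 2 by field; rewrite gt_eqF.
lra.
Qed.

(** Circle integrals do not depend on the radius in a punctured disc, and by continuity they tend to
    the value at the centre. Differentiability is asked for off the centre so that the lemma covers
    an exceptional point at 0. *)
Lemma mean_value f (r : R) : 0 < r -> (forall z, normc z <= r -> ccont f z) ->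
  holo (fun z => 0 < normc z <= r) f -> circ_int f r = f 0 * (2 * pi)%:C%C.
Proof.
move=> r0 hc hf; apply/eqP; rewrite -subr_eq0; apply/eqP.
apply: (@small_norm_eq0 _ (1 : R)) => e e0; rewrite mulr1.
have [d d0 hd] := circ_int_unif hc e0.
pose r1 := Num.min r (d / 2).
have r10 : 0 < r1 by rewrite lt_min r0 divr_gt0.
have r1r : r1 <= r by rewrite ge_min lexx.
have r1d : r1 < d by rewrite gt_min; apply/orP; right; lra.
have <- : circ_int f r1 = circ_int f r.
  apply: circ_int_annulus => //; apply: holo_sub hf => z /andP[h1 ->].
  by rewrite (lt_le_trans r10 h1).
have <- : circ_int f 0 = f 0 * (2 * pi)%:C%C.
  rewrite -(circ_int_cst _ 0); apply: eq_circ_int => // z /eqP.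
  by rewrite normc_eq0 => /eqP ->.
by apply: hd; rewrite ?lexx ?(ltW r0) ?(ltW r10)// subr0 gtr0_norm.
Qed.

(* Differentiability may fail at [p]: circle means do not change on either side of
   [|z| = |p|], and they depend continuously on the radius. *)
Lemma circ_int_exceptional f (r : R) p : 0 < r -> normc p < r ->
  (forall z, normc z <= r -> ccont f z) ->
  holo (fun z => normc z <= r /\ z != p) f -> circ_int f r = f 0 * (2 * pi)%:C%C.
Proof.
move=> r0 pr hc hf; have [p0|p0] := eqVneq p 0.
  apply: mean_value => //; apply: holo_sub hf => z /andP[z0 ->].
  by rewrite p0 -normc_gt0.
rewrite -normc_gt0 in p0.
have below r1 : 0 < r1 -> r1 < normc p -> circ_int f r1 = f 0 * (2 * pi)%:C%C.
  move=> r10 r1p; apply: mean_value => //.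
    by move=> z zr1; apply: hc; rewrite (le_trans zr1)// ltW// (lt_trans r1p).
  apply: holo_sub hf => z /andP[z0 zr1]; split.
    by rewrite (le_trans zr1)// ltW// (lt_trans r1p).
  by apply: contraTneq zr1 => ->; rewrite -ltNge.
have above r1 : normc p < r1 -> r1 <= r -> circ_int f r1 = circ_int f r.
  move=> pr1 r1r; apply: circ_int_annulus => //; first exact: lt_trans pr1.
  apply: holo_sub hf => z /andP[z1 z2]; split=> //.
  by apply: contraTneq z1 => ->; rewrite -ltNge.
apply/eqP; rewrite -subr_eq0; apply/eqP.
apply: (@small_norm_eq0 _ (1 : R)) => e e0; rewrite mulr1.
have [d d0 hd] := circ_int_unif hc e0.
pose k := Num.min (d / 3) (Num.min (normc p / 2) (r - normc p)).
have k0 : 0 < k by rewrite !lt_min !divr_gt0// subr_gt0.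
have k1 : k <= d / 3 by rewrite ge_min lexx.
have k2 : k <= normc p / 2 by rewrite !ge_min lexx orbT.
have k3 : k <= r - normc p by rewrite !ge_min lexx !orbT.
move: k k0 k1 k2 k3 => k k0 k1 k2 k3.
rewrite -(below (normc p - k)); [|lra|lra].
rewrite -(above (normc p + k)); [|lra|lra].
by apply: hd; [lra|lra|rewrite ltr_norml; lra].
Qed.

(** The integral is the same over all larger circles, and [z / (z - p)] tends to 1 at infinity. *)
Lemma circ_int_kernel1 (r : R) p : normc p < r ->
  circ_int (fun z => z / (z - p)) r = (2 * pi)%:C%C.
Proof.
move=> pr; have r0 : 0 < r := le_lt_trans (normc_ge0 _) pr.
have nz z : r <= normc z -> z - p != 0.
  by move=> zr; rewrite subr_eq0; apply: contraTneq zr => ->; rewrite -ltNge.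
apply/eqP; rewrite -subr_eq0; apply/eqP.
apply: (@small_norm_eq0 _ (2 * (2 * pi) : R)) => e e0.
(* On |z| = r' the kernel differs from 1 by at most |p| / (r' - |p|), which is at most [e] because
   r' - |p| >= |p| / e. *)
pose r' := r + normc p / e.
have rr' : r <= r' by rewrite lerDl; apply: divr_ge0; [exact: normc_ge0|exact: ltW].
have r'0 : 0 <= r' by rewrite (le_trans _ rr')// ltW.
have hh : holo (fun z => r <= normc z) (fun z => z / (z - p)).
  apply: holoM; first exact: holo_id.
  apply: holoV => //; apply: holoB; [exact: holo_id|exact: holo_cst].
rewrite (@circ_int_annulus _ _ r r')//; last first.
  by apply: holo_sub hh => z /andP[].
have cc z : normc z = r' -> ccont (fun z => z / (z - p)) z.
  by move=> zr; apply: (holo_cont hh); rewrite zr.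
rewrite -[X in _ - X]mul1r -(circ_int_cst _ r') -circ_intB//; last first.
  by move=> z _; exact: ccont_cst.
have -> : e * (2 * (2 * pi)) = 2 * e * (2 * pi) by ring.
apply: circ_int_bound => // [z zr|z zr].
  by apply: ccontB; [exact: cc|exact: ccont_cst].
have zp : z - p != 0 by apply: nz; rewrite zr.
have -> : z / (z - p) - 1 = p / (z - p) by field.
rewrite normcM normcV ler_pdivrMr ?normc_gt0//.
have := ler_dist_normc z p; rewrite zr /r' => h.
rewrite mulrC -ler_pdivrMr//; lra.
Qed.

(** The difference quotient [q] of [f] at [p] is continuous at [p] but not yet known to be
    differentiable there, which is the situation of [circ_int_exceptional]. Applied to [z * q z], it
    gives 0, as this function vanishes at 0. *)
Theorem cauchy_formula f (r : R) p : normc p < r -> holo (fun z => normc z <= r) f ->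
  circ_int (fun z => f z * (z / (z - p))) r = f p * (2 * pi)%:C%C.
Proof.
move=> pr hf; have r0 : 0 < r := le_lt_trans (normc_ge0 _) pr.
have [l hl] := hf p (ltW pr); have [q [_ cq fE]] := (cderivP _ _ _).1 hl.
have qE z : z != p -> q z = (f z - f p) / (z - p).
  by rewrite -subr_eq0 => zp; rewrite (fE z); field.
have hq z : normc z <= r -> z != p -> exists k, cderiv q z k.
  move=> zr zp; have [k hk] := hf z zr.
  have zp0 : z - p != 0 by rewrite subr_eq0.
  exists ((k - 0) * (z - p)^-1 + (f z - f p) * (- ((z - p)^-1 ^+ 2) * (1 - 0))).
  apply: (@cderiv_near _ (fun w => (f w - f p) / (w - p)) _ _ _ (normc (z - p))).
  - by rewrite normc_gt0.
  - move=> w wz; rewrite qE//; apply: contraTneq wz => ->.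
    by rewrite normc_distC ltxx.
  apply: cderivM; first by apply: cderivB => //; exact: cderiv_cst.
  by apply: cderivV => //; apply: cderivB; [exact: cderiv_id|exact: cderiv_cst].
have cq' z : normc z <= r -> ccont q z.
  by move=> zr; have [->//|/(hq z zr)[k]] := eqVneq z p; exact: cderiv_cont.
have : circ_int (fun z => z * q z) r = (0 * q 0) * (2 * pi)%:C%C.
  apply: (@circ_int_exceptional _ _ p) => //.
    by move=> z zr; apply: ccontM; [exact: ccont_id|exact: cq'].
  by apply: holoM; [exact: holo_id|move=> z [zr zp]; exact: hq].
have nz z : normc z = r -> z - p != 0.
  by move=> zr; rewrite subr_eq0; apply: contraTneq pr => <-; rewrite zr ltxx.
have ck z : normc z = r -> ccont (fun z => z / (z - p)) z.
  move=> zr; apply: ccontM; first exact: ccont_id.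
  apply: ccontV; first exact: nz.
  by apply: ccontB; [exact: ccont_id|exact: ccont_cst].
have cf z : normc z = r -> ccont f z.
  by move=> zr; apply: (holo_cont hf); rewrite zr.
rewrite (@eq_circ_int _ _ (fun z => f z * (z / (z - p)) - f p * (z / (z - p)))) ?(ltW r0)//; last first.
  move=> z zr; have h := nz z zr; rewrite qE; last by rewrite -subr_eq0.
  by field.
rewrite circ_intB ?(ltW r0)//; last 2 first.
- by move=> z zr; apply: ccontM; [exact: cf|exact: ck].
- by move=> z zr; apply: ccontM; [exact: ccont_cst|exact: ck].
rewrite circ_intZ ?(ltW r0)// circ_int_kernel1// !mul0r => /eqP.
by rewrite subr_eq0 => /eqP.
Qed.

End CauchyDisc.

(** * Entire functions *)

Section EntireFunctions.
Set Implicit Arguments.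
Unset Strict Implicit.
Variable R : realType.
Local Notation C := R[i].
Local Notation E := (@circle_point R).
Implicit Types (f g q : C -> C) (z w s l p a : C) (B r e : R).

Definition cmean f r : C := circ_int f r / (2 * pi)%:C%C.

Lemma twopi_gt0 : 0 < 2 * pi :> R.
Proof. by rewrite mulr_gt0// pi_gt0. Qed.

Lemma twopiC_neq0 : (2 * pi)%:C%C != 0 :> C.
Proof. by rewrite -normc_gt0 normcR gtr0_norm ?twopi_gt0. Qed.

Definition cts_circle f r := forall z, normc z = r -> ccont f z.

Lemma cmeanD f g r : 0 <= r -> cts_circle f r -> cts_circle g r ->
  cmean (fun z => f z + g z) r = cmean f r + cmean g r.
Proof. by move=> r0 hf hg; rewrite /cmean circ_intD// mulrDl. Qed.

Lemma cmeanB f g r : 0 <= r -> cts_circle f r -> cts_circle g r ->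
  cmean (fun z => f z - g z) r = cmean f r - cmean g r.
Proof. by move=> r0 hf hg; rewrite /cmean circ_intB// mulrBl. Qed.

Lemma cmeanZ k f r : 0 <= r -> cts_circle f r ->
  cmean (fun z => k * f z) r = k * cmean f r.
Proof. by move=> r0 hf; rewrite /cmean circ_intZ// mulrA. Qed.

Lemma cmean_bound f r e : 0 <= r -> cts_circle f r ->
  (forall z, normc z = r -> normc (f z) <= e) -> normc (cmean f r) <= 2 * e.
Proof.
move=> r0 hf h; rewrite normcM normcV normcR gtr0_norm ?twopi_gt0//.
by rewrite ler_pdivrMr ?twopi_gt0//; exact: circ_int_bound.
Qed.

Lemma eq_cmean f g r : 0 <= r -> (forall z, normc z = r -> f z = g z) ->
  cmean f r = cmean g r.
Proof. by move=> r0 h; congr (_ / _); exact: eq_circ_int. Qed.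

Lemma cmean_cauchy f r p : normc p < r -> holo (fun z => normc z <= r) f ->
  cmean (fun z => f z * (z / (z - p))) r = f p.
Proof.
by move=> pr hf; rewrite /cmean cauchy_formula// mulfK// twopiC_neq0.
Qed.

Lemma cderiv_quadratic f z l (M d : R) : 0 < d -> (forall s, normc s < d ->
  normc (f (z + s) - f z - l * s) <= M * normc s ^+ 2) -> cderiv f z l.
Proof.
move=> d0 h e e0; pose K := Num.max 1 M; have K0 : 0 < K by rewrite lt_max ltr01.
exists (Num.min d (e / K)); first by rewrite lt_min d0 divr_gt0.
move=> s; rewrite lt_min ltr_pdivlMr// => /andP[sd sK].
apply: le_trans (h s sd) _; rewrite expr2 mulrA ler_wpM2r//.
apply: le_trans (ltW sK); rewrite [leRHS]mulrC ler_wpM2r//.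
by rewrite /K le_max lexx orbT.
Qed.

Definition ent f := holo (fun=> True) f.

Lemma ent_cderiv f z : ent f -> cderiv f z ((f^`())%classic z).
Proof. by move=> /holo_entire /(_ z) /derivable_cderiv. Qed.

Lemma ent_cont f z : ent f -> ccont f z.
Proof. by move=> /holo_cont; exact. Qed.

Lemma ent_holo P f : ent f -> holo P f.
Proof. exact: holo_sub. Qed.

(* Cauchy's formula for the Taylor coefficient of index [k.-1] of [f] at [p]. *)
Definition cauchy_coef f r k p := cmean (fun z => f z * (z * (z - p)^-1 ^+ k)) r.

(** With u = 1 / (z - p) and v = 1 / (z - p - s), each estimate is Cauchy's formula applied to a
    rational identity, such as v - u - s u^2 = s^2 u^2 v. The radius [B + 2] keeps |u| and |v| at
    most 1. In the constant 6, the 2 comes from [cmean_bound] and the 3 from |u + (u + v)|. *)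
Lemma ent_expansion f B : ent f -> 0 <= B -> exists2 M, 0 < M &
  forall p s, normc p <= B -> normc s <= 1 ->
  normc (f (p + s) - f p - cauchy_coef f (B + 2) 2 p * s) <= M * normc s ^+ 2 /\
  normc (f (p + s) - f p - cauchy_coef f (B + 2) 2 p * s -
    cauchy_coef f (B + 2) 3 p * s ^+ 2) <= M * normc s ^+ 3 /\
  normc (cauchy_coef f (B + 2) 2 (p + s) - cauchy_coef f (B + 2) 2 p -
    (2 * cauchy_coef f (B + 2) 3 p) * s) <= M * normc s ^+ 2.
Proof.
move=> hf B0; set r := B + 2; have r0 : 0 <= r by rewrite addr_ge0.
have [M0 M00 hM0] := bounded_disc (B := r) (fun z _ => ent_cont z hf).
exists (6 * (M0 * r)); first by rewrite mulr_gt0// mulr_gt0// ltr_wpDl.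
move=> p s pB s1.
have psr : normc (p + s) <= B + 1 by apply: le_trans (le_normcD _ _) _; rewrite lerD.
pose u z := (z - p)^-1; pose v z := (z - (p + s))^-1.
have far w z : normc w <= B + 1 -> normc z = r -> 1 <= normc (z - w).
  by move=> wB zr; apply: le_trans (ler_dist_normc _ _); rewrite zr /r; lra.
have nz w z : normc w <= B + 1 -> normc z = r -> z - w != 0.
  by move=> wB zr; rewrite -normc_gt0 (lt_le_trans ltr01)// far.
have pB1 : normc p <= B + 1 by lra.
have u1 z : normc z = r -> normc (u z) <= 1.
  by move=> zr; rewrite /u normcV invf_le1 ?normc_gt0 ?nz ?far.
have v1 z : normc z = r -> normc (v z) <= 1.
  by move=> zr; rewrite /v normcV invf_le1 ?normc_gt0 ?nz ?far.
have cinv w : normc w <= B + 1 -> cts_circle (fun z => (z - w)^-1) r.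
  move=> wB z zr; apply: ccontV; first exact: nz.
  by apply: ccontB; [exact: ccont_id|exact: ccont_cst].
have cf g : cts_circle g r -> cts_circle (fun z => f z * (z * g z)) r.
  move=> hg z zr; apply: ccontM; first exact: ent_cont.
  by apply: ccontM; [exact: ccont_id|exact: hg].
have cu : cts_circle u r by exact: cinv.
have cv : cts_circle v r by exact: cinv.
have bnd g (k : R) : cts_circle g r -> (forall z, normc z = r -> normc (g z) <= k) ->
    normc (cmean (fun z => f z * (z * g z)) r) <= 2 * (M0 * (r * k)).
  move=> hg h; apply: cmean_bound => //; first exact: cf.
  move=> z zr; rewrite !normcM; apply: ler_pM; rewrite ?mulr_ge0//.
    by apply: hM0; rewrite zr.
  by rewrite zr; apply: ler_wpM2l => //; exact: h.
have hr : holo (fun z => normc z <= r) f by exact: ent_holo.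
have E1 : f p = cmean (fun z => f z * (z * u z)) r.
  by rewrite cmean_cauchy//; rewrite /r; lra.
have E2 : f (p + s) = cmean (fun z => f z * (z * v z)) r.
  by rewrite cmean_cauchy//; rewrite /r; lra.
have cuk k : cts_circle (fun z => u z ^+ k) r by move=> z zr; apply: ccontX; exact: cu.
have cvk k : cts_circle (fun z => v z ^+ k) r by move=> z zr; apply: ccontX; exact: cv.
have cM g h : cts_circle g r -> cts_circle h r -> cts_circle (fun z => g z * h z) r.
  by move=> hg hh z zr; apply: ccontM; [exact: hg|exact: hh].
have cD g h : cts_circle g r -> cts_circle h r -> cts_circle (fun z => g z + h z) r.
  by move=> hg hh z zr; apply: ccontD; [exact: hg|exact: hh].
have lin3 (k1 k2 k3 : C) g1 g2 g3 g4 : cts_circle g1 r -> cts_circle g2 r -> cts_circle g3 r ->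
   (forall z, normc z = r -> k1 * g4 z = g1 z - g2 z - k2 * g3 z) -> cts_circle g4 r ->
   cmean (fun z => f z * (z * g1 z)) r - cmean (fun z => f z * (z * g2 z)) r -
   cmean (fun z => f z * (z * g3 z)) r * k2 = k1 * cmean (fun z => f z * (z * g4 z)) r.
  move=> h1 h2 h3 h h4; rewrite [_ * k2]mulrC -!cmeanZ//; try exact: cf.
  have c12 : cts_circle (fun z => f z * (z * g1 z) - f z * (z * g2 z)) r.
    by move=> z zr; apply: ccontB; apply: cf.
  have c3 : cts_circle (fun z => k2 * (f z * (z * g3 z))) r.
    by move=> z zr; apply: ccontM; [exact: ccont_cst|exact: cf].
  rewrite -!cmeanB//; try exact: cf.
  apply: eq_cmean => // z zr.
  transitivity (f z * (z * (k1 * g4 z))); last by ring.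
  by rewrite h//; ring.
have A1 : f (p + s) - f p - cauchy_coef f r 2 p * s =
    s ^+ 2 * cmean (fun z => f z * (z * (u z ^+ 2 * v z))) r.
  rewrite E1 E2; apply: lin3 => //; last by apply: cM.
  move=> z zr; have := nz _ _ pB1 zr; have := nz _ _ psr zr.
  by rewrite /u /v => h1 h2; field; rewrite h1 h2.
split; last split.
- rewrite A1 normcM normcX mulrC ler_wpM2r ?exprn_ge0//.
  apply: le_trans (bnd _ 1 _ _) _ => [|z zr|].
  + by apply: cM.
  + by rewrite normcM normcX mulr_ile1 ?exprn_ge0 ?exprn_ile1 ?u1 ?v1.
  + by rewrite mulr1; apply: ler_wpM2r; [rewrite mulr_ge0// ltW|lra].
- rewrite A1 -[_ * s ^+ 2]mulrC -mulrBr /cauchy_coef -cmeanB//; [|by apply: cf; apply: cM|exact: cf].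
  rewrite (@eq_cmean _ (fun z => s * (f z * (z * (u z ^+ 3 * v z)))))//; last first.
    move=> z zr; have := nz _ _ pB1 zr; have := nz _ _ psr zr.
    by rewrite /u /v => h1 h2; field; rewrite h1 h2.
  rewrite cmeanZ//; last by apply: cf; apply: cM.
  rewrite normcM [normc (s * _)]normcM normcX mulrA -exprSr mulrC ler_wpM2r ?exprn_ge0//.
  apply: le_trans (bnd _ 1 _ _) _ => [|z zr|].
  + by apply: cM.
  + by rewrite normcM normcX mulr_ile1 ?exprn_ge0 ?exprn_ile1 ?u1 ?v1.
  + by rewrite mulr1; apply: ler_wpM2r; [rewrite mulr_ge0// ltW|lra].
- have -> : cauchy_coef f r 2 (p + s) - cauchy_coef f r 2 p - 2 * cauchy_coef f r 3 p * s =
     s ^+ 2 * cmean (fun z => f z * (z * (u z ^+ 2 * (v z * (u z + (u z + v z)))))) r.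
    rewrite [2 * _ * s]mulrAC [2 * s * _]mulrC.
    apply: lin3 => //; last by apply: (cM) => //; apply: cM => //; apply: (cD) => //; exact: cD.
    move=> z zr; have := nz _ _ pB1 zr; have := nz _ _ psr zr.
    by rewrite /u /v => h1 h2; field; rewrite h1 h2.
  rewrite normcM normcX mulrC ler_wpM2r ?exprn_ge0//.
  apply: le_trans (bnd _ 3 _ _) _ => [|z zr|].
  + by apply: (cM) => //; apply: cM => //; apply: (cD) => //; exact: cD.
  + rewrite normcM [normc (v z * _)]normcM normcX -[3]mul1r.
    apply: ler_pM; rewrite ?exprn_ge0 ?exprn_ile1 ?mulr_ge0 ?u1//.
    rewrite -[3]mul1r; apply: ler_pM; rewrite ?v1//.
    apply: le_trans (le_normcD _ _) _; have := le_normcD (u z) (v z).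
    by have := u1 z zr; have := v1 z zr; lra.
  + by rewrite le_eqVlt; apply/orP; left; apply/eqP; ring.
Qed.

Lemma cauchy_coefE f B p : ent f -> 0 <= B -> normc p <= B ->
  (f^`())%classic p = cauchy_coef f (B + 2) 2 p.
Proof.
move=> hf B0 pB; have [M M0 hM] := ent_expansion hf B0.
apply: cderiv_uniq (ent_cderiv p hf) _.
by apply: (@cderiv_quadratic _ _ _ M 1) => // s /ltW s1; have [] := hM p s pB s1.
Qed.

Lemma ent_derive f : ent f -> ent (f^`())%classic.
Proof.
move=> hf z _; pose B := normc z + 1; have B0 : 0 <= B by rewrite addr_ge0.
have [M M0 hM] := ent_expansion hf B0.
exists (2 * cauchy_coef f (B + 2) 3 z).
apply: (@cderiv_quadratic _ _ _ M 1) => // s s1.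
have zB : normc z <= B by rewrite lerDl.
have zsB : normc (z + s) <= B by apply: le_trans (le_normcD _ _) _; rewrite lerD2l ltW.
by rewrite !(cauchy_coefE hf B0)//; have [_ []] := hM z s zB (ltW s1).
Qed.

Lemma ent_taylor1 f B : ent f -> exists2 M, 0 < M & forall p s, normc p <= B ->
  normc s <= 1 -> normc (f (p + s) - f p - (f^`())%classic p * s) <= M * normc s ^+ 2.
Proof.
move=> hf; have [B0|B0] := leP 0 B; last first.
  by exists 1 => // p s pB; have := le_lt_trans pB B0; rewrite ltNge normc_ge0.
have [M M0 hM] := ent_expansion hf B0; exists M => // p s pB s1.
by rewrite (cauchy_coefE hf B0 pB); have [] := hM p s pB s1.
Qed.

(** The only delicate point is the differentiability of the quotient at [a]: it is the second-order
    expansion of [f] at [a], with its cubic error, divided by [s]. *)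
Lemma ent_divide f a : ent f -> exists2 q, ent q & forall z, f z = f a + (z - a) * q z.
Proof.
move=> hf; pose l := (f^`())%classic a.
pose q z := if z == a then l else (f z - f a) / (z - a).
exists q; last first.
  move=> z; rewrite /q; case: eqVneq => [->|za]; first by rewrite subrr mul0r addr0.
  by rewrite -subr_eq0 in za; field.
move=> z _; have [->|za] := eqVneq z a; last first.
  have za0 : z - a != 0 by rewrite subr_eq0.
  have [k hk] := hf z I.
  exists ((k - 0) * (z - a)^-1 + (f z - f a) * (- ((z - a)^-1 ^+ 2) * (1 - 0))).
  apply: (@cderiv_near _ (fun w => (f w - f a) / (w - a)) _ _ _ (normc (z - a))).
  - by rewrite normc_gt0.
  - move=> w wz; rewrite /q; case: eqVneq wz => [->|//].
    by rewrite normc_distC ltxx.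
  apply: cderivM; first by apply: cderivB => //; exact: cderiv_cst.
  by apply: cderivV => //; apply: cderivB; [exact: cderiv_id|exact: cderiv_cst].
have [M M0 hM] := ent_expansion hf (normc_ge0 a).
exists (cauchy_coef f (normc a + 2) 3 a).
apply: (@cderiv_quadratic _ _ _ M 1) => // s s1.
have [->|s0] := eqVneq s 0.
  by rewrite addr0 subrr mulr0 subrr normc0 expr0n mulr0.
have [_ [h _]] := hM a s (lexx _) (ltW s1).
rewrite -(cauchy_coefE hf (normc_ge0 a) (lexx _)) -/l in h.
rewrite /q eqxx ifN; last by rewrite -subr_eq0 (_ : a + s - a = s); [|ring].
rewrite -(ler_pM2r (_ : 0 < normc s)) ?normc_gt0// -normcM.
rewrite [leRHS](_ : _ = M * normc s ^+ 3); last by ring.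
apply: le_trans h; rewrite le_eqVlt; apply/orP; left; apply/eqP; congr normc.
by rewrite (_ : a + s - a = s); [field|ring].
Qed.

(** A weak maximum principle straight from Cauchy's formula: on the circle the kernel [w / (w - z)]
    is at most 2, and [cmean_bound] contributes another factor 2. *)
Lemma max_modulus f r z e : ent f -> 0 < r -> normc z <= r / 2 ->
  (forall w, normc w = r -> normc (f w) <= e) -> normc (f z) <= 4 * e.
Proof.
move=> hf r0 zr h; have zr' : normc z < r by lra.
have far w : normc w = r -> r / 2 <= normc (w - z).
  by move=> wr; apply: le_trans (ler_dist_normc _ _); rewrite wr; lra.
have nz w : normc w = r -> w - z != 0.
  by move=> wr; rewrite -normc_gt0 (lt_le_trans _ (far w wr))// divr_gt0.
have hr : holo (fun z => normc z <= r) f by exact: ent_holo.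
rewrite -(cmean_cauchy zr' hr).
have -> : 4 * e = 2 * (e * 2) by ring.
apply: cmean_bound => [|w wr|w wr]; first exact: ltW.
  apply: ccontM; first exact: ent_cont.
  apply: ccontM; first exact: ccont_id.
  apply: ccontV; first exact: nz.
  by apply: ccontB; [exact: ccont_id|exact: ccont_cst].
rewrite normcM; apply: ler_pM => //; first exact: h.
rewrite normcM normcV ler_pdivrMr ?normc_gt0 ?nz// wr.
by have := far w wr; lra.
Qed.

Lemma liouville f (M : R) : ent f -> (forall z, normc (f z) <= M) -> forall z, f z = f 0.
Proof.
move=> hf hM z; have [q hq fE] := ent_divide 0 hf.
suff q0 : forall w, q w = 0 by rewrite fE q0 mulr0 addr0.
move=> w; apply: (@small_norm_eq0 _ _ (4 : R)) => e e0.
have M0 : 0 <= M := le_trans (normc_ge0 _) (hM 0).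
(* Large enough for |w| <= r / 2 and for 2 M / r <= e, the bound of the quotient on the circle. *)
pose r := 1 + 2 * normc w + 2 * M / e.
have h1 : 0 <= 2 * M / e by rewrite divr_ge0 ?mulr_ge0// ltW.
have h2 := normc_ge0 w.
have r0 : 0 < r by rewrite /r; lra.
rewrite mulrC; apply: (max_modulus hq r0); first by rewrite /r; lra.
move=> v vr; have := fE v; rewrite subr0 => fv.
rewrite -(ler_pM2l r0) -{1}vr -normcM.
have -> : v * q v = f v - f 0 by rewrite fv; ring.
apply: le_trans (ler_normcB _ _) _; apply: le_trans (lerD (hM v) (hM 0)) _.
rewrite -ler_pdivrMr// /r; lra.
Qed.

Lemma entM f g : ent f -> ent g -> ent (fun z => f z * g z).
Proof. exact: holoM. Qed.

Lemma ent_sub a : ent (fun z => z - a).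
Proof. by apply: holoB; [exact: holo_id|exact: holo_cst]. Qed.

Lemma ent_prod (s : seq C) : ent (fun z => \prod_(a <- s) (z - a)).
Proof.
elim: s => [|a s IH].
  by apply: (holo_eq (f := fun=> 1)) => [z|]; [rewrite big_nil|exact: holo_cst].
apply: (holo_eq (f := fun z => (z - a) * \prod_(a <- s) (z - a))) => [z|].
  by rewrite big_cons.
by apply: holoM => //; exact: ent_sub.
Qed.

(* On a circle of radius [r >> rho] the zeros cost a factor [(r - rho) ^ size s], so
   a function with arbitrarily many zeros in a disc vanishes identically. *)
Lemma zeros_decay f q (s : seq C) (rho : R) z : ent q -> 0 <= rho ->
  (forall a, a \in s -> normc a <= rho) ->
  (forall w, f w = \prod_(a <- s) (w - a) * q w) ->
  forall M, (forall w, normc w = 2 * normc z + 3 * rho + 1 -> normc (f w) <= M) ->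
  normc (f z) <= 4 * M / 2 ^+ size s.
Proof.
move=> hq rho0 hs fE M hM; set r := 2 * normc z + 3 * rho + 1 in hM.
have z0 := normc_ge0 z.
have r0 : 0 < r by rewrite /r; lra.
(* The choice of [r] makes |z| + rho <= k / 2, so that each factor [z - a] is at most half of what
   the same factor is on the circle. *)
pose k := r - rho; have k0 : 0 < k by rewrite /k /r; lra.
have M0 : 0 <= M.
  by apply: le_trans (hM r%:C%C _); rewrite ?normc_ge0// normcR gtr0_norm.
have low w : normc w = r -> k ^+ size s <= normc (\prod_(a <- s) (w - a)).
  move=> wr; elim: s hs {fE} => [|a s IH] hs; first by rewrite big_nil normc1.
  rewrite big_cons normcM exprS; apply: ler_pM; rewrite ?exprn_ge0 ?(ltW k0)//.
    apply: le_trans (ler_dist_normc _ _); rewrite wr /k lerD2l lerN2.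
    by apply: hs; rewrite mem_head.
  by apply: IH => b bs; apply: hs; rewrite in_cons bs orbT.
have up : normc (\prod_(a <- s) (z - a)) <= (k / 2) ^+ size s.
  elim: s hs {fE low} => [|a s IH] hs; first by rewrite big_nil normc1.
  rewrite big_cons normcM exprS; apply: ler_pM => //.
    apply: le_trans (ler_normcB _ _) _.
    have : normc a <= rho by apply: hs; rewrite mem_head.
    by rewrite /k /r; lra.
  by apply: IH => b bs; apply: hs; rewrite in_cons bs orbT.
have qz : normc (q z) <= 4 * (M / k ^+ size s).
  apply: (max_modulus hq r0); first by rewrite /r; lra.
  move=> w wr; rewrite ler_pdivlMr ?exprn_gt0//.
  apply: le_trans (hM w wr); rewrite fE normcM mulrC ler_wpM2r//.
  exact: low.
rewrite fE normcM; apply: le_trans (ler_pM _ _ up qz) _ => //.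
rewrite expr_div_n le_eqVlt; apply/orP; left; apply/eqP; field.
by rewrite !expf_neq0// gt_eqF.
Qed.

(** Zeros are divided out one at a time. If this never stopped, [zeros_decay] with arbitrarily long
    lists would force [f z0 = 0] at the given point with [f z0 != 0]. *)
Theorem factor_disc f (rho : R) : ent f -> 0 <= rho -> (exists z, f z != 0) ->
  exists (s : seq C) q, [/\ ent q, forall a, a \in s -> normc a <= rho,
    forall z, f z = \prod_(a <- s) (z - a) * q z &
    forall z, normc z <= rho -> q z != 0].
Proof.
move=> hf rho0 [z0 fz0]; apply: contrapT => H.
have all_n n : exists (s : seq C) q, [/\ size s = n, ent q,
    forall a, a \in s -> normc a <= rho & forall z, f z = \prod_(a <- s) (z - a) * q z].
  elim: n => [|n [s [q [sn hq hs fE]]]].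
    by exists [::], f; split=> // z; rewrite big_nil mul1r.
  have [[a [ar qa]]|nz] := pselect (exists a, normc a <= rho /\ q a = 0).
    have [g hg qE] := ent_divide a hq.
    exists (a :: s), g; split=> //; first by rewrite /= sn.
      by move=> b; rewrite in_cons => /predU1P[->//|/hs].
    by move=> z; rewrite big_cons fE qE qa; ring.
  exfalso; apply: H; exists s, q; split=> // z zr.
  by apply/eqP => qz; apply: nz; exists z.
move/eqP: fz0; apply; apply/eqP.
have [M M0 hM] := bounded_disc (B := 2 * normc z0 + 3 * rho + 1) (fun z _ => ent_cont z hf).
rewrite -normc_eq0 eq_le normc_ge0 andbT leNgt; apply/negP => f0.
have [n hn] := half_pow_small (4 * M) f0.
have [s [q [sn hq hs fE]]] := all_n n.
have := zeros_decay hq rho0 hs fE (z := z0) (M := M).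
rewrite sn leNgt hn => /(_ _)/notF; apply.
by move=> w wr; apply: hM; rewrite wr.
Qed.

End EntireFunctions.

(** * Poisson's formula for log|u| *)

Section Poisson.
Set Implicit Arguments.
Unset Strict Implicit.
Variable R : realType.
Local Notation C := R[i].
Local Notation E := (@circle_point R).
Implicit Types (f g q u : C -> C) (z w s l p a : C) (v : C -> R) (r e : R).

Definition smean v r : R := (2 * pi)^-1 * rint 0 (2 * pi) (fun t => v (E r t)).

Definition rcircle v r := rcts 0 (2 * pi) (fun t => v (E r t)).

Lemma smeanD v v' r : rcircle v r -> rcircle v' r ->
  smean (fun z => v z + v' z) r = smean v r + smean v' r.
Proof. by move=> h h'; rewrite /smean rintD// mulrDr. Qed.

Lemma smeanB v v' r : rcircle v r -> rcircle v' r ->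
  smean (fun z => v z - v' z) r = smean v r - smean v' r.
Proof. by move=> h h'; rewrite /smean rintB// mulrBr. Qed.

Lemma smeanZ k v r : rcircle v r -> smean (fun z => k * v z) r = k * smean v r.
Proof. by move=> h; rewrite /smean rintZ// mulrCA. Qed.

Lemma smean_cst k r : smean (fun=> k) r = k.
Proof.
rewrite /smean rint_cst ?twopi_ge0// subr0 mulrCA mulVf ?mulr1//.
by rewrite gt_eqF// twopi_gt0.
Qed.

Lemma le_smean v v' r : 0 <= r -> rcircle v r -> rcircle v' r ->
  (forall z, normc z = r -> v z <= v' z) -> smean v r <= smean v' r.
Proof.
move=> r0 h h' le; rewrite ler_wpM2l ?invr_ge0 ?twopi_ge0//.
by apply: le_rint => // t _; apply: le; rewrite normc_circle.
Qed.

Lemma eq_smean v v' r : 0 <= r -> (forall z, normc z = r -> v z = v' z) ->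
  smean v r = smean v' r.
Proof.
by move=> r0 h; congr (_ * _); apply: eq_rint => t _; rewrite h// normc_circle.
Qed.

Lemma rcircle_cst (k r : R) : rcircle (fun=> k) r.
Proof. exact: rcts_cst. Qed.

Lemma rcircleD v v' r : rcircle v r -> rcircle v' r -> rcircle (fun z => v z + v' z) r.
Proof. exact: rctsD. Qed.

Lemma rcircleB v v' r : rcircle v r -> rcircle v' r -> rcircle (fun z => v z - v' z) r.
Proof. exact: rctsB. Qed.

Lemma rcircleM v v' r : rcircle v r -> rcircle v' r -> rcircle (fun z => v z * v' z) r.
Proof. exact: rctsM. Qed.

Lemma rcircleZ k v r : rcircle v r -> rcircle (fun z => k * v z) r.
Proof. by move=> h; apply: rcircleM => //; exact: rcircle_cst. Qed.

Lemma rcircle_Re f r : 0 <= r -> cts_circle f r -> rcircle (fun z => Re (f z)) r.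
Proof.
by move=> r0 hf; apply: (@pcts_Re _ _ _ (fun t => f (E r t))); exact: pcts_circle.
Qed.

Lemma rcircle_ln f r : 0 <= r -> cts_circle f r -> (forall z, normc z = r -> f z != 0) ->
  rcircle (fun z => ln (normc (f z))) r.
Proof.
move=> r0 hf f0 t ht; apply: (@continuous_comp _ _ _ (fun t => normc (f (E r t))) (@ln R)).
  by apply: pcont_normc; exact: (pcts_circle r0 hf).
by apply: continuous_ln; rewrite normc_gt0 f0// normc_circle.
Qed.

Lemma ReZ (k : R) z : Re (k%:C%C * z) = k * Re z.
Proof. by case: z => x y /=; ring. Qed.

Lemma Re_cmean f r : 0 <= r -> cts_circle f r -> Re (cmean f r) = smean (fun z => Re (f z)) r.
Proof.
move=> r0 hf; rewrite /cmean /smean mulrC.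
by rewrite -fmorphV ReZ.
Qed.

Lemma mulcJ_normc z : z * (conjc z) = (normc z ^+ 2)%:C%C.
Proof. by apply: complex_ext; rewrite ?ReM ?ImM ?normc_sqr; case: z => x y /=; ring. Qed.

Lemma normc_conj z : normc (conjc z) = normc z.
Proof. by case: z => x y /=; rewrite sqrrN. Qed.

(** Cauchy's kernel for [s] plus a term with its pole at the reflected point r^2 / conj(s). The
    second term is holomorphic in the disc and vanishes at 0; on |z| = r the sum is real and equals
    Poisson's kernel. *)
Definition pkernel r s z : C :=
  z / (z - s) + conjc s * z / ((r ^+ 2)%:C%C - conjc s * z).

Definition poisson r s z : R := Re (pkernel r s z).

Lemma pkernelE r s z : normc s < r -> normc z = r ->
  pkernel r s z = ((r ^+ 2 - normc s ^+ 2) / normc (z - s) ^+ 2)%:C%C.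
Proof.
move=> sr zr; rewrite /pkernel.
have zs : z - s != 0.
  by rewrite subr_eq0; apply: contraTneq sr => <-; rewrite zr ltxx.
have zsJ : conjc z - conjc s != 0 by rewrite -rmorphB conjc_eq0.
have z0 : z != 0.
  by rewrite -normc_gt0 zr (le_lt_trans (normc_ge0 s)).
transitivity (((r ^+ 2)%:C%C - (normc s ^+ 2)%:C%C) / (normc (z - s) ^+ 2)%:C%C); last first.
  by rewrite -rmorphB -fmorphV -rmorphM.
rewrite -!mulcJ_normc -zr -mulcJ_normc rmorphB.
have -> : z * conjc z - conjc s * z = z * (conjc z - conjc s) by ring.
by field; rewrite zs zsJ z0.
Qed.

Lemma poissonE r s z : normc s < r -> normc z = r ->
  poisson r s z = (r ^+ 2 - normc s ^+ 2) / normc (z - s) ^+ 2.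
Proof. by move=> sr zr; rewrite /poisson pkernelE. Qed.

Lemma pkernel_real r s z : normc s < r -> normc z = r ->
  pkernel r s z = (poisson r s z)%:C%C.
Proof. by move=> sr zr; rewrite /poisson pkernelE. Qed.

Lemma pkernel_den r s z : normc s < r -> normc z <= r ->
  (r ^+ 2)%:C%C - conjc s * z != 0.
Proof.
move=> sr zr; rewrite subr_eq0; apply/eqP => h.
have r0 : 0 < r := le_lt_trans (normc_ge0 s) sr.
have : normc (r ^+ 2)%:C%C = r ^+ 2 by rewrite normcR ger0_norm// sqr_ge0.
rewrite h normcM normc_conj => h'.
have : normc s * normc z < r ^+ 2.
  by apply: le_lt_trans (ler_wpM2l (normc_ge0 _) zr) _; rewrite expr2 ltr_pM2r.
by rewrite h' ltxx.
Qed.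

Lemma cts_kernel1 r s : normc s < r -> cts_circle (fun z => z / (z - s)) r.
Proof.
move=> sr z zr; apply: ccontM; first exact: ccont_id.
apply: ccontV.
  by rewrite subr_eq0; apply: contraTneq sr => <-; rewrite zr ltxx.
by apply: ccontB; [exact: ccont_id|exact: ccont_cst].
Qed.

Lemma holo_kernel2 r s : normc s < r -> holo (fun z => normc z <= r)
  (fun z => conjc s * z / ((r ^+ 2)%:C%C - conjc s * z)).
Proof.
move=> sr; have h : holo (fun z => normc z <= r) (fun z => conjc s * z).
  by apply: holoM; [exact: holo_cst|exact: holo_id].
apply: holoM => //; apply: holoV; first by apply: holoB => //; exact: holo_cst.
by move=> z zr; exact: pkernel_den.
Qed.

Lemma cts_pkernel r s : normc s < r -> cts_circle (pkernel r s) r.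
Proof.
move=> sr z zr; apply: ccontD; first exact: (cts_kernel1 sr).
by apply: (holo_cont (holo_kernel2 sr)); rewrite zr.
Qed.

(** The first half of the kernel reproduces [f s] by Cauchy's formula. The second half times [f] is
    holomorphic in the disc and vanishes at 0, so its mean is 0. *)
Lemma poisson_holo f r s : normc s < r -> holo (fun z => normc z <= r) f ->
  f s = cmean (fun z => f z * pkernel r s z) r.
Proof.
move=> sr hf; have r0 : 0 < r := le_lt_trans (normc_ge0 s) sr.
have cf : cts_circle f r by move=> z zr; apply: (holo_cont hf); rewrite zr.
have h2 := holoM hf (holo_kernel2 sr).
have c2 : cts_circle (fun z => f z * (conjc s * z / ((r ^+ 2)%:C%C - conjc s * z))) r.
  by move=> z zr; apply: (holo_cont h2); rewrite zr.
have m2 : cmean (fun z => f z * (conjc s * z / ((r ^+ 2)%:C%C - conjc s * z))) r = 0.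
  have h20 : holo (fun z => 0 < normc z <= r)
      (fun z => f z * (conjc s * z / ((r ^+ 2)%:C%C - conjc s * z))).
    by apply: holo_sub h2 => z /andP[].
  rewrite /cmean (mean_value r0 _ h20) => [|z zr]; last exact: (holo_cont h2).
  by rewrite mulr0 mul0r mulr0 !mul0r.
rewrite -{1}(cmean_cauchy sr hf) -[LHS]addr0 -m2 -cmeanD ?(ltW r0)//.
  by apply: eq_cmean; rewrite ?(ltW r0)// => z _; rewrite /pkernel mulrDr.
by move=> z zr; apply: ccontM; [exact: cf|exact: (cts_kernel1 sr)].
Qed.

Lemma rcircle_poisson r s : normc s < r -> rcircle (poisson r s) r.
Proof.
move=> sr; apply: rcircle_Re; last exact: cts_pkernel.
exact: le_trans (normc_ge0 s) (ltW sr).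
Qed.

Lemma poisson_Re f r s : normc s < r -> holo (fun z => normc z <= r) f ->
  Re (f s) = smean (fun z => poisson r s z * Re (f z)) r.
Proof.
move=> sr hf; have r0 : 0 <= r := le_trans (normc_ge0 s) (ltW sr).
rewrite {1}(poisson_holo sr hf) Re_cmean//.
  apply: eq_smean => // z zr; rewrite (pkernel_real sr zr) ReM /= mulr0 subr0.
  exact: mulrC.
move=> z zr; apply: ccontM; last exact: (cts_pkernel sr).
by apply: (holo_cont hf); rewrite zr.
Qed.

Lemma smean_poisson r s : normc s < r -> smean (poisson r s) r = 1.
Proof.
move=> sr; have r0 : 0 <= r := le_trans (normc_ge0 s) (ltW sr).
transitivity (smean (fun z => poisson r s z * Re (1 : C)) r).
  by apply: eq_smean => // z _; rewrite mulr1.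
by rewrite -(@poisson_Re (fun=> 1) r s sr (@holo_cst _ _ 1)).
Qed.

Lemma poisson_lower r s z : normc s < r -> normc z = r ->
  (r - normc s) / (r + normc s) <= poisson r s z.
Proof.
move=> sr zr; rewrite poissonE//; have s0 := normc_ge0 s.
have h1 : normc (z - s) <= r + normc s by rewrite -zr ler_normcB.
have h2 : r - normc s <= normc (z - s) by rewrite -zr ler_dist_normc.
have p0 : 0 < normc (z - s) by lra.
rewrite ler_pdivlMr ?exprn_gt0// mulrAC ler_pdivrMr; last by lra.
rewrite subr_sqr -mulrA ler_pM2l ?subr_gt0// expr2.
by apply: ler_pM.
Qed.

Lemma poisson_upper r s z : normc s < r -> normc z = r ->
  poisson r s z <= (r + normc s) / (r - normc s).
Proof.
move=> sr zr; rewrite poissonE//; have s0 := normc_ge0 s.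
have h2 : r - normc s <= normc (z - s) by rewrite -zr ler_dist_normc.
have p0 : 0 < normc (z - s) by lra.
rewrite ler_pdivrMr ?exprn_gt0// mulrAC ler_pdivlMr; last by lra.
rewrite subr_sqr mulrAC mulrC [_ * (r + _)]mulrC ler_pM2l; last by lra.
by rewrite expr2; apply: ler_pM => //; lra.
Qed.

Lemma poisson_ge0 r s z : normc s < r -> normc z = r -> 0 <= poisson r s z.
Proof.
move=> sr zr; apply: le_trans (poisson_lower sr zr).
by have s0 := normc_ge0 s; rewrite divr_ge0//; lra.
Qed.

(** The logarithm stays real: |1 + x|^2 = 1 + y with y = 2 Re x + |x|^2, and ln (1 + y) lies between
    y - 2 y^2 and y. The lower bound comes from the upper one for 1 / (1 + y). *)
Lemma ln_expand (x : C) : normc x <= 6^-1 ->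
  `|ln (normc (1 + x)) - Re x| <= 10 * normc x ^+ 2.
Proof.
move=> x6; pose n := normc x; have n0 : 0 <= n by exact: normc_ge0.
pose y := 2 * Re x + n ^+ 2.
have xn : `|Re x| <= n by exact: Re_le_normc.
have xE : normc (1 + x) ^+ 2 = 1 + y.
  by rewrite /y /n normc_sqr normc_sqr ReD ImD /=; ring.
have n2 : n ^+ 2 <= n / 6 by rewrite expr2 ler_wpM2l.
have y3 : `|y| <= 3 * n.
  apply: le_trans (ler_normD _ _) _; rewrite normrM ger0_norm// [`|n ^+ 2|]ger0_norm ?sqr_ge0//.
  lra.
have yh : `|y| <= 2^-1 by apply: le_trans y3 _; rewrite -/n in x6; lra.
have y2 : y ^+ 2 <= 9 * n ^+ 2.
  rewrite -real_normK ?num_real// (_ : 9 * n ^+ 2 = (3 * n) ^+ 2); last by ring.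
  by rewrite ler_sqr ?nnegrE// mulr_ge0.
move: (yh); rewrite ler_norml => /andP[yl yu].
have y1 : 0 < 1 + y by lra.
have nE : ln (normc (1 + x)) = ln (1 + y) / 2.
  rewrite -xE expr2 lnM ?posrE; last 2 first.
  - by rewrite lt0r normc_ge0 andbT; apply: contraTneq y1 => h; rewrite -xE h expr0n ltxx.
  - by rewrite lt0r normc_ge0 andbT; apply: contraTneq y1 => h; rewrite -xE h expr0n ltxx.
  by field.
have U : ln (1 + y) <= y by apply: le_ln1Dx; lra.
have L : y - 2 * y ^+ 2 <= ln (1 + y).
  have := @le_ln1Dx R (- y / (1 + y)); have -> : 1 + - y / (1 + y) = (1 + y)^-1.
    by field; rewrite gt_eqF.
  rewrite lnV ?posrE// => h.
  have : -1 < - y / (1 + y) by rewrite ltr_pdivlMr//; lra.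
  move=> /h; rewrite mulNr lerN2; apply: le_trans.
  rewrite ler_pdivlMr//.
  have -> : (y - 2 * y ^+ 2) * (1 + y) = y - y ^+ 2 * (1 + 2 * y) by ring.
  rewrite gerBl mulr_ge0 ?sqr_ge0//; lra.
have n02 : 0 <= n ^+ 2 by rewrite sqr_ge0.
rewrite nE ler_norml -/n; apply/andP; split; rewrite /y in U L y2; lra.
Qed.

Definition logd u z : C := (u^`())%classic z / u z.

(** Since |u| has a positive lower bound on the disc, the relative increment [u z' / u z - 1] equals
    [logd u z * (z' - z)] up to a quadratic error with one constant for the whole disc; [ln_expand]
    passes to the logarithm. *)
Lemma ln_normc_taylor u r : ent u -> (forall z, normc z <= r -> u z != 0) ->
  exists M, exists2 d, 0 < d & 0 <= M /\ forall z z', normc z <= r -> normc z' <= r ->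
   normc (z' - z) <= d ->
   `|ln (normc (u z')) - ln (normc (u z)) - Re (logd u z * (z' - z))| <= M * normc (z' - z) ^+ 2.
Proof.
move=> hu u0.
have [c c0 hc] := bounded_away_disc (fun z _ => ent_cont z hu) u0.
have [M1 M10 hM1] := ent_taylor1 r hu.
have [L L0 hL] := bounded_disc (B := r) (fun z _ => ent_cont z (ent_derive hu)).
pose A := (L + M1) / c; have A0 : 0 < A by rewrite divr_gt0// addr_gt0.
exists (10 * A ^+ 2 + M1 / c), (Num.min 1 (6^-1 / A)).
  by rewrite lt_min ltr01 divr_gt0// invr_gt0.
have Mc : 0 <= M1 / c by rewrite divr_ge0// ltW.
split; first by rewrite addr_ge0// mulr_ge0// sqr_ge0.
move=> z z' zr z'r; rewrite le_min ler_pdivlMr// => /andP[h1 hA].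
set h := z' - z in h1 hA *; have uz := u0 z zr; have uz' := u0 z' z'r.
have T := hM1 z h zr h1; rewrite /h subrKC -/h in T.
have cu := hc z zr; have nu : 0 < normc (u z) by rewrite normc_gt0.
have [x xdef] : exists x, x = u z' / u z - 1 by exists (u z' / u z - 1).
have xE : x - logd u z * h = (u z' - u z - (u^`())%classic z * h) / u z.
  by rewrite xdef /logd; field.
have x1 : normc (x - logd u z * h) <= M1 / c * normc h ^+ 2.
  rewrite xE normcM normcV ler_pdivrMr//; apply: le_trans T _.
  have -> : M1 / c * normc h ^+ 2 * normc (u z) = M1 * normc h ^+ 2 * (normc (u z) / c).
    by ring.
  by rewrite ler_peMr ?mulr_ge0 ?sqr_ge0 ?(ltW M10)// ler_pdivlMr// mul1r.
have lh : normc (logd u z * h) <= L / c * normc h.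
  rewrite normcM ler_wpM2r// /logd normcM normcV.
  by apply: ler_pM; rewrite ?invr_ge0// ?hL// lef_pV2 ?posrE.
have xA : normc x <= A * normc h.
  rewrite -[x](subrK (logd u z * h)).
  apply: le_trans (le_normcD _ _) _; apply: le_trans (lerD x1 lh) _.
  have -> : A * normc h = M1 / c * normc h + L / c * normc h.
    by rewrite /A mulrDl mulrDl addrC.
  rewrite lerD2r ler_wpM2l//.
  by rewrite expr2 ler_piMr.
have x6 : normc x <= 6^-1 by apply: le_trans xA _; rewrite mulrC.
have nE : ln (normc (u z')) - ln (normc (u z)) = ln (normc (1 + x)).
  have -> : 1 + x = u z' / u z by rewrite xdef subrKC.
  by rewrite normcM normcV lnM ?posrE ?invr_gt0 ?normc_gt0// lnV ?posrE ?normc_gt0.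
rewrite nE.
have -> : ln (normc (1 + x)) - Re (logd u z * h) =
    (ln (normc (1 + x)) - Re x) + Re (x - logd u z * h).
  by rewrite ReB addrA subrK.
apply: le_trans (ler_normD _ _) _; rewrite mulrDl; apply: lerD.
  apply: le_trans (ln_expand x6) _; rewrite -mulrA ler_pM2l// -exprMn.
  by rewrite ler_sqr// nnegrE// mulr_ge0// ltW.
by apply: le_trans x1; exact: Re_le_normc.
Qed.

(** Over [N] equal steps the linear parts add up to [X] and the quadratic ones to only [K / N]. It
    is used with [X = 0] to show constancy and with [X > 0] as a mean value inequality. *)
Lemma increment_bound (F : R -> C) (X K d : R) : 0 < d -> 0 <= X -> 0 <= K ->
  (forall t t', 0 <= t <= 1 -> 0 <= t' <= 1 -> `|t' - t| <= d ->
    normc (F t' - F t) <= X * `|t' - t| + K * (t' - t) ^+ 2) -> normc (F 1 - F 0) <= X.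
Proof.
move=> d0 X0 K0 h; rewrite leNgt; apply/negP => D0.
set D := normc (F 1 - F 0) in D0.
have {}D0 : 0 < D - X by rewrite subr_gt0.
pose N := maxn (Num.bound d^-1) (Num.bound (K / (D - X))).
have N1 : d^-1 < N%:R.
  have := archi_boundP (ltW (_ : 0 < d^-1)); rewrite invr_gt0 => /(_ d0) /lt_le_trans; apply.
  by rewrite ler_nat leq_maxl.
have N2 : K / (D - X) < N%:R.
  have := archi_boundP (divr_ge0 K0 (ltW D0)) => /lt_le_trans; apply.
  by rewrite ler_nat leq_maxr.
have N0 : 0 < N%:R :> R by apply: lt_trans N1; rewrite invr_gt0.
pose e := X / N%:R + K / N%:R ^+ 2.
have step k : (k < N)%N -> normc (F (k.+1%:R / N%:R) - F (k%:R / N%:R)) <= e.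
  move=> kN.
  have st : k.+1%:R / N%:R - k%:R / N%:R = N%:R^-1 :> R.
    by rewrite -natr1; field; rewrite gt_eqF.
  have in01 j : (j <= N)%N -> 0 <= (j%:R / N%:R : R) <= 1.
    by move=> jN; rewrite divr_ge0//= ler_pdivrMr// mul1r ler_nat.
  have := h (k%:R / N%:R) (k.+1%:R / N%:R); rewrite st !in01 ?(ltnW kN)//.
  rewrite gtr0_norm ?invr_gt0// exprVn => /(_ isT isT); apply.
  by rewrite -[d]invrK lef_pV2 ?posrE ?invr_gt0// ltW.
have tel k : (k <= N)%N -> normc (F (k%:R / N%:R) - F 0) <= k%:R * e.
  elim: k => [|k IH] kN; first by rewrite mul0r subrr normc0 mul0r.
  have -> : F (k.+1%:R / N%:R) - F 0 =
    (F (k.+1%:R / N%:R) - F (k%:R / N%:R)) + (F (k%:R / N%:R) - F 0) by ring.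
  apply: le_trans (le_normcD _ _) _.
  have -> : k.+1%:R * e = e + k%:R * e by rewrite -natr1 mulrDl mul1r addrC.
  by apply: lerD; [exact: step|exact/IH/ltnW].
have := tel N (leqnn N); rewrite divff ?gt_eqF// -/D => hD.
have : (D - X) * N%:R <= K.
  have eE : N%:R * e = X + K / N%:R by rewrite /e; field; rewrite gt_eqF.
  have := ler_wpM2r (ltW N0) hD; rewrite eE mulrDl divfK ?gt_eqF//; lra.
by rewrite leNgt -ltr_pdivrMl// mulrC N2.
Qed.

Lemma quadratic_const (F : R -> R) (K d : R) : 0 < d -> 0 <= K ->
  (forall t t', 0 <= t <= 1 -> 0 <= t' <= 1 -> `|t' - t| <= d ->
    `|F t' - F t| <= K * (t' - t) ^+ 2) -> F 1 = F 0.
Proof.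
move=> d0 K0 h; apply/eqP; rewrite -subr_eq0 -normr_eq0 eq_le normr_ge0 andbT.
rewrite -normcR rmorphB; apply: (@increment_bound (fun t => (F t)%:C%C) 0 K d) => //.
by move=> t t' t1 t2 td; rewrite mul0r add0r -rmorphB normcR; exact: h.
Qed.

(* The defect in the formula for [z |-> ln |u (t z)|] is constant in [t], because its
   derivative is the defect for the holomorphic [z |-> z * logd u (t z)], which is 0;
   at [t = 0] it vanishes. *)
Theorem poisson_log u r s : ent u -> (forall z, normc z <= r -> u z != 0) ->
  normc s < r ->
  ln (normc (u s)) = smean (fun z => poisson r s z * ln (normc (u z))) r.
Proof.
move=> hu u0 sr; have s0 := normc_ge0 s; have r0 : 0 < r by lra.
have [M [d d0 [M0 hM]]] := ln_normc_taylor hu u0.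
pose tc (t : R) : C := t%:C%C.
have tcn t z : 0 <= t <= 1 -> normc z <= r -> normc (tc t * z) <= r.
  move=> /andP[t0 t1] zr; rewrite normcM normcR ger0_norm//.
  by apply: le_trans zr; rewrite ler_piMl.
have cu t : 0 <= t <= 1 -> rcircle (fun z => ln (normc (u (tc t * z)))) r.
  move=> t01; apply: (@rcircle_ln (fun z => u (tc t * z))); rewrite ?(ltW r0)// => z zr.
    apply: ccont_comp; last exact: ent_cont.
    by apply: ccontM; [exact: ccont_cst|exact: ccont_id].
  by apply: u0; apply: tcn; rewrite ?zr.
have cP := rcircle_poisson sr.
pose F t := smean (fun z => poisson r s z * ln (normc (u (tc t * z)))) r - ln (normc (u (tc t * s))).
have hFl t : 0 <= t <= 1 -> holo (fun z => normc z <= r) (fun z => logd u (tc t * z) * z).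
  move=> t01; apply: holoM; last exact: holo_id.
  apply: (@holo_comp _ _ (fun z => normc z <= r) (logd u)).
  - by apply: holoM; [exact: holo_cst|exact: holo_id].
  - by move=> z zr; exact: tcn.
  - apply: holoM; first exact/ent_holo/ent_derive.
    by apply: holoV; [exact: ent_holo|exact: u0].
suff : F 1 = F 0.
  rewrite /F /tc rmorph1 rmorph0 !mul0r.
  rewrite (@eq_smean (fun z => poisson r s z * ln (normc (u (0 * z))))
    (fun z => ln (normc (u 0)) * poisson r s z)) ?(ltW r0)//; last first.
    by move=> z _; rewrite mul0r mulrC.
  rewrite smeanZ// smean_poisson// mulr1 subrr mul1r => /eqP.
  rewrite subr_eq0 => /eqP <-; apply: eq_smean; rewrite ?(ltW r0)// => z _.
  by rewrite mul1r.
pose d' := d / r.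
apply: (@quadratic_const F ((M * r ^+ 2) * 2) d'); [by rewrite divr_gt0| |].
  by apply: mulr_ge0 => //; apply: mulr_ge0 => //; exact: sqr_ge0.
move=> t t' t01 t'01 tt'.
have near z : normc z <= r -> `|ln (normc (u (tc t' * z))) - ln (normc (u (tc t * z)))
    - (t' - t) * Re (logd u (tc t * z) * z)| <= M * r ^+ 2 * (t' - t) ^+ 2.
  move=> zr; have dE : tc t' * z - tc t * z = (t' - t)%:C%C * z by rewrite rmorphB /tc; ring.
  have nE : normc ((t' - t)%:C%C * z) <= `|t' - t| * r.
    by rewrite normcM normcR ler_wpM2l.
  have := hM (tc t * z) (tc t' * z) (tcn _ _ t01 zr) (tcn _ _ t'01 zr); rewrite dE.
  have -> : Re (logd u (tc t * z) * ((t' - t)%:C%C * z)) = (t' - t) * Re (logd u (tc t * z) * z).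
    by rewrite !ReM !ImM /=; ring.
  move=> /(_ _)/le_trans; apply.
    by apply: le_trans nE _; rewrite -ler_pdivlMr.
  rewrite -mulrA ler_wpM2l// -exprMn -[r * _]mulrC.
  rewrite -(real_normK (num_real ((t' - t) * r))) normrM (gtr0_norm r0).
  by rewrite ler_sqr ?nnegrE// mulr_ge0// ltW.
have cRe : rcircle (fun z => Re (logd u (tc t * z) * z)) r.
  apply: rcircle_Re; rewrite ?(ltW r0)// => z zr; apply: (holo_cont (hFl t t01)).
  by rewrite zr.
pose G z := ln (normc (u (tc t' * z))) - ln (normc (u (tc t * z)))
    - (t' - t) * Re (logd u (tc t * z) * z).
have cG : rcircle G r.
  by apply: rcircleB; [apply: rcircleB; exact: cu|exact: rcircleZ].
(* The linear terms cancel because Poisson's formula is exact for the real part of the holomorphic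
   [logd u (tc t * z) * z]; the quadratic remainder [G] is left, once in the mean and once at [s],
   hence the factor 2. *)
have -> : F t' - F t = smean (fun z => poisson r s z * G z) r - G s.
  rewrite /F /G (poisson_Re sr (hFl t t01)).
  rewrite (@eq_smean (fun z => poisson r s z * (_ - _ - _)) (fun z =>
    poisson r s z * ln (normc (u (tc t' * z))) - poisson r s z * ln (normc (u (tc t * z)))
    - (t' - t) * (poisson r s z * Re (logd u (tc t * z) * z)))) ?(ltW r0)//; last first.
    by move=> z _; ring.
  rewrite smeanB; last 2 first.
  - by apply: rcircleB; apply: rcircleM => //; exact: cu.
  - by apply: rcircleZ; apply: rcircleM.
  rewrite smeanB; last 2 first.
  - by apply: rcircleM => //; exact: cu.
  - by apply: rcircleM => //; exact: cu.
  rewrite smeanZ; last by apply: rcircleM.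
  ring.
apply: le_trans (ler_normB _ _) _; rewrite mulrAC mulr_natr mulr2n; apply: lerD; last first.
  exact/near/ltW.
set K := M * r ^+ 2 * (t' - t) ^+ 2 in near *.
have KP k : smean (fun z => k * poisson r s z) r = k.
  by rewrite smeanZ// smean_poisson// mulr1.
rewrite ler_norml -{1}[- K]KP -{2}[K]KP; apply/andP; split; apply: le_smean; rewrite ?(ltW r0)//.
- exact: rcircleZ.
- exact: rcircleM.
- move=> z zr; rewrite mulrC ler_wpM2l ?poisson_ge0//.
  by have := near z; rewrite zr lexx => /(_ isT); rewrite ler_norml => /andP[].
- exact: rcircleM.
- exact: rcircleZ.
- move=> z zr; rewrite mulrC ler_wpM2r ?poisson_ge0//.
  by have := near z; rewrite zr lexx => /(_ isT); rewrite ler_norml => /andP[].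
Qed.

End Poisson.

(** * Logarithmic means *)

Section LogMeans.
Set Implicit Arguments.
Unset Strict Implicit.
Variable R : realType.
Local Notation C := R[i].
Local Notation E := (@circle_point R).
Implicit Types (f g h q u : C -> C) (z w p a : C) (s : seq C) (v : C -> R) (r e : R).

Definition lnmean f r : R := smean (fun z => ln (normc (f z))) r.

Definition zero_free f (r : R) := forall z, normc z = r -> f z != 0.

Lemma rcircle_lnmean f r : 0 <= r -> ent f -> zero_free f r ->
  rcircle (fun z => ln (normc (f z))) r.
Proof. by move=> r0 hf f0; apply: rcircle_ln => // z _; exact: ent_cont. Qed.

Lemma poisson0 r z : 0 < r -> normc z = r -> poisson r 0 z = 1.
Proof.
move=> r0 zr; rewrite poissonE ?normc0// subr0 zr expr0n subr0 divff//.
by rewrite expf_neq0// gt_eqF.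
Qed.

Lemma lnmean_zero_free_disc u r : 0 < r -> ent u ->
  (forall z, normc z <= r -> u z != 0) -> lnmean u r = ln (normc (u 0)).
Proof.
move=> r0 hu u0; rewrite (@poisson_log _ u r 0 hu u0) ?normc0//.
by apply: eq_smean; rewrite ?(ltW r0)// => z zr; rewrite poisson0// mul1r.
Qed.

Lemma normc_reflect r a z : normc z = r ->
  normc ((r ^+ 2)%:C%C - conjc a * z) = r * normc (z - a).
Proof.
move=> zr; have -> : (r ^+ 2)%:C%C - conjc a * z = z * conjc (z - a).
  by rewrite rmorphB -zr -mulcJ_normc; ring.
by rewrite normcM normc_conj zr.
Qed.

Lemma ent_reflect r a : ent (fun z => (r ^+ 2)%:C%C - conjc a * z).
Proof. by apply: holoB; [exact: holo_cst|apply: holoM; [exact: holo_cst|exact: holo_id]]. Qed.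

Lemma lnM_normc z w : z != 0 -> w != 0 ->
  ln (normc (z * w)) = ln (normc z) + ln (normc w).
Proof. by move=> z0 w0; rewrite normcM lnM// posrE normc_gt0. Qed.

Lemma zero_free_sub a r : normc a != r -> zero_free (fun z => z - a) r.
Proof. by move=> ar z zr; rewrite subr_eq0; apply: contraNneq ar => <-; rewrite zr. Qed.

(** For |a| < r the factor is replaced on the circle by [r^2 - conjc a * z] divided by [r]: the
    modulus is the same, but the zero has moved outside the disc. *)
Lemma lnmean_sub a r : 0 < r -> normc a != r ->
  lnmean (fun z => z - a) r = ln (Num.max r (normc a)).
Proof.
move=> r0 ar; case: (ltgtP (normc a) r) ar => // [ar|ra] _.
- rewrite /lnmean.
  have z0 z : normc z = r -> z - a != 0 by apply: zero_free_sub; rewrite lt_eqF.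
  rewrite (@eq_smean _ _ (fun z => ln (normc ((r ^+ 2)%:C%C - conjc a * z)) - ln r)) ?(ltW r0)//.
    have d0 z : normc z <= r -> (r ^+ 2)%:C%C - conjc a * z != 0.
      by move=> zr; apply: pkernel_den.
    rewrite smeanB; last 2 first.
    - apply: rcircle_lnmean; rewrite ?(ltW r0)//; first exact: ent_reflect.
      by move=> z zr; apply: d0; rewrite zr.
    - exact: rcircle_cst.
    rewrite smean_cst [X in X - _](lnmean_zero_free_disc r0 (ent_reflect r a) d0).
    rewrite mulr0 subr0 normcR ger0_norm ?sqr_ge0// expr2 lnM ?posrE//.
    by rewrite addrK.
  move=> z zr; rewrite normc_reflect// lnM ?posrE ?normc_gt0 ?z0//.
  by rewrite addrAC subrr add0r.
- rewrite (lnmean_zero_free_disc r0 (ent_sub a)); first by rewrite sub0r normcN.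
  by move=> z zr; rewrite subr_eq0; apply: contraTneq zr => ->; rewrite -ltNge.
Qed.

(** Jensen's formula for a factorisation made on the larger disc of radius [B]: zeros beyond |z| = r
    are allowed and contribute ln |a|. Thus one factorisation serves several circles. *)
Lemma lnmean_factor s q r B : 0 < r -> r <= B -> ent q ->
  (forall z, normc z <= B -> q z != 0) -> (forall a, a \in s -> normc a != r) ->
  lnmean (fun z => \prod_(a <- s) (z - a) * q z) r =
    \sum_(a <- s) ln (Num.max r (normc a)) + ln (normc (q 0)).
Proof.
move=> r0 rB hq q0.
have qr z : normc z <= r -> q z != 0 by move=> zr; apply: q0; exact: le_trans rB.
elim: s => [|a s IH] hs.
  rewrite big_nil add0r -(lnmean_zero_free_disc r0 hq qr).
  by apply: eq_smean; rewrite ?(ltW r0)// => z _; rewrite big_nil mul1r.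
have ha : normc a != r by apply: hs; rewrite mem_head.
have {}hs b : b \in s -> normc b != r by move=> bs; apply: hs; rewrite in_cons bs orbT.
have p0 z : normc z = r -> \prod_(a <- s) (z - a) * q z != 0.
  move=> zr; rewrite mulf_neq0// ?qr ?zr// prodf_seq_neq0; apply/allP => b bs /=.
  exact: (zero_free_sub (hs b bs)).
rewrite big_cons -addrA -IH// -lnmean_sub// /lnmean -smeanD; last 2 first.
- apply: (rcircle_lnmean (ltW r0) (ent_sub a)); exact: zero_free_sub.
- apply: (rcircle_lnmean (ltW r0) _ p0); apply: entM => //; exact: ent_prod.
apply: eq_smean; rewrite ?(ltW r0)// => z zr.
by rewrite big_cons -mulrA lnM_normc ?p0//; exact: (zero_free_sub ha).
Qed.

(** [u] is [h] divided by its Blaschke product: each factor [z - a] becomes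
    [(r^2 - conjc a * z) / r], of equal modulus on the circle and larger inside, because (r^2 -
    |a|^2) (r^2 - |z|^2) >= 0. *)
Lemma blaschke_majorant h r : 0 < r -> ent h -> zero_free h r -> exists u,
  [/\ ent u, forall z, normc z <= r -> u z != 0,
    forall z, normc z = r -> normc (u z) = normc (h z) &
    forall z, normc z <= r -> normc (h z) <= normc (u z)].
Proof.
move=> r0 hh h0.
have [|s [q [hq hs hE q0]]] := factor_disc hh (ltW r0).
  by exists r%:C%C; apply: h0; rewrite normcR gtr0_norm.
have {}hs a : a \in s -> normc a < r.
  move=> sa; rewrite lt_neqAle hs// andbT; apply/eqP => ar.
  have := h0 a ar; rewrite hE (big_rem a)//= subrr !mul0r eqxx//.
suff [u [u1 u2 u3 u4]] : exists u, [/\ ent u, forall z, normc z <= r -> u z != 0,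
    forall z, normc z = r -> normc (u z) = normc (\prod_(a <- s) (z - a) * q z) &
    forall z, normc z <= r -> normc (\prod_(a <- s) (z - a) * q z) <= normc (u z)].
  by exists u; split=> // z zr; rewrite hE; [exact: u3|exact: u4].
elim: s hs {hE} => [|a s IH] hs.
  by exists q; split=> // z zr; rewrite big_nil mul1r.
have ar : normc a < r by apply: hs; rewrite mem_head.
have [|u [u1 u2 u3 u4]] := IH; first by move=> b bs; apply: hs; rewrite in_cons bs orbT.
have rC : normc (r^-1)%:C%C = r^-1 by rewrite normcR gtr0_norm// invr_gt0.
exists (fun z => ((r^-1)%:C%C * ((r ^+ 2)%:C%C - conjc a * z)) * u z); split.
- apply: entM => //; apply: entM; [exact: holo_cst|exact: ent_reflect].
- move=> z zr; rewrite !mulf_neq0 ?u2 ?pkernel_den//.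
  by rewrite -normc_gt0 rC invr_gt0.
- move=> z zr; rewrite big_cons -[in RHS]mulrA normcM [in RHS]normcM u3//; congr (_ * _).
  by rewrite normcM rC normc_reflect// mulKf// gt_eqF.
- move=> z zr; rewrite big_cons -mulrA normcM [leRHS]normcM.
  apply: ler_pM => //; last exact: u4.
  rewrite normcM rC ler_pdivlMl// -ler_sqr ?nnegrE ?mulr_ge0 ?(ltW r0)//.
  rewrite exprMn !normc_sqr !ReB !ImB !ReM !ImM /=.
  have za : (r ^+ 2 - normc a ^+ 2) * (r ^+ 2 - normc z ^+ 2) >= 0.
    by rewrite mulr_ge0// subr_ge0 ler_sqr ?nnegrE ?(ltW r0) ?(ltW ar).
  rewrite !normc_sqr in za; case: a z {hs ar zr} za => [a1 a2] [z1 z2] /= za.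
  rewrite -subr_ge0; apply: le_trans za _; rewrite le_eqVlt; apply/orP; left; apply/eqP.
  ring.
Qed.

Lemma logp_ge0 (x : R) : 0 <= logp x.
Proof. by rewrite le_max lexx. Qed.

Lemma ln_le_logp (x : R) : ln x <= logp x.
Proof. by rewrite le_max lexx orbT. Qed.

(** For x >= 0, [logp x] is [ln (Num.max 1 x)], which stays continuous where the path meets 0. *)
Lemma continuous_logp_normc (phi : R -> C) t : pcont phi t ->
  {for t, continuous (fun x => logp (normc (phi x)))}.
Proof.
move=> hp; have logpE (x : R) : 0 <= x -> logp x = ln (Num.max 1 x).
  move=> x0; rewrite /logp; have [x1|x1] := leP x 1.
    by rewrite ln1 max_l// ln_le0.
  by rewrite max_r// ln_ge0// ltW.
have -> : (fun x => logp (normc (phi x))) = (fun x => ln (Num.max 1 (normc (phi x)))).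
  by apply/funext => x; exact: logpE.
apply: (@continuous_comp _ _ _ (fun x => Num.max 1 (normc (phi x))) (@ln R)).
  apply: (@continuous_max _ _ (fun=> 1) (fun x => normc (phi x))).
    exact: continuous_cst_real.
  exact: pcont_normc.
by apply: continuous_ln; rewrite lt_max ltr01.
Qed.

Lemma rcircle_logp f r : 0 <= r -> cts_circle f r ->
  rcircle (fun z => logp (normc (f z))) r.
Proof.
by move=> r0 hf t ht; apply: continuous_logp_normc; exact: (pcts_circle r0 hf).
Qed.

Lemma m_proximityE f r : m_proximity f r = smean (fun z => logp (normc (f z))) r.
Proof. by []. Qed.

(** Poisson's formula for the zero-free majorant of [h]; the constant 3 bounds the kernel, (r + r/2)
    / (r - r/2). *)
Lemma ln_normc_le_m_proximity h r p : 0 < r -> ent h -> zero_free h r ->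
  normc p <= r / 2 -> h p != 0 -> ln (normc (h p)) <= 3 * m_proximity h r.
Proof.
move=> r0 hh h0 pr hp; have [u [u1 u2 u3 u4]] := blaschke_majorant r0 hh h0.
have pr' : normc p < r by lra.
apply: (@le_trans _ _ (ln (normc (u p)))).
  by rewrite ler_ln ?posrE ?normc_gt0 ?u2 ?u4// ltW.
rewrite (poisson_log u1 u2 pr') m_proximityE -smeanZ; last first.
  by apply: rcircle_logp; [exact: ltW|move=> z _; exact: ent_cont].
have cu : zero_free u r by move=> z zr; apply: u2; rewrite zr.
apply: le_smean; first exact: ltW.
- by apply: rcircleM; [exact: rcircle_poisson|apply: rcircle_lnmean => //; exact: ltW].
- by apply: rcircleZ; apply: rcircle_logp; [exact: ltW|move=> z _; exact: ent_cont].
move=> z zr; rewrite u3//.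
have P0 := poisson_ge0 pr' zr.
apply: le_trans (ler_wpM2l P0 (ln_le_logp _)) _.
apply: ler_wpM2r; first exact: logp_ge0.
apply: le_trans (poisson_upper pr' zr) _; rewrite ler_pdivrMr; lra.
Qed.

(** Taking the difference over two circles removes [q 0], so that nothing about the size of [g] at
    the origin enters. *)
Theorem jensen_annulus g s q (rho r : R) : 0 < rho -> rho <= r -> ent q ->
  (forall z, normc z <= r -> q z != 0) ->
  (forall z, g z = \prod_(a <- s) (z - a) * q z) ->
  zero_free g rho -> zero_free g r ->
  lnmean g r - lnmean g rho =
    \sum_(a <- s) (ln (Num.max r (normc a)) - ln (Num.max rho (normc a))).
Proof.
move=> rho0 rr hq q0 gE g1 g2.
have r0 : 0 < r := lt_le_trans rho0 rr.
have ns t : zero_free g t -> forall a, a \in s -> normc a != t.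
  move=> gt a sa; apply/eqP => at_; have := gt a at_.
  by rewrite gE (big_rem a)//= subrr !mul0r eqxx.
have L t : 0 < t -> t <= r -> zero_free g t ->
    lnmean g t = \sum_(a <- s) ln (Num.max t (normc a)) + ln (normc (q 0)).
  move=> t0 tr gt; rewrite -(lnmean_factor t0 tr hq q0 (ns t gt)).
  by apply: eq_smean; rewrite ?(ltW t0)// => z _; rewrite gE.
by rewrite !L// opprD addrACA subrr addr0 sumrB.
Qed.

(** * Unit shifts of linear factors *)

Section Shift.
Variables (r tau : R).
Hypotheses (r0 : 0 < r) (tau0 : 0 < tau) (rtau : 1 <= tau ^+ 3 * r ^+ 2).

(* Moving the zero of a linear factor away from the circle [|z| = r] increases
   [|z - a|^2] by at least [tau^2 r^2], which absorbs a unit shift of [z], while the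
   mean of the logarithm grows only by [ln (1 + tau)]. *)
Let shifted a z := if normc a < r then (1 + tau)%:C%C * z - a else z - (1 + tau)%:C%C * a.

Let shifted_sqr a z : normc z = r -> normc (z - a) ^+ 2 + tau ^+ 2 * r ^+ 2 <= normc (shifted a z) ^+ 2.
Proof.
move=> zr.
have dotz : 0 <= (normc z + normc a) * (normc z - normc a) ->
    0 <= normc z ^+ 2 - (Re z * Re a + Im z * Im a).
  move=> h; have : 0 <= (Re z - Re a) ^+ 2 + (Im z - Im a) ^+ 2 by rewrite addr_ge0 ?sqr_ge0.
  move: h; rewrite mulrC -subr_sqr !normc_sqr !expr2; lra.
have dota : 0 <= (normc a + normc z) * (normc a - normc z) ->
    0 <= normc a ^+ 2 - (Re z * Re a + Im z * Im a).
  move=> h; have : 0 <= (Re z - Re a) ^+ 2 + (Im z - Im a) ^+ 2 by rewrite addr_ge0 ?sqr_ge0.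
  move: h; rewrite mulrC -subr_sqr !normc_sqr !expr2; lra.
rewrite /shifted -zr; case: ltP => az.
- have /dotz : 0 <= (normc z + normc a) * (normc z - normc a).
    by apply: mulr_ge0; [exact: addr_ge0|rewrite subr_ge0 ltW].
  move=> h; rewrite -subr_ge0; rewrite !normc_sqr !ReB !ImB !ReM !ImM /= in h *.
  rewrite [X in 0 <= X](_ : _ = 2 * tau * (Re z ^+ 2 + Im z ^+ 2 - (Re z * Re a + Im z * Im a))).
    by rewrite mulr_ge0 ?mulr_ge0 ?(ltW tau0)//; lra.
  ring.
- have /dota : 0 <= (normc a + normc z) * (normc a - normc z).
    by apply: mulr_ge0; [exact: addr_ge0|rewrite subr_ge0].
  have za2 : normc z ^+ 2 <= normc a ^+ 2 by rewrite ler_sqr ?nnegrE.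
  move=> h; rewrite -subr_ge0; rewrite !normc_sqr !ReB !ImB !ReM !ImM /= in h za2 *.
  rewrite [X in 0 <= X](_ : _ = 2 * tau * (Re a ^+ 2 + Im a ^+ 2 - (Re z * Re a + Im z * Im a))
     + tau ^+ 2 * ((Re a ^+ 2 + Im a ^+ 2) - (Re z ^+ 2 + Im z ^+ 2))).
    by rewrite addr_ge0// !mulr_ge0 ?sqr_ge0 ?(ltW tau0)//; lra.
  ring.
Qed.

Let ent_shifted a : ent (shifted a).
Proof.
rewrite /shifted; case: ltP => _; apply: holoB; try exact: holo_cst; try exact: holo_id.
by apply: holoM; [exact: holo_cst|exact: holo_id].
Qed.

Let shifted_neq0 a z : normc z = r -> shifted a z != 0.
Proof.
move=> zr; rewrite -normc_gt0 lt0r normc_ge0 andbT; apply/eqP => h.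
have := shifted_sqr a zr; rewrite h expr0n leNgt ltr_wpDl ?sqr_ge0//.
by rewrite mulr_gt0 ?exprn_gt0.
Qed.

(** [shifted] scales [z] or [a] according to the side of the circle on which [a] lies, so the zero
    stays on its side: at [a / (1 + tau)] inside, at [(1 + tau) * a] outside. Either way the mean
    gains exactly [ln (1 + tau)]. *)
Let lnmean_shifted a : normc a != r ->
  lnmean (shifted a) r = ln (1 + tau) + ln (Num.max r (normc a)).
Proof.
move=> ar; have t1 : 0 < 1 + tau by rewrite addr_gt0.
have tC : normc (1 + tau)%:C%C = 1 + tau by rewrite normcR gtr0_norm.
have tC0 : (1 + tau)%:C%C != 0 :> C by rewrite -normc_gt0 tC.
rewrite /shifted; case: (ltgtP (normc a) r) ar => // [alr|ra] _.
  have a'r : normc (((1 + tau)%:C%C)^-1 * a) < r.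
    rewrite normcM normcV tC mulrC ltr_pdivrMr// (lt_le_trans alr)//.
    by rewrite ler_peMr ?(ltW r0)// lerDl ltW.
  rewrite /lnmean (@eq_smean _ _ (fun z => ln (1 + tau) +
     ln (normc (z - ((1 + tau)%:C%C)^-1 * a)))) ?(ltW r0)//.
    rewrite smeanD ?smean_cst; [|exact: rcircle_cst|].
      rewrite [X in _ + X](lnmean_sub r0); last by rewrite lt_eqF.
      by rewrite max_l// ltW.
    apply: (rcircle_lnmean (ltW r0)); first exact: ent_sub.
    by apply: zero_free_sub; rewrite lt_eqF.
  move=> z zr; have -> : (1 + tau)%:C%C * z - a = (1 + tau)%:C%C * (z - ((1 + tau)%:C%C)^-1 * a).
    by rewrite mulrBr mulVKf.
  rewrite lnM_normc ?tC//.
  by apply: (zero_free_sub _ zr); rewrite lt_eqF.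
have ra' : r < normc ((1 + tau)%:C%C * a).
  by rewrite normcM tC (lt_le_trans ra)// ler_peMl// lerDl ltW.
rewrite (lnmean_sub r0) ?gt_eqF// max_r ?(ltW ra')// normcM tC lnM// posrE.
exact: lt_trans ra.
Qed.

(** With n = |z - a|, the inequality (n + 1)^2 <= (1 + tau) (n^2 + 1 / tau) is a square being
    nonnegative, and [1 / tau <= tau^2 * r^2] is the hypothesis [rtau]; the gain of [shifted_sqr]
    then absorbs the unit shift. *)
Let shifted_dominates a z w : normc z = r -> normc w <= 1 ->
  normc (z + w - a) <= expR (tau / 2) * normc (shifted a z).
Proof.
move=> zr w1; rewrite -ler_sqr ?nnegrE ?mulr_ge0 ?expR_ge0//.
rewrite exprMn -expRM_natl (_ : 2 * (tau / 2) = tau); last by field.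
have t0 : 0 <= 1 + tau by rewrite addr_ge0 ?(ltW tau0).
apply: (@le_trans _ _ ((1 + tau) * normc (shifted a z) ^+ 2)); last first.
  by rewrite ler_wpM2r ?sqr_ge0// expR_ge1Dx.
apply: le_trans (ler_wpM2l t0 (shifted_sqr a zr)).
set n := normc (z - a).
have nw : normc (z + w - a) <= n + 1.
  by rewrite addrAC (le_trans (le_normcD _ _))// lerD2l.
have n0 : 0 <= n by exact: normc_ge0.
apply: (@le_trans _ _ ((n + 1) ^+ 2)).
  by rewrite ler_sqr ?nnegrE ?addr_ge0.
have k : 1 / tau <= tau ^+ 2 * r ^+ 2.
  by rewrite ler_pdivrMr// mulrAC -exprSr.
apply: (@le_trans _ _ ((1 + tau) * (n ^+ 2 + 1 / tau))); last first.
  by rewrite ler_wpM2l// lerD2l.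
rewrite -subr_ge0.
have -> : (1 + tau) * (n ^+ 2 + 1 / tau) - (n + 1) ^+ 2 = (tau * n - 1) ^+ 2 / tau.
  by field; rewrite gt_eqF.
by rewrite divr_ge0 ?sqr_ge0 ?ltW.
Qed.

(** Each factor adds [tau / 2 + ln |shifted a z| - ln |z - a|] to [L], whose mean is
    [tau / 2 + ln (1 + tau)], at most [3 / 2 * tau]. Since [L] depends on [z] alone, the bound is
    uniform in [w]. *)
Lemma shift_linear_factors s : (forall a, a \in s -> normc a != r) ->
  exists L : C -> R, [/\ rcircle L r, smean L r <= (size s)%:R * (3 / 2 * tau) &
    forall z w, normc z = r -> normc w <= 1 ->
      normc (\prod_(a <- s) (z + w - a)) <= normc (\prod_(a <- s) (z - a)) * expR (L z)].
Proof.
elim: s => [|a s IH] hs.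
  exists (fun=> 0); split; first exact: rcircle_cst.
    by rewrite smean_cst mul0r.
  by move=> z w _ _; rewrite !big_nil expR0 mulr1.
have ar : normc a != r by apply: hs; rewrite mem_head.
have [|L [cL mL hL]] := IH; first by move=> b bs; apply: hs; rewrite in_cons bs orbT.
have c1 : rcircle (fun z => ln (normc (shifted a z))) r.
  by apply: (rcircle_lnmean (ltW r0) (ent_shifted a)) => z; exact: shifted_neq0.
have c2 : rcircle (fun z => ln (normc (z - a))) r.
  by apply: (rcircle_lnmean (ltW r0) (ent_sub a)); exact: zero_free_sub.
have c3 : rcircle (fun z => tau / 2 + ln (normc (shifted a z))) r.
  by apply: rcircleD => //; exact: rcircle_cst.
exists (fun z => (tau / 2 + ln (normc (shifted a z)) - ln (normc (z - a))) + L z); split.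
- by apply: rcircleD => //; exact: rcircleB.
- rewrite smeanD//; last exact: rcircleB.
  rewrite smeanB// smeanD//; last exact: rcircle_cst.
  rewrite smean_cst -/(lnmean (shifted a) r) -/(lnmean (fun z => z - a) r).
  rewrite lnmean_shifted// lnmean_sub// addrA addrK.
  have -> : (size (a :: s))%:R * (3 / 2 * tau) = 3 / 2 * tau + (size s)%:R * (3 / 2 * tau).
    by rewrite -[(size (a :: s))%:R]natr1; ring.
  apply: lerD => //; have tm1 : -1 < tau by apply: lt_trans tau0; rewrite oppr_lt0.
  by have := le_ln1Dx tm1; move: (ln _) => x; lra.
- move=> z w zr w1; rewrite !big_cons !normcM expRD mulrACA.
  apply: ler_pM => //; last exact: hL.
  apply: le_trans (shifted_dominates a zr w1) _.
  have za : z - a != 0 by exact: (zero_free_sub ar).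
  rewrite expRB expRD !lnK ?posrE ?normc_gt0 ?shifted_neq0//.
  by rewrite [leRHS]mulrC divfK// gt_eqF// normc_gt0.
Qed.

End Shift.

(** Harnack's inequality for the nonnegative [A - ln |q|] on the disc of radius [r] about [z]. The
    lower bound (r - |w|) / (r + |w|) of the kernel is at least [1 - tau], because 2 |w| <= 2 <= tau
    r. *)
Lemma harnack q r z w (A tau : R) : 0 < r -> 2 <= tau * r -> ent q ->
  (forall p, normc (p - z) <= r -> q p != 0) ->
  (forall p, normc (p - z) <= r -> ln (normc (q p)) <= A) -> normc w <= 1 -> 1 < r ->
  ln (normc (q (z + w))) <= ln (normc (q z)) + tau * (A - ln (normc (q z))).
Proof.
move=> r0 tr hq q0 qA w1 r1; pose u p := q (z + p).
have hu : ent u.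
  apply: (@holo_comp _ _ (fun=> True) q) => //.
  by apply: holoD; [exact: holo_cst|exact: holo_id].
have zp p : z + p - z = p by ring.
have u0 p : normc p <= r -> u p != 0 by move=> pr; apply: q0; rewrite zp.
have wr : normc w < r := le_lt_trans w1 r1.
have zu : zero_free u r by move=> p pr; apply: u0; rewrite pr.
have cu : rcircle (fun p => ln (normc (u p))) r by apply: rcircle_lnmean => //; exact: ltW.
have cP := rcircle_poisson wr.
have w0 := normc_ge0 w.
pose k := (r - normc w) / (r + normc w).
have c1 : rcircle (fun p => A - ln (normc (u p))) r.
  by apply: rcircleB => //; exact: rcircle_cst.
have low : k * (A - ln (normc (u 0))) <= A - ln (normc (u w)).
  rewrite (poisson_log hu u0 wr) -(lnmean_zero_free_disc r0 hu u0).
  have -> : A - lnmean u r = smean (fun p => A - ln (normc (u p))) r.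
    by rewrite smeanB ?smean_cst//; exact: rcircle_cst.
  have -> : A - smean (fun p => poisson r w p * ln (normc (u p))) r =
     smean (fun p => poisson r w p * (A - ln (normc (u p)))) r.
    rewrite -{1}[A]mulr1 -(smean_poisson wr) -smeanZ// -smeanB; last 2 first.
    - exact: rcircleZ.
    - exact: rcircleM.
    by apply: eq_smean; rewrite ?(ltW r0)// => p _; ring.
  rewrite -smeanZ//; apply: le_smean; rewrite ?(ltW r0)//.
  - exact: rcircleZ.
  - exact: rcircleM.
  move=> p pr; apply: ler_wpM2r; last exact: poisson_lower.
  by rewrite subr_ge0; apply: qA; rewrite zp pr.
have A0 : 0 <= A - ln (normc (u 0)).
  by rewrite subr_ge0; apply: qA; rewrite zp normc0 ltW.
have kt : 1 - tau <= k.
  have rw : 0 < r + normc w by lra.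
  rewrite /k ler_pdivlMr//.
  have : 0 <= tau * normc w.
    rewrite mulr_ge0//; rewrite -(pmulr_lge0 _ r0); lra.
  lra.
have := ler_wpM2r A0 kt; rewrite /u addr0 in low *; lra.
Qed.

Lemma ln2_ge : 2^-1 <= ln (2 : R).
Proof.
have := @le_ln1Dx R (- 2^-1); have -> : 1 + - 2^-1 = 2^-1 :> R by field.
rewrite lnV ?posrE//; have -> : -1 < - 2^-1 :> R by lra.
by move=> /(_ isT); rewrite lerN2.
Qed.

(* Split off the zeros in [|z| <= 2r]: Harnack's inequality controls the zero-free
   factor, [shift_linear_factors] the others, and their number is [O(Lam)]. *)
Theorem difference_estimate h (r tau Lam : R) : ent h -> 1 < r -> 0 < tau ->
  1 <= tau ^+ 3 * r ^+ 2 -> 2 <= tau * r -> zero_free h r ->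
  (forall z, normc z = 6 * r -> normc (h z) <= expR Lam) ->
  exists L : C -> R, [/\ rcircle L r,
    smean L r <= 4 * tau * (Lam + ln 4 - lnmean h r), lnmean h r <= Lam + ln 4 &
    forall z w, normc z = r -> normc w <= 1 ->
      normc (h (z + w)) <= normc (h z) * expR (L z)].
Proof.
move=> hh r1 tau0 rtau tr h0 hLam.
have r0 : 0 < r by lra.
have r20 : 0 <= 2 * r by lra.
have [|s [q [hq hs hE q0]]] := factor_disc hh r20.
  by exists r%:C%C; apply: h0; rewrite normcR gtr0_norm.
have ns a : a \in s -> normc a != r.
  move=> sa; apply/eqP => ar; have := h0 a ar.
  by rewrite hE (big_rem a)//= subrr !mul0r eqxx.
have [L1 [cL1 mL1 hL1]] := shift_linear_factors r0 tau0 rtau ns.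
pose n : R := (size s)%:R; have n0 : 0 <= n by exact: ler0n.
(* On |w| = 6 r every factor [w - a] with |a| <= 2 r is at least 4 r, which gives the last term;
   [ln 4] is the constant of [max_modulus]. *)
pose A := Lam + ln 4 - n * ln (4 * r).
have r4 : 0 < 4 * r by lra.
have expA : expR A = 4 * (expR Lam / (4 * r) ^+ size s).
  rewrite /A expRB expRD lnK ?posrE// /n expRM_natl lnK ?posrE//.
  by rewrite [expR Lam * 4]mulrC mulrA.
have qA p : normc p <= 3 * r -> normc (q p) <= expR A.
  move=> pr; rewrite expA; apply: (@max_modulus _ q (6 * r)) => //; [lra|lra|].
  move=> w wr; rewrite ler_pdivlMr ?exprn_gt0//; apply: le_trans (hLam w wr).
  rewrite hE normcM mulrC ler_wpM2r//.
  elim: s hs {hE ns L1 cL1 mL1 hL1 n n0 A expA} => [|a s IH] hs; first by rewrite big_nil normc1.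
  rewrite big_cons normcM exprS; apply: ler_pM; rewrite ?exprn_ge0 ?(ltW r4)//.
    apply: le_trans (ler_dist_normc _ _); rewrite wr.
    by have := hs a (mem_head _ _); lra.
  by apply: IH => b bs; apply: hs; rewrite in_cons bs orbT.
have lnqA p : normc p <= 2 * r -> ln (normc (q p)) <= A.
  move=> pr; rewrite -[A]expRK ler_ln ?posrE ?expR_gt0 ?normc_gt0 ?q0//.
  by apply: qA; lra.
have rr2 : r <= 2 * r by lra.
have cq : rcircle (fun z => ln (normc (q z))) r.
  by apply: rcircle_lnmean; rewrite ?(ltW r0)// => z zr; apply: q0; rewrite zr.
have mq : lnmean q r = ln (normc (q 0)).
  by apply: lnmean_zero_free_disc => // z zr; apply: q0; lra.
have Ih : lnmean h r = \sum_(a <- s) ln (Num.max r (normc a)) + ln (normc (q 0)).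
  rewrite -(lnmean_factor r0 rr2 hq q0 ns).
  by apply: eq_smean; rewrite ?(ltW r0)// => z _; rewrite hE.
have sum_le : \sum_(a <- s) ln (Num.max r (normc a)) <= n * ln (2 * r).
  rewrite /n; elim: s hs {hE ns L1 cL1 mL1 hL1 n n0 A expA qA lnqA Ih} => [|a s IH] hs.
    by rewrite big_nil mul0r.
  rewrite big_cons -[(size (a :: s))%:R]natr1 mulrDl mul1r [leRHS]addrC; apply: lerD; last first.
    by apply: IH => b bs; apply: hs; rewrite in_cons bs orbT.
  rewrite ler_ln ?posrE ?lt_max ?r0//; last by lra.
  by rewrite ge_max rr2 hs// mem_head.
have q0A : ln (normc (q 0)) <= A by apply: lnqA; rewrite normc0.
have ln42 : ln (4 * r) = ln 2 + ln (2 * r).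
  rewrite -lnM ?posrE//; last by lra.
  by congr ln; ring.
pose W := Lam + ln 4 - lnmean h r.
(* Each zero lowers [A] by ln (4 r) but adds at most ln (2 r) to the mean of ln|h|. The surplus ln 2
   per zero bounds the number of zeros by [2 * W]. *)
have AW : A - ln (normc (q 0)) <= W - n * ln 2.
  by rewrite /A /W ln42 Ih; lra.
have nW : n <= 2 * W.
  have := ler_wpM2l n0 ln2_ge; lra.
have W0 : 0 <= W by lra.
exists (fun z => L1 z + tau * (A - ln (normc (q z)))); split.
- apply: rcircleD => //; apply: rcircleZ; apply: rcircleB => //; exact: rcircle_cst.
- rewrite smeanD//; last by apply: rcircleZ; apply: rcircleB => //; exact: rcircle_cst.
  rewrite smeanZ; last by apply: rcircleB => //; exact: rcircle_cst.
  rewrite smeanB//; last exact: rcircle_cst.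
  rewrite smean_cst -/(lnmean q r) mq.
  (* The linear factors cost at most [3 * tau * W] since [n <= 2 * W], the zero-free factor at most
     [tau * W]: together the constant 4. *)
  have := ler_wpM2l (ltW tau0) AW; have := ler_wpM2l (ltW tau0) nW.
  have l20 : 0 <= ln (2 : R) by apply: le_trans ln2_ge; rewrite invr_ge0.
  have := mulr_ge0 (ltW tau0) (mulr_ge0 n0 l20).
  by rewrite -/n in mL1; rewrite -/W; lra.
- by rewrite -subr_ge0.
- move=> z w zr w1; rewrite !hE !normcM expRD mulrACA.
  apply: ler_pM => //; first exact: hL1.
  have disc p : normc (p - z) <= r -> normc p <= 2 * r.
    by move=> pz; rewrite -[p](subrK z) (le_trans (le_normcD _ _))//; lra.
  have zwr : normc (z + w) <= 2 * r by apply: disc; rewrite addrC addKr; lra.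
  have zr2 : normc z <= 2 * r by lra.
  have qzw0 : 0 < normc (q (z + w)) by rewrite normc_gt0 q0.
  have qz0 : 0 < normc (q z) by rewrite normc_gt0 q0.
  have H := @harnack q r z w A tau r0 tr hq (fun p hp => q0 p (disc p hp))
    (fun p hp => lnqA p (disc p hp)) w1 r1.
  by rewrite -ler_expR expRD !lnK ?posrE// in H.
Qed.

End LogMeans.

(** * Counting separated pairs *)

Section Counting.
Set Implicit Arguments.
Unset Strict Implicit.
Variable R : realType.
Local Notation C := R[i].
Implicit Types (f g h q u : C -> C) (z w p a b c : C) (s Z : seq C) (r t : R) (mult : C -> nat).

(** The list [Z] certifies that the support in the disc is finite, so the sum in [counting] is the
    true count and not the default 0. *)
Lemma counting_seq mult Z r t : uniq Z ->
  (forall z, normc z <= r -> mult z != 0%N -> z \in Z) -> t <= r ->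
  Defs.counting mult t = \sum_(z <- Z) (mult z)%:R * ((normc z <= t)%R)%:R.
Proof.
move=> uZ hZ tr; rewrite /Defs.counting.
rewrite (@fsbigE _ _ _ _ _ [seq z <- Z | normc z <= t]).
- rewrite big_filter_cond [RHS](bigID (fun z => normc z <= t)) /=.
  rewrite [X in _ = _ + X]big1 => [|z /negbTE ->]; last by rewrite mulr0.
  rewrite addr0; apply: eq_big => [z|z /andP[-> _]]; last by rewrite mulr1.
  by rewrite andb_idr// => zt; exact/mem_set.
- exact: filter_uniq.
- by move=> z /=; rewrite mem_filter => /andP[].
- move=> z /= zt; rewrite mem_filter zt /= => nZ.
  have [->//|m0] := eqVneq (mult z) 0%N.
  by rewrite hZ// in nZ; exact: le_trans tr.
Qed.

(** What a single point of modulus [c] contributes to the integrand of [integrated_counting]. *)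
Definition cut_inv (c t : R) : R := ((c <= t)%R)%:R * t^-1.

Lemma cut_inv_integral (c r : R) : 0 < c -> c <= r ->
  lebesgue_measure.-integrable `[0, r] (EFin \o cut_inv c) /\
  rint 0 r (cut_inv c) = ln r - ln c.
Proof.
move=> c0 cr; have cutE : cut_inv c = GRing.inv \_ `[c, +oo[.
  apply/funext => t; rewrite /cut_inv patchE.
  have [ct|ct] := leP c t.
    by rewrite mem_set ?mul1r//= in_itv /= ct.
  by rewrite memNset ?mul0r//= in_itv /= andbT leNgt ct.
have sub : `[0, r]%classic `&` `[c, +oo[%classic = `[c, r]%classic :> set R.
  apply/seteqP; split=> t /=; rewrite !in_itv /= ?andbT.
    by move=> [/andP[_ ->] ->].
  by move=> /andP[ct tr]; rewrite ct tr (le_trans (ltW c0) ct).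
have ic : rcts c r (GRing.inv : R -> R).
  move=> t /andP[ct _]; apply: inv_continuous; rewrite gt_eqF//.
  exact: lt_le_trans ct.
split.
- have -> : EFin \o cut_inv c = (EFin \o GRing.inv) \_ `[c, +oo[.
    by rewrite cutE; apply/funext => t; rewrite /= !patchE; case: ifP.
  by apply/integrable_restrict => //; rewrite ?sub; first exact: rcts_integrable.
- rewrite /rint cutE -Rintegral_mkcondr sub /Rintegral.
  have [cr'|cr'] := eqVneq c r.
    by rewrite cr' subrr set_itv1 integral_set1.
  rewrite (@continuous_FTC2 _ _ (@ln R))//; first by rewrite lt_neqAle cr'.
  + apply: continuous_in_subspaceT => t /set_mem /=; rewrite in_itv /=; exact: ic.
  + have cl t : c <= t -> {for t, continuous (@ln R)}.
      by move=> ct; apply: continuous_ln; exact: lt_le_trans ct.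
    split=> [t|/=|/=].
    * rewrite in_itv /= => /andP[ct _].
      by have [] := is_derive1_ln (lt_trans c0 ct).
    * by apply: cvg_at_right_filter; exact: cl.
    * by apply: cvg_at_left_filter; exact: cl.
  + move=> t; rewrite in_itv /= => /andP[ct _].
    by rewrite derive1E; have [_ ->] := is_derive1_ln (lt_trans c0 ct).
Qed.

Lemma integrated_counting_seq mult Z r : 0 < r -> uniq Z ->
  (forall z, normc z <= r -> mult z != 0%N -> z \in Z) ->
  (forall z, z \in Z -> 0 < normc z <= r) ->
  integrated_counting mult r = \sum_(z <- Z) (mult z)%:R * (ln r - ln (normc z)).
Proof.
move=> r0 uZ hZ Zr; have c0 : Defs.counting mult 0 = 0.
  rewrite (counting_seq uZ hZ (ltW r0)) big_seq big1// => z /Zr /andP[z0 _].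
  by rewrite leNgt z0 mulr0.
rewrite /integrated_counting c0 mul0r addr0.
rewrite -/(rint 0 r (fun t => (Defs.counting mult t - 0) / t)).
rewrite (@eq_rint _ _ _ _ (fun t => \sum_(z <- Z) (mult z)%:R * cut_inv (normc z) t)).
  rewrite /rint; elim: Z Zr {uZ hZ} => [|z Z IH] Zr.
    by rewrite big_nil; under eq_Rintegral do rewrite big_nil; rewrite Rintegral_cst// mul0r.
  have /andP[z0 zr] := Zr z (mem_head _ _).
  have [iz Ez] := cut_inv_integral z0 zr.
  have {}Zr b : b \in Z -> 0 < normc b <= r by move=> bZ; apply: Zr; rewrite in_cons bZ orbT.
  rewrite big_cons -Ez -IH//; under eq_Rintegral do rewrite big_cons.
  have iZ : lebesgue_measure.-integrable `[0, r]
      (EFin \o (fun t => \sum_(z <- Z) (mult z)%:R * cut_inv (normc z) t)).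
    elim: Z Zr {IH} => [|b Z IH] Zr.
      rewrite (_ : EFin \o _ = EFin \o (fun=> 0)); first exact: rcts_integrable (@rcts_cst _ _ _ 0).
      by apply/funext => t /=; rewrite big_nil.
    have /andP[b0 br] := Zr b (mem_head _ _).
    have [ib _] := cut_inv_integral b0 br.
    have {}Zr b' : b' \in Z -> 0 < normc b' <= r.
      by move=> bZ; apply: Zr; rewrite in_cons bZ orbT.
    rewrite (_ : EFin \o _ = (fun t => (mult b)%:R%:E * (EFin \o cut_inv (normc b)) t +
      (EFin \o (fun t => \sum_(z <- Z) (mult z)%:R * cut_inv (normc z) t)%R) t)%E).
      by apply: integrableD => //; [exact: integrableZl|exact: IH].
    by apply/funext => t /=; rewrite big_cons.
  rewrite RintegralD//; last first.
    rewrite (_ : EFin \o _ = (fun t => (mult z)%:R%:E * (EFin \o cut_inv (normc z)) t)%E)//.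
    exact: integrableZl.
  by rewrite RintegralZl.
move=> t /andP[t0 tr]; rewrite (counting_seq uZ hZ tr) subr0 mulr_suml.
by apply: eq_bigr => z _; rewrite /cut_inv mulrA.
Qed.

Definition div_diff f c z : C := (f (z + c) - f z) / c.

Lemma ent_shift f c : ent f -> ent (fun z => f (z + c)).
Proof.
move=> hf; apply: (@holo_comp _ _ (fun=> True) f) => //.
by apply: holoD; [exact: holo_id|exact: holo_cst].
Qed.

Lemma derive1_ent f l : (forall z, cderiv f z (l z)) -> (f^`())%classic = l.
Proof. by move=> h; apply/funext => z; have [_ ->] := cderiv_derive1 (h z). Qed.

Lemma ent_derive1n f n : ent f -> ent (f^`(n))%classic.
Proof. by elim: n f => [//|n IH] f hf; rewrite derive1Sn; apply: IH; exact: ent_derive. Qed.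

Lemma derive1n_diff f c n : ent f -> ((fun z => f (z + c) - f z)^`(n))%classic =
  fun z => (f^`(n))%classic (z + c) - (f^`(n))%classic z.
Proof.
move=> hf; elim: n => [//|n IH]; rewrite derive1nS IH; apply: derive1_ent => z.
have h w : cderiv ((f^`(n))%classic) w ((f^`(n.+1))%classic w).
  by rewrite derive1nS; apply: ent_cderiv; exact: ent_derive1n.
apply: cderivB; last exact: h.
apply: (@cderiv_eql _ _ _ ((f^`(n.+1))%classic (z + c) * 1)); first exact: mulr1.
apply: (@cderiv_comp _ (f^`(n))%classic (fun z => z + c)); last exact: h.
apply: (@cderiv_eql _ _ _ (1 + 0)); first exact: addr0.
by apply: cderivD; [exact: cderiv_id|exact: cderiv_cst].
Qed.

(** One differentiation leaves [(z - a) ^+ n] times a new entire cofactor with value [n.+1%:R * q a]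
    at [a], so the induction generalises over [q]. *)
Lemma derive1n_pow_mul q a n : ent q ->
  ((fun z => (z - a) ^+ n * q z)^`(n))%classic a = n`!%:R * q a.
Proof.
elim: n q => [|n IH] q hq; first by rewrite /= expr0 fact0 !mul1r.
rewrite derive1Sn.
have -> : ((fun z => (z - a) ^+ n.+1 * q z)^`())%classic =
    fun z => (z - a) ^+ n * (n.+1%:R * q z + (z - a) * (q^`())%classic z).
  apply: derive1_ent => z.
  have h : cderiv (fun z => z - a) z 1.
    by apply: cderiv_eql (cderivB (cderiv_id z) (cderiv_cst a z)); rewrite subr0.
  apply: cderiv_eql (cderivM (cderivX n.+1 h) (ent_cderiv z hq)).
  by rewrite exprS /=; ring.
rewrite IH; last first.
  apply: holoD; first by apply: holoM => //; exact: holo_cst.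
  by apply: holoM; [exact: ent_sub|exact: ent_derive].
by rewrite subrr mul0r addr0 mulrA -natrM factS mulnC.
Qed.

Lemma prod_count s z a : \prod_(b <- s) (z - b) =
  (z - a) ^+ count_mem a s * \prod_(b <- s | b != a) (z - b).
Proof.
rewrite (bigID (pred1 a)) /=; congr (_ * _).
rewrite (eq_bigr (fun=> z - a)) => [|b /eqP -> //].
by rewrite big_const_seq iter_mulr_1.
Qed.

(** If more than m initial terms agreed, m being the multiplicity of [z] in [s], the derivative of
    order m of f(w + c) - f(w) would vanish at [z]; but it is m! times a nonzero cofactor. The
    default 0 of [xget] satisfies the bound trivially. *)
Lemma equal_initial_terms_le f c s q z : ent f -> c != 0 -> ent q -> q z != 0 ->
  (forall w, div_diff f c w = \prod_(b <- s) (w - b) * q w) ->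
  (equal_initial_terms f c z <= count_mem z s)%N.
Proof.
move=> hf c0 hq qz dE; rewrite /equal_initial_terms; case: xgetP => [k -> [hk _]|//].
rewrite leqNgt; apply/negP => lt; have := hk _ lt; rewrite /taylor_coef => /eqP.
set m := count_mem z s.
have mf : m`!%:R != 0 :> C by rewrite pnatr_eq0 -lt0n fact_gt0.
rewrite (inj_eq (mulIf (invr_neq0 mf))) eq_sym -subr_eq0 => /eqP.
have := congr1 (fun F => F z) (derive1n_diff c m hf) => /= <-.
pose Q w := c * (\prod_(b <- s | b != z) (w - b) * q w).
have hQ : ent Q.
  apply: holoM; first exact: holo_cst.
  apply: holoM => //.
  apply: (holo_eq (f := fun w => \prod_(b <- [seq b <- s | b != z]) (w - b))) => [w|].
    by rewrite big_filter.
  exact: ent_prod.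
have -> : (fun w => f (w + c) - f w) = (fun w => (w - z) ^+ m * Q w).
  apply/funext => w; rewrite /Q mulrCA [X in c * X]mulrA -prod_count -dE /div_diff.
  by rewrite mulrC divfK.
rewrite derive1n_pow_mul// => /eqP; rewrite !mulf_eq0 (negbTE mf) (negbTE c0) (negbTE qz) /=.
rewrite orbF => /eqP h.
have : \prod_(b <- s | b != z) (z - b) != 0.
  rewrite prodf_seq_neq0; apply/allP => b _ /=; apply/implyP => bz.
  by rewrite subr_eq0 eq_sym.
by rewrite h eqxx.
Qed.

(** A zero of [div_diff f c] is a pair for at most one value, namely [f z], so the sum over [A]
    collapses to one sum over zeros. The zeros in |z| <= rho carry no pair with value in [A], and
    all terms on the right are nonnegative. Two radii occur because pairs are counted up to [r]
    while Jensen's formula is used on a generic circle [r']. *)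
Theorem sum_N_pairs_le f c A s q (rho r r' : R) : ent f -> c != 0 -> uniq A ->
  0 < rho -> rho <= r' -> 0 < r -> r <= r' -> ent q ->
  (forall z, normc z <= r' -> q z != 0) ->
  (forall w, div_diff f c w = \prod_(b <- s) (w - b) * q w) ->
  (forall z, normc z <= rho -> f z \in A -> f (z + c) != f z) ->
  \sum_(a <- A) N_pairs f c a r <=
    \sum_(b <- s) (ln (Num.max r' (normc b)) - ln (Num.max rho (normc b))).
Proof.
move=> hf c0 uA rho0 rhor' r0 rr' hq q0 dE nopair.
pose P b := (rho < normc b) && (normc b <= r).
pose s' := [seq b <- s | P b]; pose Z := undup s'.
have multle a z : normc z <= r' -> (pair_mult f c a z <= (a == f z) * count_mem z s)%N.
  move=> zr; rewrite /pair_mult; case: ifP => // /andP[/eqP <- _].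
  by rewrite eqxx mul1n; apply: (equal_initial_terms_le hf c0 hq (q0 z zr) dE).
have supp a z : a \in A -> normc z <= r -> pair_mult f c a z != 0%N -> z \in Z.
  move=> aA zr m0; rewrite mem_undup mem_filter /P zr andbT.
  have zs : z \in s.
    rewrite -has_pred1 has_count lt0n; apply: contraNneq m0 => h.
    by have := multle a z (le_trans zr rr'); rewrite h muln0 leqn0.
  rewrite zs andbT ltNge; apply/negP => zrho.
  move: m0; rewrite /pair_mult; case: ifP => // /andP[/eqP fz /eqP fzc] _.
  by have := nopair z zrho; rewrite fz fzc aA eqxx => /(_ isT).
have Zr z : z \in Z -> 0 < normc z <= r.
  by rewrite mem_undup mem_filter => /andP[/andP[h ->] _]; rewrite (lt_trans rho0 h).
have NE a : a \in A -> N_pairs f c a r =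
    \sum_(z <- Z) (pair_mult f c a z)%:R * (ln r - ln (normc z)).
  move=> aA; apply: integrated_counting_seq => //; first exact: undup_uniq.
  by move=> z; exact: supp.
rewrite big_seq (eq_bigr _ NE) -big_seq exchange_big /=.
apply: (@le_trans _ _ (\sum_(z <- Z) (ln r - ln (normc z)) *+ count_mem z s')).
  rewrite big_seq [leRHS]big_seq; apply: ler_sum => z zZ.
  have /andP[z0 zr] := Zr z zZ.
  have lnrz : 0 <= ln r - ln (normc z) by rewrite subr_ge0 ler_ln ?posrE.
  rewrite -mulr_suml -natr_sum -[leRHS]mulr_natl; apply: ler_wpM2r => //; rewrite ler_nat.
  have -> : count_mem z s' = count_mem z s.
    rewrite /s' count_filter; apply: eq_count => b /=; rewrite andb_idr// => /eqP ->.
    by move: zZ; rewrite mem_undup mem_filter => /andP[].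
  apply: (@leq_trans (\sum_(a <- A) (a == f z) * count_mem z s)).
    by apply: leq_sum => a _; apply: multle; exact: le_trans rr'.
  rewrite -big_distrl /= -[leqRHS]mul1n leq_mul2r; apply/orP; right.
  have -> : (\sum_(a <- A) (a == f z) = count_mem (f z) A)%N.
    by rewrite -sum1_count [RHS]big_mkcond; apply: eq_bigr => a _ /=; case: (a == f z).
  by rewrite count_uniq_mem// leq_b1.
have -> : \sum_(z <- Z) (ln r - ln (normc z)) *+ count_mem z s' =
    \sum_(b <- s') (ln r - ln (normc b)).
  rewrite -(big_undup_iterop_count _ s' xpredT); apply: eq_bigr => z _.
  by rewrite Monoid.iteropE /= ; elim: (count_mem z s') => [|n IH] //=; rewrite mulrS IH.
rewrite big_filter big_mkcond; apply: ler_sum => b _.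
have r'0 : 0 < r' := lt_le_trans r0 rr'.
case: ifP => [/andP[h1 h2]|_]; last first.
  by rewrite subr_ge0 ler_ln ?posrE ?lt_max ?rho0 ?r'0// ge_max !le_max lexx rhor' orbT.
rewrite (max_r (ltW h1)) lerD2r ler_ln ?posrE ?lt_max ?r'0//.
by rewrite le_max rr'.
Qed.

End Counting.

(** * Growth *)

Section Growth.
Set Implicit Arguments.
Unset Strict Implicit.
Variable R : realType.
Local Notation C := R[i].
Local Notation E := (@circle_point R).
Implicit Types (f g h q u : C -> C) (z w p a b c : C) (r t e B : R).

Lemma ent_div_diff f c : ent f -> ent (div_diff f c).
Proof.
move=> hf; apply: holoM; last exact: holo_cst.
by apply: holoB => //; exact: ent_shift.
Qed.

(** The mean value inequality on the segment from [z] to [z + c], obtained from [increment_bound]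
    with the uniform first-order Taylor estimate. *)
Lemma div_diff_bound f c z (X : R) : ent f -> c != 0 -> 0 <= X ->
  (forall w, normc w <= normc c -> normc ((f^`())%classic (z + w)) <= X) ->
  normc (div_diff f c z) <= X.
Proof.
move=> hf c0 X0 hX; have nc : 0 < normc c by rewrite normc_gt0.
have [M M0 hM] := ent_taylor1 (normc z + normc c) hf.
rewrite /div_diff normcM normcV ler_pdivrMr//.
have := @increment_bound R (fun t => f (z + t%:C%C * c)) (X * normc c) (M * normc c ^+ 2)
  (normc c)^-1.
rewrite rmorph1 rmorph0 mul1r mul0r addr0; apply.
- by rewrite invr_gt0.
- by rewrite mulr_ge0.
- by rewrite mulr_ge0 ?sqr_ge0// ltW.
move=> t t' /andP[t0 t1] _ tt'; pose k := (t' - t)%:C%C * c.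
have -> : z + t'%:C%C * c = (z + t%:C%C * c) + k by rewrite /k rmorphB; ring.
have nk : normc k = `|t' - t| * normc c by rewrite normcM normcR.
have tc : normc (t%:C%C * c) <= normc c.
  by rewrite normcM normcR ger0_norm// ler_piMl.
have k1 : normc k <= 1 by rewrite nk -ler_pdivlMr// mul1r.
have zt : normc (z + t%:C%C * c) <= normc z + normc c.
  by apply: le_trans (le_normcD _ _) _; rewrite lerD2l.
have := hM _ _ zt k1; set D := (f^`())%classic _ => hMk.
have -> : f (z + t%:C%C * c + k) - f (z + t%:C%C * c) =
  D * k + (f (z + t%:C%C * c + k) - f (z + t%:C%C * c) - D * k) by ring.
apply: le_trans (le_normcD _ _) _; apply: lerD.
  have -> : X * normc c * `|t' - t| = X * (`|t' - t| * normc c) by ring.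
  rewrite normcM nk ler_wpM2r ?mulr_ge0// hX// (le_trans tc)//.
apply: le_trans hMk _; rewrite nk exprMn real_normK ?num_real//.
by rewrite mulrCA mulrC.
Qed.

(** The derivative is the value at [z] of the quotient (f(w) - f(z)) / (w - z), which is at most 2 S
    on the unit circle about [z]; [max_modulus] multiplies this by 4. *)
Lemma derive_bound f z (S : R) : ent f ->
  (forall w, normc w <= 1 -> normc (f (z + w)) <= S) -> normc ((f^`())%classic z) <= 8 * S.
Proof.
move=> hf hS; have [q hq fE] := ent_divide z hf.
have -> : (f^`())%classic z = q z.
  apply: cderiv_uniq (ent_cderiv z hf) _; apply/cderivP; exists q; split=> //.
  exact: ent_cont.
have hq' := ent_shift z hq.
have -> : 8 * S = 4 * (2 * S) by ring.
have := @max_modulus _ _ 1 0 (2 * S) hq' ltr01; rewrite add0r; apply.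
  by rewrite normc0 divr_ge0.
move=> w w1; rewrite -[normc (q _)]mul1r -{1}w1 -normcM.
have -> : w * q (w + z) = f (z + w) - f (z + 0).
  by rewrite addr0 (fE (z + w)) [w + z]addrC; ring.
apply: le_trans (ler_normcB _ _) _; rewrite mulr_natl mulr2n.
by apply: lerD; apply: hS; rewrite ?normc0 ?ler01// w1.
Qed.

Lemma avoid_seq (l : seq R) (a b : R) : a < b -> exists2 x, a < x < b & x \notin l.
Proof.
move=> ab; suff [a' [b' [h1 h2 h3 h4]]] : exists a' b' : R, [/\ a <= a', a' < b', b' <= b &
    forall x, a' < x < b' -> x \notin l].
  by exists ((a' + b') / 2); [lra|apply: h4; lra].
elim: l => [|y l [a' [b' [h1 h2 h3 h4]]]]; first by exists a, b; rewrite !lexx.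
have [yh|hy] := leP y ((a' + b') / 2).
  exists ((a' + b') / 2), b'; split; [lra|lra|lra|].
  move=> x /andP[x1 x2]; rewrite in_cons negb_or gt_eqF/=; last by lra.
  by apply: h4; lra.
exists a', ((a' + b') / 2); split; [lra|lra|lra|].
move=> x /andP[x1 x2]; rewrite in_cons negb_or lt_eqF/=; last by lra.
by apply: h4; lra.
Qed.

Definition nonzero f := exists z, f z != 0.

Lemma zero_moduli h B : ent h -> nonzero h -> exists l : seq R, forall z, normc z <= B ->
  h z = 0 -> normc z \in l.
Proof.
move=> hh h0; have B0 : 0 <= Num.max 0 B by rewrite le_max lexx.
have [s [q [hq hs hE q0]]] := factor_disc hh B0 h0.
exists [seq normc a | a <- s] => z zB /eqP; rewrite hE mulf_eq0.
rewrite (negbTE (q0 z _)) ?orbF; last by rewrite le_max zB orbT.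
rewrite prodf_seq_eq0 => /hasP[a sa /=]; rewrite subr_eq0 => /eqP ->.
exact: map_f.
Qed.

(** Three functions, because [f], its derivative and [div_diff f c] must be free of zeros on one
    common circle; fewer are handled by repeating an argument. *)
Lemma generic_radius3 h1 h2 h3 (r r2 : R) : r < r2 -> ent h1 -> nonzero h1 -> ent h2 -> nonzero h2 ->
  ent h3 -> nonzero h3 ->
  exists2 r', r < r' < r2 & [/\ zero_free h1 r', zero_free h2 r' & zero_free h3 r'].
Proof.
move=> rr2 e1 n1 e2 n2 e3 n3.
have [l1 H1] := @zero_moduli _ r2 e1 n1; have [l2 H2] := @zero_moduli _ r2 e2 n2.
have [l3 H3] := @zero_moduli _ r2 e3 n3.
have [x /andP[x1 x2]] := avoid_seq (l1 ++ l2 ++ l3) rr2.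
rewrite !mem_cat !negb_or => /and3P[L1 L2 L3].
exists x; first by rewrite x1.
by split=> z zx; [apply: contra L1|apply: contra L2|apply: contra L3] => /eqP hz; rewrite -zx;
  [apply: H1|apply: H2|apply: H3]; rewrite // zx ltW.
Qed.

Lemma logp_mono (x y : R) : 0 <= x -> x <= y -> logp x <= logp y.
Proof.
rewrite le_eqVlt => /predU1P[<- _|x0 xy]; first by rewrite {1}/logp ln0// maxxx logp_ge0.
by rewrite /logp ge_max !le_max lexx ler_ln ?posrE ?xy ?orbT// (lt_le_trans x0).
Qed.

Lemma logp_mul (x y : R) : 0 < x -> 0 < y -> logp (x * y) <= logp x + logp y.
Proof.
move=> x0 y0; rewrite {1}/logp ge_max addr_ge0 ?logp_ge0//= lnM ?posrE//.
by apply: lerD; exact: ln_le_logp.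
Qed.

Lemma logp_lipschitz (x y : R) : 0 <= x -> 0 <= y -> logp x - logp y <= `|x - y|.
Proof.
move=> x0 y0; have [x1|x1] := leP x 1.
  have -> : logp x = 0 by rewrite /logp max_l// ln_le0.
  by rewrite sub0r (le_trans _ (normr_ge0 _))// oppr_le0 logp_ge0.
have lx : logp x = ln x by rewrite /logp max_r// ln_ge0// ltW.
rewrite lx; have [y1|y1] := leP y 1.
  apply: (@le_trans _ _ (ln x)); first by rewrite gerBl logp_ge0.
  apply: (@le_trans _ _ (x - 1)); last by rewrite (le_trans _ (ler_norm _))//; lra.
  have := @le_ln1Dx R (x - 1); rewrite subrKC; apply; lra.
apply: (@le_trans _ _ (ln x - ln y)); first by rewrite lerD2l lerN2 ln_le_logp.
have [xy|yx] := leP x y.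
  by rewrite (le_trans _ (normr_ge0 _))// subr_le0 ler_ln ?posrE//; lra.
have y00 : 0 < y by lra.
rewrite -ln_div ?posrE//; last by lra.
have := @le_ln1Dx R (x / y - 1); rewrite subrKC.
have xy1 : 1 < x / y by rewrite ltr_pdivlMr// mul1r.
move=> /(_ _)/le_trans; apply; first by lra.
apply: le_trans (ler_norm _).
have -> : x / y - 1 = (x - y) / y by field; rewrite gt_eqF.
by rewrite ler_pdivrMr// ler_peMr; lra.
Qed.

Lemma rcircle_logp_ent f r : 0 <= r -> ent f -> rcircle (fun z => logp (normc (f z))) r.
Proof. by move=> r0 hf; apply: rcircle_logp => // z _; exact: ent_cont. Qed.

Lemma m_proximity_ge0 f r : 0 <= m_proximity f r.
Proof.
rewrite mulr_ge0 ?invr_ge0 ?twopi_ge0// Rintegral_ge0// => t _.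
exact: logp_ge0.
Qed.

(** This pays for moving from [r] to a generic radius slightly beyond it. It follows from uniform
    continuity, [logp] being 1-Lipschitz on nonnegative reals. *)
Lemma m_proximity_right_cont f r e : 0 <= r -> ent f -> 0 < e ->
  exists2 d : R, 0 < d & forall r', r <= r' < r + d -> m_proximity f r' <= m_proximity f r + e.
Proof.
move=> r0 hf e0; have [d d0 hd] := unif_cont (B := r + 1) (fun z _ => ent_cont z hf) e0.
exists (Num.min 1 d); first by rewrite lt_min ltr01.
move=> r' /andP[rr']; rewrite -ltrBlDl lt_min => /andP[r'1 r'd].
have r'0 : 0 <= r' by exact: le_trans rr'.
rewrite !m_proximityE.
have -> : smean (fun z => logp (normc (f z))) r + e = smean (fun z => logp (normc (f z)) + e) r.
  by rewrite smeanD ?smean_cst//; [exact: rcircle_logp_ent|exact: rcircle_cst].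
rewrite /smean ler_wpM2l ?invr_ge0 ?twopi_ge0//; apply: le_rint.
- exact: rcircle_logp_ent.
- by apply: rctsD; [exact: rcircle_logp_ent|exact: rcts_cst].
move=> t _; rewrite -lerBlDl; apply: le_trans (logp_lipschitz _ _) _ => //.
have := hd (E r t) (E r' t); rewrite !normc_circle//.
have -> : E r' t - E r t = (r' - r)%:C%C * E 1 t.
  by rewrite circle_pointE [X in _ - X]circle_pointE -mulrBl -rmorphB.
rewrite normcM normc_circle// mulr1 normcR ger0_norm ?subr_ge0// => H.
have {}H : normc (f (E r' t) - f (E r t)) < e by apply: H => //; lra.
by apply: le_trans (ltW H); exact: ler_dist_dist_normc.
Qed.

Lemma normc_le_exp_m_proximity h r p : 0 < r -> ent h -> zero_free h r ->
  normc p <= r / 2 -> normc (h p) <= expR (3 * m_proximity h r).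
Proof.
move=> r0 hh h0 pr; have [->|hp] := eqVneq (h p) 0; first by rewrite normc0 expR_ge0.
by rewrite -ler_ln ?posrE ?expR_gt0 ?normc_gt0// expRK; exact: ln_normc_le_m_proximity.
Qed.

Lemma nonconstant_nonzero h : ~ (exists a, forall z, h z = a) -> nonzero h.
Proof.
move=> nc; apply: contrapT => /forallNP h0; apply: nc; exists 0 => z.
by apply/eqP/negPn/negP; exact: h0.
Qed.

(** If the proximity were at most [B] at arbitrarily large radii, |h| would be at most exp (3 (B +
    1)) everywhere, against Liouville's theorem. *)
Lemma m_proximity_unbounded h B : ent h -> ~ (exists a, forall z, h z = a) ->
  exists r0, forall r, r0 <= r -> B < m_proximity h r.
Proof.
move=> hh nc; have nz := nonconstant_nonzero nc.
apply: contrapT => /forallNP H; apply: nc; exists (h 0).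
apply: (@liouville _ _ (expR (3 * (B + 1)))) => // z.
have /existsNP[r /not_implyP[rz /negP]] := H (2 * normc z + 1).
rewrite -leNgt => mB; have z0 := normc_ge0 z.
have r0 : 0 <= r by lra.
have [d d0 hd] := m_proximity_right_cont r0 hh ltr01.
have rd : r < r + d by rewrite ltrDl.
have [r' /andP[rr' r'd] [h0 _ _]] := generic_radius3 rd hh nz hh nz hh nz.
have r'0 : 0 < r' by lra.
apply: le_trans (normc_le_exp_m_proximity r'0 hh h0 _) _; first by lra.
rewrite ler_expR ler_pM2l//; apply: le_trans (hd r' _) _; first by rewrite (ltW rr').
by rewrite lerD2r.
Qed.

(** For k > 0 the function (w - z)^k f(w) tends to 0, so no nonzero limit exists and [xget] returns
    its default. *)
Lemma pole_order_ent f z : ent f -> pole_order f z = 0%N.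
Proof.
move=> hf; rewrite /pole_order; case: xgetP => // k _ [k0 [l l0 cl]]; exfalso.
have nl : 0 < normc l by rewrite normc_gt0.
have e0 : 0 < (normc l / 2)%:C%C :> C by rewrite ltcR divr_gt0.
move/cvgrPdist_lt: cl => /(_ _ e0); rewrite near_withinE => -[[d d2]].
rewrite /= ltcE /= => /andP[/eqP -> d0] hd.
have [d1 d10 hb] := ccont_bounded (ent_cont z hf).
pose M := normc (f z) + 1; have M0 : 0 < M by rewrite ltr_wpDl.
pose t := Num.min 1 (Num.min (d / 2) (Num.min (d1 / 2) (normc l / 2 / M))).
have [t0 t1 td td1 tM] : [/\ 0 < t, t <= 1, t <= d / 2, t <= d1 / 2 & t <= normc l / 2 / M].
  by rewrite !lt_min !ge_min !lexx !orbT ltr01 !divr_gt0//.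
move: t t0 t1 td td1 tM => t t0 t1 td td1 tM.
have nt : normc t%:C%C = t by rewrite normcR gtr0_norm.
have wz : z + t%:C%C - z = t%:C%C by ring.
have := hd (z + t%:C%C); rewrite /ball /= opprD addrA subrr sub0r normrN.
rewrite ltcR normcR gtr0_norm// => /(_ _)/(_ _) => H.
have {}H : `|l - (z + t%:C%C - z) ^+ k * f (z + t%:C%C)| < (normc l / 2)%:C%C.
  apply: H; first by lra.
  by rewrite -subr_eq0 wz -normc_gt0 nt.
move: H; rewrite ltcR wz => H.
have fb : normc (f (z + t%:C%C)) <= M by apply/ltW/hb; rewrite wz nt; lra.
have tk : t ^+ k <= t by rewrite -[leRHS]expr1 ler_wiXn2l// ltW.
have small : normc (t%:C%C ^+ k * f (z + t%:C%C)) <= normc l / 2.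
  rewrite normcM normcX nt; apply: (@le_trans _ _ (t * M)).
    by apply: ler_pM; rewrite ?exprn_ge0// ltW.
  by rewrite -ler_pdivlMr.
have := le_lt_trans (ler_dist_normc _ _) H; lra.
Qed.

Lemma T_char_ent f r : ent f -> T_char f r = m_proximity f r.
Proof.
move=> hf; rewrite /T_char /N_poles.
have -> : pole_order f = fun=> 0%N by apply/funext => z; exact: pole_order_ent.
have c0 t : Defs.counting (fun _ : C => 0%N) t = 0.
  by rewrite /Defs.counting fsbig1.
rewrite /integrated_counting !c0 mul0r addr0.
rewrite (@eq_Rintegral _ _ _ _ _ (fun=> 0)) => [|t _]; last by rewrite c0 subrr mul0r.
by rewrite Rintegral_cst// mul0r addr0.
Qed.

Lemma finite_order_bound f : ent f -> finite_order f ->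
  exists k : nat, exists r0, forall r, r0 <= r -> m_proximity f r <= r ^+ k.
Proof.
move=> hf; rewrite /finite_order limf_esupE => /ereal_inf_lt[_ [V [M [_ hM]] <-] Vlt].
have [B hB] : exists B : R, forall r, M < r -> logp (m_proximity f r) / ln r <= B.
  set S := ereal_sup _ in Vlt.
  have ub r : M < r -> ((logp (m_proximity f r) / ln r)%:E <= S)%E.
    move=> Mr; rewrite -T_char_ent//; apply: ereal_sup_ubound; exists r => //; exact: hM.
  case: S Vlt ub => [B _ ub|//|_ ub].
    by exists B => r /ub; rewrite lee_fin.
  by have := ub (M + 1); rewrite ltrDl ltr01 leNgt ltNyr => /(_ isT).
exists (Num.bound `|B|), (Num.max (M + 1) 3) => r; rewrite ge_max => /andP[Mr r3].
have lr : 0 < ln r by rewrite ln_gt0//; lra.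
have r0 : 0 < r by lra.
have {}hB : logp (m_proximity f r) <= B * ln r by rewrite -ler_pdivrMr// hB//; lra.
have [m0|m0] := leP (m_proximity f r) 0.
  by apply: le_trans m0 _; rewrite exprn_ge0// ltW.
rewrite -ler_ln ?posrE ?exprn_gt0//; apply: le_trans (ln_le_logp _) _.
apply: le_trans hB _; rewrite lnXn// -[leRHS]mulr_natl ler_wpM2r ?(ltW lr)//.
by apply: le_trans (ler_norm _) _; apply/ltW/archi_boundP.
Qed.

(** If the proximity grew by more than 16^(k+1) at every step from r to 16 r, iteration would beat
    the bound r^k. The ratio 16 suits the later use: bounds at distance about 6 r, plus a unit, are
    read off a circle at least twice as large. *)
Lemma growth_radius f : ent f -> ~ (exists a, forall z, f z = a) -> finite_order f ->
  exists2 K : R, 0 < K & forall r0, exists2 r, r0 <= r & m_proximity f (16 * r) <= K * m_proximity f r.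
Proof.
move=> hf nc /(finite_order_bound hf)[k [r1 hk]].
have [r2 h2] := m_proximity_unbounded 1 hf nc.
exists (16 ^+ k.+1); first by rewrite exprn_gt0.
move=> r0; apply: contrapT => H.
pose s := Num.max 1 (Num.max r0 (Num.max r1 r2)).
have [s1 s0 sr1 sr2] : [/\ 1 <= s, r0 <= s, r1 <= s & r2 <= s].
  by rewrite !le_max !lexx !orbT.
move: s s1 s0 sr1 sr2 => s s1 s0 sr1 sr2.
have s16 n : s <= 16 ^+ n * s.
  by rewrite ler_peMl ?exprn_ege1//; lra.
have low n : (16 ^+ k.+1) ^+ n <= m_proximity f (16 ^+ n * s).
  elim: n => [|n IH]; first by rewrite !expr0 mul1r ltW// h2.
  have : ~~ (m_proximity f (16 * (16 ^+ n * s)) <= 16 ^+ k.+1 * m_proximity f (16 ^+ n * s)).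
    by apply/negP => h; apply: H; exists (16 ^+ n * s) => //; exact: le_trans (s16 n).
  rewrite -ltNge mulrA -exprS => /ltW; apply: le_trans.
  by rewrite exprS ler_wpM2l// exprn_ge0.
have up n : (16 ^+ k.+1) ^+ n <= (16 ^+ n * s) ^+ k.
  by apply: le_trans (low n) (hk _ _); exact: le_trans (s16 n).
have sk n : 16 ^+ n <= s ^+ k.
  have := up n; rewrite exprMn -!exprM mulSn exprD [(n * k)%N]mulnC mulrC.
  by rewrite ler_pM2l// exprn_gt0.
have [n hn] := @half_pow_small R (s ^+ k) 1 ltr01.
have : 2 ^+ n <= s ^+ k.
  by apply: le_trans (sk n); rewrite lerXn2r ?nnegrE// ler_nat.
by rewrite leNgt -[X in _ < X]mul1r -ltr_pdivrMr ?exprn_gt0// hn.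
Qed.

End Growth.

(** * The main estimate *)

Section SeparatedPairs.
Set Implicit Arguments.
Unset Strict Implicit.
Variable R : realType.
Local Notation C := R[i].
Implicit Types (f g h q u : C -> C) (z w p a c : C) (A : seq C) (r t e B : R).

Lemma lnmean_mono g (rho r : R) : ent g -> 0 < rho -> rho <= r ->
  zero_free g rho -> zero_free g r -> lnmean g rho <= lnmean g r.
Proof.
move=> hg rho0 rr g1 g2; have r0 : 0 < r := lt_le_trans rho0 rr.
have [|s [q [hq _ gE q0]]] := factor_disc hg (ltW r0).
  by exists r%:C%C; apply: g2; rewrite normcR gtr0_norm.
rewrite -subr_ge0 (jensen_annulus rho0 rr hq q0 gE g1 g2) sumr_ge0// => a _.
rewrite subr_ge0 ler_ln ?posrE ?lt_max ?rho0 ?r0//.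
by rewrite ge_max !le_max rr lexx orbT.
Qed.

Lemma lnmean_lower h : ent h -> nonzero h -> exists B, forall r, 2 <= r ->
  zero_free h r -> - B <= lnmean h r.
Proof.
move=> hh h0; have lt12 : 1 < 2 :> R by lra.
have [rho /andP[r1 r2] [z1 _ _]] := generic_radius3 lt12 hh h0 hh h0 hh h0.
exists (- lnmean h rho) => r rr zr; rewrite opprK; apply: lnmean_mono => //; lra.
Qed.

Lemma lnmean_proximity h r : 0 <= r -> ent h -> zero_free h r ->
  lnmean h r = m_proximity h r - m_proximity (fun z => (h z)^-1) r.
Proof.
move=> r0 hh h0; rewrite !m_proximityE -smeanB.
- apply: eq_smean => // z zr; have hz : 0 < normc (h z) by rewrite normc_gt0 h0.
  rewrite normcV /logp lnV ?posrE//; move: (ln _) => x.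
  by case: (leP 0 x) => x0; case: (leP 0 (- x)) => y0; lra.
- exact: rcircle_logp_ent.
- apply: rcircle_logp => // z zr; apply: ccontV; first exact: h0.
  exact: ent_cont.
Qed.

Lemma inner_radius (l : seq R) : exists2 rho : R, 0 < rho <= 1 & forall x, x \in l -> 0 < x -> rho < x.
Proof.
elim: l => [|y l [rho /andP[rho0 rho1] h]]; first by exists 1; rewrite ?ltr01 ?lexx.
have [y0|y0] := leP y 0.
  exists rho; first by rewrite rho0.
  by move=> x; rewrite in_cons => /predU1P[->|/h//]; rewrite ltNge y0.
exists (Num.min rho (y / 2)); first by rewrite lt_min rho0 divr_gt0//= ge_min rho1.
move=> x; rewrite in_cons gt_min => /predU1P[->|/h hx /hx ->//].
by move=> _; apply/orP; right; lra.
Qed.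

(** The origin is left out because [f 0] may belong to [A]. Two distinct points of the disc can then
    not both take values in [A], which excludes pairs near 0 for small shifts. *)
Lemma isolated_values f A : ent f -> ~ (exists a, forall z, f z = a) ->
  exists2 rho : R, 0 < rho & forall z, 0 < normc z <= rho -> f z \notin A.
Proof.
move=> hf nc; elim: A => [|a A [rho rho0 h]]; first by exists 1.
have ha : ent (fun z => f z - a) by apply: holoB => //; exact: holo_cst.
have na : nonzero (fun z => f z - a).
  apply: contrapT => /forallNP n0; apply: nc; exists a => z.
  by apply/eqP; rewrite -subr_eq0; apply/negPn/negP; exact: n0.
have [l hl] := @zero_moduli _ _ 1 ha na.
have [d /andP[d0 d1] hd] := inner_radius l.
exists (Num.min rho d); first by rewrite lt_min rho0.
move=> z; rewrite le_min => /and3P[z0 zrho zd].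
rewrite in_cons negb_or h ?z0// andbT; apply/negP => /eqP fa.
have := hd (normc z) (hl z (le_trans zd d1) _) z0; rewrite ltNge zd.
by rewrite fa subrr => /(_ erefl).
Qed.

(** A point off the circle has a neighbourhood missing it, where the condition is void, so
    compactness of the disc applies. *)
Lemma bounded_away_circle h r : ent h -> zero_free h r ->
  exists2 k : R, 0 < k & forall z, normc z = r -> k <= normc (h z).
Proof.
move=> hh h0.
pose Pr (S : C -> Prop) := exists2 k : R, 0 < k & forall z, S z -> normc z = r -> k <= normc (h z).
suff [k k0 hk] : Pr (fun z => normc z <= r).
  by exists k => // z zr; apply: hk; rewrite // zr.
apply: disc_ind.
- by move=> S S' sub [k k0 hk]; exists k => // z /sub; exact: hk.
- move=> S S' [k k0 hk] [k' k'0 hk']; exists (Num.min k k'); first by rewrite lt_min k0.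
  by move=> z [Sz|Sz] zr; rewrite ge_min; apply/orP; [left; exact: hk|right; exact: hk'].
- by exists 1.
move=> z _; have [zr|zr] := eqVneq (normc z) r; last first.
  exists `|normc z - r|; first by rewrite normr_gt0 subr_eq0.
  exists 1 => // w wz wr; exfalso; move: wz; rewrite -wr normc_distC ltNge => /negP; apply.
  exact: ler_dist_dist_normc.
have hz := h0 z zr; rewrite -normc_gt0 in hz.
have [|d d0 hd] := ent_cont z hh (e := normc (h z) / 2); first by rewrite divr_gt0.
exists d => //; exists (normc (h z) / 2); first by rewrite divr_gt0.
move=> w /hd wz _; rewrite normc_distC in wz.
have := le_lt_trans (ler_dist_normc _ _) wz; lra.
Qed.

(** As c tends to 0, [div_diff f c] tends to the derivative uniformly on the circle, so half the
    lower bound of |f'| survives. [B] and [d] are chosen before [c], as the shift will vary with the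
    radius. *)
Lemma div_diff_lower f r : ent f -> 0 < r -> zero_free (f^`())%classic r ->
  exists B, exists2 d : R, 0 < d & forall c, c != 0 -> normc c < d ->
    zero_free (div_diff f c) r /\ - B <= lnmean (div_diff f c) r.
Proof.
move=> hf r0 h0; have hh := ent_derive hf.
have [k k0 hk] := bounded_away_circle hh h0.
have [M M0 hM] := ent_taylor1 r hf.
exists (- ln (k / 2)), (Num.min 1 (k / 2 / M)).
  by rewrite lt_min ltr01 !divr_gt0.
move=> c c0; rewrite lt_min ltr_pdivlMr// => /andP[c1 cM].
have nc : 0 < normc c by rewrite normc_gt0.
have low z : normc z = r -> k / 2 <= normc (div_diff f c z).
  move=> zr; have zr' : normc z <= r by rewrite zr.
  have := hM z c zr' (ltW c1); set D := (f^`())%classic z => T.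
  have dE : D - div_diff f c z = - ((f (z + c) - f z - D * c) / c).
    by rewrite /div_diff; field.
  have : normc (D - div_diff f c z) <= k / 2.
    rewrite dE normcN normcM normcV ler_pdivrMr//; apply: le_trans T _.
    by rewrite expr2 mulrA ler_pM2r// mulrC ltW.
  have := hk z zr; rewrite -/D => kD.
  have := ler_dist_normc D (div_diff f c z); lra.
have zf : zero_free (div_diff f c) r.
  by move=> z zr; rewrite -normc_gt0 (lt_le_trans _ (low z zr))// divr_gt0.
split=> //; rewrite opprK -(smean_cst (ln (k / 2)) r); apply: le_smean; first exact: ltW.
- exact: rcircle_cst.
- by apply: rcircle_lnmean => //; [exact: ltW|exact: ent_div_diff].
- by move=> z zr; rewrite ler_ln ?posrE ?normc_gt0 ?zf ?low ?divr_gt0.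
Qed.

Lemma derive_nonzero f : ent f -> ~ (exists a, forall z, f z = a) ->
  nonzero (f^`())%classic.
Proof.
move=> hf nc; apply: contrapT => /forallNP n0; apply: nc; exists (f 0) => c.
have [->//|c0] := eqVneq c 0.
have : normc (div_diff f c 0) <= 0.
  apply: div_diff_bound => // w _; rewrite le_eqVlt normc_eq0.
  by apply/orP; left; apply/negPn/negP; exact: n0.
rewrite le_eqVlt ltNge normc_ge0 orbF normc_eq0 /div_diff mulf_eq0 invr_eq0 (negbTE c0) orbF.
by rewrite add0r subr_eq0 => /eqP.
Qed.

Lemma div_diff_nonzero f c : c != 0 -> ~ periodic f c -> nonzero (div_diff f c).
Proof.
move=> c0 np; apply: contrapT => /forallNP n0; apply: np => z.
have /negP/negPn := n0 z.
by rewrite /div_diff mulf_eq0 invr_eq0 (negbTE c0) orbF subr_eq0 => /eqP.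
Qed.

(** All points of the segment from [z] to [z + c] are unit shifts of [z], so the majorant [L] for
    the derivative also bounds its difference quotient. *)
Lemma lnmean_div_diff_le f c r (tau Lam : R) : ent f -> c != 0 -> normc c <= 1 -> 1 < r -> 0 < tau ->
  1 <= tau ^+ 3 * r ^+ 2 -> 2 <= tau * r ->
  zero_free (f^`())%classic r -> zero_free (div_diff f c) r ->
  (forall z, normc z = 6 * r -> normc ((f^`())%classic z) <= expR Lam) ->
  lnmean (div_diff f c) r <=
    lnmean (f^`())%classic r + 4 * tau * (Lam + ln 4 - lnmean (f^`())%classic r).
Proof.
move=> hf c0 c1 r1 tau0 rtau tr h0 g0 hLam; have hh := ent_derive hf.
have [L [cL mL _ hL]] := difference_estimate hh r1 tau0 rtau tr h0 hLam.
have r0 : 0 <= r by lra.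
have ch := rcircle_lnmean r0 hh h0.
apply: (@le_trans _ _ (lnmean (f^`())%classic r + smean L r)); last by rewrite lerD2l.
rewrite /lnmean -smeanD//; apply: le_smean => //.
- by apply: rcircle_lnmean => //; exact: ent_div_diff.
- exact: rcircleD.
move=> z zr; rewrite -[L z]expRK -lnM ?posrE ?expR_gt0 ?normc_gt0 ?h0//.
rewrite ler_ln ?posrE ?mulr_gt0 ?expR_gt0 ?normc_gt0 ?h0 ?g0//.
apply: div_diff_bound => //; first by rewrite mulr_ge0 ?expR_ge0.
by move=> w wc; apply: hL => //; exact: le_trans c1.
Qed.

(** Takes the place of the lemma on the logarithmic derivative: |f'(z)| is at most 8 times the
    maximum of |f| on the unit disc about [z], hence at most 8 |f(z)| exp (L z). *)
Lemma m_proximity_derive_le f r (tau Lam : R) : ent f -> 1 < r -> 0 < tau ->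
  1 <= tau ^+ 3 * r ^+ 2 -> 2 <= tau * r -> zero_free f r ->
  (forall z, normc z = 6 * r -> normc (f z) <= expR Lam) ->
  m_proximity (f^`())%classic r <=
    m_proximity f r + 4 * tau * (Lam + ln 4 - lnmean f r) + ln 8.
Proof.
move=> hf r1 tau0 rtau tr f0 hLam.
have [L [cL mL _ hL]] := difference_estimate hf r1 tau0 rtau tr f0 hLam.
have r0 : 0 <= r by lra.
have cf := rcircle_logp_ent r0 hf.
apply: (@le_trans _ _ (m_proximity f r + smean L r + ln 8)); last by rewrite lerD2r lerD2l.
have -> : m_proximity f r + smean L r + ln 8 =
    smean (fun z => logp (normc (f z)) + L z + ln 8) r.
  rewrite m_proximityE smeanD ?smean_cst ?smeanD//; last exact: rcircle_cst.
  exact: rcircleD.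
rewrite m_proximityE; apply: le_smean => //.
- by apply: rcircle_logp_ent => //; exact: ent_derive.
- by apply: rcircleD; [exact: rcircleD|exact: rcircle_cst].
move=> z zr; have fz : 0 < normc (f z) by rewrite normc_gt0 f0.
have L0 : 0 <= L z.
  have := hL z 0 zr; rewrite normc0 ler01 addr0 => /(_ isT).
  by rewrite -{1}[normc (f z)]mulr1 ler_pM2l// -expR0 ler_expR.
have d8 : normc ((f^`())%classic z) <= normc (f z) * expR (L z) * 8.
  by rewrite [leRHS]mulrC; apply: derive_bound => // w w1; exact: hL.
apply: le_trans (logp_mono _ d8) _ => //.
apply: le_trans (logp_mul _ _) _ => //; first by rewrite mulr_gt0// expR_gt0.
have l8 : logp 8 = ln (8 : R) by rewrite /logp max_r// ln_ge0//; lra.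
rewrite l8 lerD2r; apply: le_trans (logp_mul _ _) _ => //; first exact: expR_gt0.
by rewrite lerD2l /logp expRK max_r.
Qed.

(* Since the pair indices are lower limits, arbitrarily large radii suffice; those of
   [growth_radius] make every error term small compared with [m_proximity f r]. *)
Theorem frequent_pair_bound f (eta : R -> C) (alpha : R -> R) A (d e : R) :
  ent f -> ~ (exists a, forall z, f z = a) -> finite_order f ->
  alpha r @[r --> +oo] --> 0 ->
  (forall r, 0 < r -> 0 < normc (eta r) < alpha r) ->
  (forall r, 0 < r -> ~ periodic f (eta r)) -> uniq A ->
  d <= 1 -> 0 < e ->
  (exists r0, forall r, r0 <= r -> d * m_proximity (f^`())%classic r <=
    m_proximity (fun z => ((f^`())%classic z)^-1) r) ->
  forall r0, exists r, [/\ r0 <= r, 0 < m_proximity f r &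
    \sum_(a <- A) N_pairs f (eta r) a r <= (1 - d + e) * m_proximity f r].
Proof.
move=> hf nc fo alpha0 eta_small np uA d1 e0 [rd hd] r0.
set h := (f^`())%classic in hd *; have hh : ent h by exact: ent_derive.
have nf := nonconstant_nonzero nc; have nh : nonzero h by exact: derive_nonzero.
have [K K0 growth] := growth_radius hf nc fo.
have [Bf hBf] := lnmean_lower hf nf; have [Bh hBh] := lnmean_lower hh nh.
have [rho rho0 isol] := isolated_values A hf nc.
have rho42 : rho / 4 < rho / 2 by lra.
have [rho1 /andP[rho1l rho1u] [zh _ _]] := generic_radius3 rho42 hh nh hh nh hh nh.
have rho10 : 0 < rho1 by lra.
have [Bg [eta0 eta00 hg]] := div_diff_lower hf rho10 zh.
(* Three errors [e1 * T] enter the bound for the proximity of f', where they get multiplied by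
   [1 - d]; at most three more are added at the end. *)
pose e1 := e / (3 * (1 - d) + 3).
have e10 : 0 < e1 by rewrite divr_gt0//; lra.
(* The quantities multiplied by [4 * tau] in both shift estimates will be at most [(3 * K + 4) * T],
   so each error is at most [e1 * T]. *)
pose tau := e1 / (4 * (3 * K + 4)).
have tau0 : 0 < tau by rewrite divr_gt0// mulr_gt0//; lra.
have [r2 hr2] := m_proximity_unbounded
  (1 + (`|Bf| + `|Bh| + ln 4 + ln 8) + (ln 8 + `|Bg|) / e1) hf nc.
have [rc hrc] : exists rc, forall r, rc < r -> alpha r < Num.min 1 (Num.min (rho / 2) eta0).
  have m0 : 0 < Num.min 1 (Num.min (rho / 2) eta0) by rewrite !lt_min ltr01 eta00 divr_gt0.
  move/cvgrPdist_lt : alpha0 => /(_ _ m0)[rc [_ hrc]]; exists rc => r /hrc.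
  by rewrite sub0r normrN; apply: le_lt_trans; exact: ler_norm.
(* The entry [7 + rho] gives [6 * s + 1 <= S / 2] for the radii s < r + 1 and S > 16 r chosen below;
   the last two give the conditions on [tau] in the shift estimates. *)
pose rmin := Num.max r0 (Num.max rd (Num.max r2 (Num.max (rc + 1) (Num.max (7 + rho)
  (Num.max (2 / tau) (tau ^+ 3)^-1))))).
have [r rmr Kr] := growth rmin.
exists r; move: rmr; rewrite /rmin !ge_max => /and5P[rr0 rrd rr2 rrc /and3P[r7 rt1 rt2]].
have rpos : 0 < r by lra.
set T := m_proximity f r.
have lr2 := hr2 r rr2; rewrite -/T in lr2.
have l4 : 0 <= ln (4 : R) by apply: ln_ge0; rewrite ler1n.
have l8 : 0 <= ln (8 : R) by apply: ln_ge0; rewrite ler1n.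
have nBf := normr_ge0 Bf; have nBh := normr_ge0 Bh; have nBg := normr_ge0 Bg.
have q0 : 0 <= (ln 8 + `|Bg|) / e1 by rewrite divr_ge0 ?addr_ge0// ltW.
have T1 : 1 + (`|Bf| + `|Bh| + ln 4 + ln 8) < T by clear -lr2 q0; lra.
have T2 : ln 8 + `|Bg| <= e1 * T by rewrite mulrC -ler_pdivrMr//; clear -lr2 nBf nBh l4 l8; lra.
have T0 : 0 < T by clear -T1 nBf nBh l4 l8; lra.
split=> //.
have /andP[c0 calpha] := eta_small r rpos; set c := eta r in c0 calpha *.
have cmin : normc c < Num.min 1 (Num.min (rho / 2) eta0).
  by apply: lt_trans calpha (hrc _ _); clear -rrc; lra.
move: cmin; rewrite !lt_min => /and3P[c1 crho ceta].
rewrite normc_gt0 in c0.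
have hgc := ent_div_diff c hf; have ngc := div_diff_nonzero c0 (np r rpos).
have [gf glow] := hg c c0 ceta.
have e1T : 0 < e1 * T by rewrite mulr_gt0.
have [dl dl0 hdl] := m_proximity_right_cont (ltW rpos) hf e1T.
have rs : r < r + Num.min 1 dl by rewrite ltrDl lt_min ltr01.
have [s /andP[rs1 rs2] [sf sh sg]] := generic_radius3 rs hf nf hh nh hgc ngc.
have s1 : s < r + 1 by rewrite (lt_le_trans rs2)// lerD2l ge_min lexx.
have sdl : s < r + dl by rewrite (lt_le_trans rs2)// lerD2l ge_min lexx orbT.
have mS : m_proximity f s <= T + e1 * T by apply: hdl; rewrite (ltW rs1).
have r16 : 0 <= 16 * r by clear -rpos; lra.
have [dR dR0 hdR] := m_proximity_right_cont r16 hf ltr01.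
have RR : 16 * r < 16 * r + dR by rewrite ltrDl.
have [S /andP[RS1 RS2] [Sf _ _]] := generic_radius3 RR hf nf hf nf hf nf.
have S0 : 0 < S by clear -RS1 r16; lra.
have mR : m_proximity f S <= K * T + 1.
  apply: le_trans (hdR S _) _; first by rewrite (ltW RS1).
  by rewrite lerD2r.
pose Lf := 3 * (K * T + 1); pose Lh := Lf + ln 8.
have boundf z : normc z <= S / 2 -> normc (f z) <= expR Lf.
  move=> zS; apply: le_trans (normc_le_exp_m_proximity S0 hf Sf zS) _.
  by rewrite ler_expR ler_pM2l.
have boundf6 z : normc z = 6 * s -> normc (f z) <= expR Lf.
  by move=> zs; apply: boundf; rewrite zs; clear -s1 RS1 r7 rho0; lra.
have boundh6 z : normc z = 6 * s -> normc (h z) <= expR Lh.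
  move=> zs; have -> : expR Lh = 8 * expR Lf by rewrite /Lh expRD lnK ?posrE// mulrC.
  apply: derive_bound => // w w1; apply: boundf.
  by apply: le_trans (le_normcD _ _) _; rewrite zs; clear -s1 RS1 r7 rho0 w1; lra.
have s_gt1 : 1 < s by clear -r7 rho0 rs1; lra.
have tau30 : 0 < tau ^+ 3 by rewrite exprn_gt0.
have ts1 : 1 <= tau ^+ 3 * s ^+ 2.
  have : 1 <= tau ^+ 3 * s.
    by rewrite -ler_pdivrMl// mulr1 (le_trans rt2)// ltW.
  move=> h1; apply: le_trans h1 _; rewrite ler_pM2l// expr2.
  by have s0 := ltW (lt_trans ltr01 s_gt1); rewrite ler_peMr// ltW.
have ts2 : 2 <= tau * s by rewrite mulrC -ler_pdivrMr// (le_trans rt1)// ltW.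
have s2 : 2 <= s by clear -r7 rho0 rs1; lra.
have lowf := hBf s s2 sf; have lowh := hBh s s2 sh.
have nf1 := ler_norm Bf; have nh1 := ler_norm Bh; have ng1 := ler_norm Bg.
have KT : 0 < K * T by rewrite mulr_gt0.
have tauE : 4 * tau * ((3 * K + 4) * T) = e1 * T.
  have K4 : 3 * K + 4 != 0 by rewrite gt_eqF// addr_gt0// mulr_gt0.
  by clear -K4; rewrite /tau; field.
have err x : x <= (3 * K + 4) * T -> 4 * tau * x <= e1 * T.
  by move=> hx; rewrite -tauE ler_pM2l// mulr_gt0.
have M1 := m_proximity_derive_le hf s_gt1 tau0 ts1 ts2 sf boundf6; rewrite -/h in M1.
have M2 := lnmean_div_diff_le hf c0 (ltW c1) s_gt1 tau0 ts1 ts2 sh sg boundh6; rewrite -/h in M2.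
have E1 : 4 * tau * (Lf + ln 4 - lnmean f s) <= e1 * T.
  by apply: err; clear -T1 nf1 lowf nBf nBh l4 l8; rewrite /Lf; lra.
have E2 : 4 * tau * (Lh + ln 4 - lnmean h s) <= e1 * T.
  by apply: err; clear -T1 nh1 lowh nBf nBh l4 l8; rewrite /Lh /Lf; lra.
have spos : 0 <= s by rewrite (le_trans _ s2).
have JH := lnmean_proximity spos hh sh.
have rds : rd <= s by rewrite (le_trans rrd)// ltW.
have Dm := hd s rds.
have [l [q [hq _ gE qz]]] := factor_disc hgc spos ngc.
have rho1s : rho1 <= s by clear -rho1u r7 rs1 rho0; lra.
have J := jensen_annulus rho10 rho1s hq qz gE gf sg.
have CNT := @sum_N_pairs_le _ f c A l q rho1 r s hf c0 uA rho10 rho1s rpos (ltW rs1) hq qz gE.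
have {}CNT : \sum_(a <- A) N_pairs f c a r <= lnmean (div_diff f c) s - lnmean (div_diff f c) rho1.
  rewrite J; apply: CNT => z zrho fzA; apply/negP => /eqP fzc.
  (* A pair in the small disc must start at 0, the one point there where [f] can take a value in
     [A]; then [f c] is in [A] with 0 < |c| < rho, a contradiction. *)
  have z0 : z = 0.
    apply/eqP; rewrite -normc_eq0 eq_le normc_ge0 andbT leNgt; apply/negP => zpos.
    have := isol z; rewrite zpos fzA => H; apply: notF; apply: H; clear -zrho rho1u rho0; lra.
  have := isol (z + c); rewrite fzc fzA z0 add0r normc_gt0 c0 /= => H.
  by apply: notF; apply: H; clear -crho rho0; lra.
have mh : m_proximity h s <= T + 3 * (e1 * T) by clear -M1 mS E1 T2 nBg; lra.
have mh' : (1 - d) * m_proximity h s <= (1 - d) * (T + 3 * (e1 * T)).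
  by rewrite ler_wpM2l// subr_ge0.
have eE : (1 - d) * (T + 3 * (e1 * T)) + 3 * (e1 * T) = (1 - d + e) * T.
  have d3 : 3 * (1 - d) + 3 != 0 by rewrite gt_eqF//; clear -d1; lra.
  by clear -d3; rewrite /e1; field.
(* The sum is at most the mean of ln|g| at [s] plus |Bg|, hence at most the mean of ln|f'| plus
   errors. That mean is m(s, f') - m(s, 1/f'), at most (1 - d) m(s, f'). *)
by rewrite -eE; clear -CNT glow ng1 M2 E2 JH Dm mh' T2 l8 e1T; lra.
Qed.

End SeparatedPairs.

(** * Lower limits of finite sums *)

Section LowerLimits.
Set Implicit Arguments.
Unset Strict Implicit.
Variable R : realType.
Local Notation C := R[i].
Local Open Scope ereal_scope.

Lemma limf_einf_gt (u : R -> \bar R) (x : \bar R) : x < limf_einf u (pinfty_nbhs R) ->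
  exists M : R, forall r, (M < r)%R -> x < u r.
Proof.
rewrite limf_einfE => /ereal_sup_gt[_ [V [M [_ hM]] <-] xV].
exists M => r /hM Vr; apply: lt_le_trans xV _.
by apply: ereal_inf_lbound; exists r.
Qed.

Lemma lte_between (x : R) (S : \bar R) : x%:E < S -> exists2 y : R, (x < y)%R & y%:E < S.
Proof.
case: S => [s| |//].
  by rewrite lte_fin => xs; exists ((x + s) / 2)%R; rewrite ?lte_fin; lra.
by move=> _; exists (x + 1)%R; [lra|exact: ltry].
Qed.

(** A sum with one term -oo is -oo, even against +oo, so the hypothesis leaves only finite or +oo
    terms. *)
Lemma lte_addP (x : R) (p q : \bar R) : x%:E < p + q ->
  exists y z : R, [/\ (x <= y + z)%R, y%:E < p & z%:E < q].
Proof.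
case: p q => [p| |] [q| |] //=.
- rewrite -EFinD lte_fin => h.
  exists (p - (p + q - x) / 2)%R, (q - (p + q - x) / 2)%R; rewrite !lte_fin.
  by split; lra.
- by move=> _; exists (p - 1)%R, (x - p + 1)%R; rewrite lte_fin ltry; split => //; lra.
- by move=> _; exists (x - q + 1)%R, (q - 1)%R; rewrite lte_fin ltry; split => //; lra.
- by move=> _; exists x, 0%R; rewrite !ltry addr0.
Qed.

Lemma limf_einf_sum_gt (I : Type) (l : seq I) (u : I -> R -> R) (x : R) :
  x%:E < \sum_(i <- l) limf_einf (fun r => (u i r)%:E) (pinfty_nbhs R) ->
  exists M : R, forall r, (M < r)%R -> (x < \sum_(i <- l) u i r)%R.
Proof.
elim: l x => [|i l IH] x.
  by rewrite big_nil lte_fin => x0; exists 0%R => r _; rewrite big_nil.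
rewrite big_cons => /lte_addP[y [z [xyz /limf_einf_gt[M1 h1] /IH[M2 h2]]]].
exists (Num.max M1 M2) => r; rewrite gt_max => /andP[/h1 + /h2 h].
by rewrite big_cons lte_fin => h'; lra.
Qed.

End LowerLimits.

(** * Bounds for the deficiency *)

Section Deficiency.
Set Implicit Arguments.
Unset Strict Implicit.
Variable R : realType.
Local Notation C := R[i].

Lemma deficiency0_gt (h : C -> C) (d : R) : ent h -> (d%:E < deficiency0 h)%E ->
  exists r0, forall r, r0 <= r -> d * m_proximity h r <= m_proximity (fun z => (h z)^-1) r.
Proof.
move=> hh /limf_einf_gt[M hM]; exists (M + 1) => r rM.
have := hM r; rewrite T_char_ent// lte_fin => /(_ _) H.
have {}H : d < m_proximity (fun z => (h z)^-1) r / m_proximity h r by apply: H; lra.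
have := m_proximity_ge0 h r; rewrite le_eqVlt => /predU1P[<-|m0].
  by rewrite mulr0 m_proximity_ge0.
by rewrite -ler_pdivlMr// ltW.
Qed.

(** For nonconstant [h], m(r, 1/h) exceeds m(r, h) by at most a constant, since the mean of ln|h| is
    bounded below on generic circles, while m(r, h) is unbounded. Constants are treated apart
    because their characteristic may be 0. *)
Lemma deficiency0_le1 (h : C -> C) : ent h -> nonzero h -> (deficiency0 h <= 1)%E.
Proof.
move=> hh nh; rewrite leNgt; apply/negP => /lte_between[d d1 hd].
have [[a ha]|nc] := pselect (exists a, forall z, h z = a).
  have [M hM] := limf_einf_gt hd.
  have := hM (M + 1); rewrite ltrDl ltr01 T_char_ent// lte_fin => /(_ isT).
  have mE (g : C -> C) b r : (forall z, g z = b) -> m_proximity g r = logp (normc b).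
    move=> gb; rewrite m_proximityE -[RHS](smean_cst _ r).
    by congr (_ * _); apply: eq_rint => t _; rewrite gb.
  rewrite (mE _ a^-1) => [|z]; last by rewrite ha.
  rewrite (mE _ a)//.
  have a0 : 0 < normc a by case: nh => z; rewrite ha normc_gt0.
  (* One of the two proximities of a constant and its inverse is 0, so the quotient is 0, by
     [x / 0 = 0] if it is the denominator. *)
  rewrite normcV /logp lnV ?posrE//; move: (ln _) => x.
  by case: (leP 0 x) => x0; [rewrite max_l|]; rewrite ?mul0r ?oppr_le0 ?invr0 ?mulr0//; lra.
have [r0 hr0] := deficiency0_gt hh hd.
have [B hB] := lnmean_lower hh nh.
have [r1 hr1] := m_proximity_unbounded (B / (d - 1)) hh nc.
pose r := Num.max 2 (Num.max r0 r1).
have rr : r < r + 1 by rewrite ltrDl.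
have [s /andP[s1 _] [zs _ _]] := generic_radius3 rr hh nh hh nh hh nh.
have : [/\ 2 <= r, r0 <= r & r1 <= r] by rewrite !le_max !lexx !orbT.
case=> h1 h2 h3; have s2 : 2 <= s by lra.
have s0 : 0 <= s by lra.
have := hB s s2 zs; rewrite (lnmean_proximity s0 hh zs).
have := hr0 s; have := hr1 s.
move=> /(_ _)/wrap[|H1]; first by lra.
move=> /(_ _)/wrap[|H2]; first by lra.
have dd : 0 < d - 1 by lra.
by move: H1; rewrite ltr_pdivrMr//; lra.
Qed.

End Deficiency.

Theorem proposition6p4 (R : realType) (f : R[i] -> R[i])
    (alpha : R -> R) (eta : R -> R[i])
    (f_entire : entire f)
    (f_nonconstant : ~ (exists a, forall z, f z = a))
    (f_finite_order : finite_order f)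
    (alpha_to0 : alpha r @[r --> +oo] --> 0)
    (eta_small : forall r, 0 < r -> 0 < Normc.normc (eta r) < alpha r)
    (f_not_periodic : forall r, 0 < r -> ~ periodic f (eta r)) :
  (\esum_(a in [set: R[i]]) pair_index f eta a <= 1 - deficiency0 (f^`())%classic)%E.
Proof.
have hf := entire_holo f_entire; have hh := ent_derive hf.
have nh := derive_nonzero hf f_nonconstant.
have := deficiency0_le1 hh nh.
(* The value +oo contradicts the bound 1, and -oo makes the right-hand side +oo. *)
case defE : (deficiency0 _) => [d0| |] //; last by rewrite leey.
rewrite lee_fin => d01; rewrite -EFinB.
apply: ge_ereal_sup => _ [A [finA _] <-].
have [A' ->] := (finite_seqP _).1 finA.
have -> : [set` A']%classic = [set` undup A']%classic :> set R[i].
  by apply/seteqP; split=> z /=; rewrite mem_undup.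
rewrite -fsbig_seq ?undup_uniq//; set l := undup A'.
rewrite leNgt; apply/negP => /lte_between[x x0 /limf_einf_sum_gt[M hM]].
(* Half of the gap lowers [d0] to a number strictly below the deficiency, the other half is the
   error allowed in [frequent_pair_bound]; together they give exactly the constant [x]. *)
pose e := (x - (1 - d0)) / 2; have e0 : 0 < e by rewrite /e; lra.
have dlt : ((d0 - e)%:E < deficiency0 (f^`())%classic)%E by rewrite defE lte_fin; lra.
have dle : d0 - e <= 1 by lra.
have [r [rM T0]] := frequent_pair_bound hf f_nonconstant f_finite_order alpha_to0 eta_small
  f_not_periodic (undup_uniq A') dle e0 (deficiency0_gt hh dlt) (M + 1).
have -> : 1 - (d0 - e) + e = x by rewrite /e; field.
rewrite -ler_pdivrMr// -/l leNgt => /negP; apply.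
have Mr : M < r by lra.
have := hM r Mr; rewrite mulr_suml.
by under [X in x < X]eq_bigr do rewrite T_char_ent//.
Qed.
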